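(* Let $\Gamma$ be a countable exact group. If the first $\ell^2$-Betti number of $\Gamma$ satisfies $\beta_1^{(2)}(\Gamma)>0$, then $\Gamma$ is properly proximal.
   Context: Proper proximality (in the sense of Boutonnet–Ioana–Peterson): for a countable group $\Gamma$, let $R_t$ denote right translation on $\ell^\infty(\Gamma)$, $(R_tf)(s)=f(st)$, and let $\mathbb S(\Gamma)=\{f\in\ell^\infty(\Gamma) : f-R_tf\in c_0(\Gamma)\ \text{for all } t\in\Gamma\}$, a unital C$^*$-algebra on which $\Gamma$ acts by left translation. The group $\Gamma$ is properly proximal if there is no left-$\Gamma$-invariant state on $\mathbb S(\Gamma)$. A group is exact if its reduced C$^*$-algebra $C^*_r(\Gamma)$ is exact (equivalently, $\Gamma$ admits a topologically amenable action on some compact Hausdorff space). *)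

(* Defs.v *)
From HB Require Import structures.
From mathcomp Require Import all_boot all_order all_algebra.
From mathcomp Require Import all_classical all_reals.
From mathcomp Require Import ereal esum.
From mathcomp Require Import complex lra.

Set Implicit Arguments.
Unset Strict Implicit.
Unset Printing Implicit Defensive.
Import Order.TTheory GRing.Theory Num.Theory.
Import ComplexField.Normc.

Local Open Scope classical_set_scope.
Local Open Scope ring_scope.
Local Open Scope complex_scope.

(* Hilbert spaces are taken in the form l^2(I) with I an arbitrary type: every
   complex Hilbert space is isometric to one of these. normsq is the squared
   l^2-norm, valued in the extended reals. *)
Section ell2.
Variables (R : realType) (I : choiceType).
Implicit Types f g : I -> R[i].

Definition normsq f : \bar R := (\esum_(i in [set: I]) (normc (f i) ^+ 2)%:E)%E.

Definition square_summable : {pred I -> R[i]} :=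
  [pred f | `[< (normsq f < +oo)%E >]].

Lemma normsq_ge0 f : (0 <= normsq f)%E.
Proof. by apply: esum_ge0 => i _; rewrite lee_fin sqr_ge0. Qed.

Lemma normsq0 : normsq 0 = 0%E.
Proof. by apply: esum1 => i _; rewrite normc0 expr0n. Qed.

Lemma esumZ (k : R) (a : I -> R) : 0 <= k -> (forall i, 0 <= a i) ->
  (\esum_(i in [set: I]) (k * a i)%:E <= k%:E * \esum_(i in [set: I]) (a i)%:E)%E.
Proof.
move=> k0 a0; apply: ge_ereal_sup => /= _ [F [finF _] <-].
under eq_fsbigr do rewrite EFinM.
rewrite -ge0_mule_fsumr; last by move=> i; rewrite lee_fin.
apply: lee_wpmul2l; first by rewrite lee_fin.
by apply: ereal_sup_ubound; exists F.
Qed.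

Lemma normsqZ (c : R[i]) f : (normsq (c *: f)%R <= (normc c ^+ 2)%:E * normsq f)%E.
Proof.
rewrite /normsq; under eq_esum do rewrite normcM exprMn.
by apply: esumZ => [|i]; exact: sqr_ge0.
Qed.

Lemma normsqD f g : (normsq (f + g)%R <= 2%:E * (normsq f + normsq g))%E.
Proof.
have nn (h : I -> R[i]) i : 0 <= normc (h i) by case: (h i) => x y; exact: sqrtr_ge0.
rewrite /normsq -esumD; try by move=> i _; rewrite lee_fin sqr_ge0.
under [X in (2%:E * X)%E]eq_esum do rewrite -EFinD.
apply: le_trans (esumZ _ _) => //; last by move=> i; rewrite addr_ge0 ?sqr_ge0.
apply: le_esum => i _; rewrite lee_fin.
apply: (@le_trans _ _ ((normc (f i) + normc (g i)) ^+ 2)).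
  by apply: lerXn2r; rewrite ?nnegrE ?addr_ge0 ?le_normcD//; exact: (nn (f + g)).
by have := sqr_ge0 (normc (f i) - normc (g i)); rewrite sqrrB sqrrD; lra.
Qed.

Lemma square_summable_submod : submod_closed square_summable.
Proof.
split=> [|c f g /asboolP ff /asboolP gf]; apply/asboolP.
  by rewrite normsq0 ltry.
apply: le_lt_trans (normsqD _ _) _; rewrite lte_mul_pinfty// ?lte_add_pinfty//.
by apply: le_lt_trans (normsqZ _ _) _; rewrite lte_mul_pinfty// lee_fin sqr_ge0.
Qed.

HB.instance Definition _ := GRing.isSubmodClosed.Build _ _ square_summable
  square_summable_submod.

Record ell2 := Ell2 {ell2_fun :> I -> R[i]; _ : ell2_fun \in square_summable}.
HB.instance Definition _ := [isSub for ell2_fun].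
HB.instance Definition _ := [Choice of ell2 by <:].
HB.instance Definition _ := [SubChoice_isSubLmodule of ell2 by <:].

Lemma delta_square_summable (i : I) :
  (fun j => (j == i)%:R) \in square_summable.
Proof.
apply/asboolP; rewrite /normsq.
rewrite (esumID [set i])//; last by move=> j _; rewrite lee_fin sqr_ge0.
rewrite setTI esum_set1 ?lee_fin ?sqr_ge0// esum1 ?adde0 ?ltry// => j [_ /eqP].
by move=> /= /negPf ->; rewrite normc0 expr0n.
Qed.

Definition delta (i : I) : ell2 := Ell2 (delta_square_summable i).

(* For 0 <= M, this says that the operator norm of T is at most M. *)
Definition opnorm_le (T : ell2 -> ell2) (M : R) : Prop :=
  forall xi : ell2, (normsq (T xi) <= (M ^+ 2)%:E * normsq xi)%E.

Definition bounded_linear : {pred ell2 -> ell2} :=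
  [pred T | `[< linear T /\ exists M, opnorm_le T M >]].

Lemma bounded_linear_submod : submod_closed bounded_linear.
Proof.
split=> [|c S T /asboolP[lS [M SM]] /asboolP[lT [N TN]]]; apply/asboolP; split.
- by move=> a u v /=; rewrite scaler0 addr0.
- exists 0 => xi; rewrite expr0n mul0e.
  have -> : ell2_fun ((0 : ell2 -> ell2) xi) = 0 by [].
  by rewrite normsq0.
- move=> a u v; rewrite /= !fctE /= lS lT !scalerDr !scalerA [c * a]mulrC.
  by rewrite addrACA.
- exists (Num.sqrt (2 * (normc c ^+ 2 * M ^+ 2 + N ^+ 2))) => xi.
  have k0 : 0 <= 2 * (normc c ^+ 2 * M ^+ 2 + N ^+ 2) :> R.
    have := sqr_ge0 (normc c * M); rewrite exprMn; have := sqr_ge0 N; lra.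
  rewrite sqr_sqrtr//.
  have -> : ell2_fun ((c *: S + T) xi) = c *: ell2_fun (S xi) + ell2_fun (T xi).
    by [].
  apply: le_trans (normsqD _ _) _.
  rewrite EFinM -muleA; apply: lee_wpmul2l; first by rewrite lee_fin.
  have cM0 : 0 <= normc c ^+ 2 * M ^+ 2 by apply: mulr_ge0; exact: sqr_ge0.
  rewrite EFinD ge0_muleDl ?lee_fin ?sqr_ge0//.
  apply: leeD; last exact: TN.
  apply: le_trans (normsqZ _ _) _.
  rewrite [X in (_ <= X * _)%E]EFinM -muleA; apply: lee_wpmul2l; last exact: SM.
  by rewrite lee_fin sqr_ge0.
Qed.

HB.instance Definition _ := GRing.isSubmodClosed.Build _ _ bounded_linear
  bounded_linear_submod.

Record bop := Bop {bop_fun :> ell2 -> ell2; _ : bop_fun \in bounded_linear}.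
HB.instance Definition _ := [isSub for bop_fun].
HB.instance Definition _ := [Choice of bop by <:].
HB.instance Definition _ := [SubChoice_isSubLmodule of bop by <:].

Lemma bop_linear (T : bop) : linear T.
Proof. by have /asboolP[] := valP T. Qed.

Lemma bop_bounded (T : bop) : exists M, opnorm_le T M.
Proof. by have /asboolP[] := valP T. Qed.

HB.instance Definition _ (T : bop) :=
  GRing.isLinear.Build _ _ _ _ (bop_fun T) (bop_linear T).

Lemma bop_id_subproof : (id : ell2 -> ell2) \in bounded_linear.
Proof.
apply/asboolP; split=> //; exists 1 => xi.
by rewrite expr1n mul1e.
Qed.

Lemma bop_comp_subproof (S T : bop) :
  ((S : ell2 -> ell2) \o T) \in bounded_linear.
Proof.
apply/asboolP; split=> [c u v|]; first by rewrite /= !linearP.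
have [M SM] := bop_bounded S; have [N TN] := bop_bounded T.
exists (M * N) => xi /=; apply: le_trans (SM _) _.
rewrite exprMn [X in (_ <= X * _)%E]EFinM -muleA; apply: lee_wpmul2l; last exact: TN.
by rewrite lee_fin sqr_ge0.
Qed.

Definition bop_id : bop := Bop bop_id_subproof.
Definition bop_comp (S T : bop) : bop := Bop (bop_comp_subproof S T).

Lemma bop_eqP (S T : bop) : (forall xi, S xi = T xi) -> S = T.
Proof. by move=> ST; apply: val_inj; apply/funext. Qed.

Lemma bop_compA : associative bop_comp.
Proof. by move=> A B D; apply: bop_eqP. Qed.

Lemma bop_comp1l : left_id bop_id bop_comp.
Proof. by move=> A; apply: bop_eqP. Qed.

Lemma bop_comp1r : right_id bop_id bop_comp.
Proof. by move=> A; apply: bop_eqP. Qed.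

Lemma bop_compDl : left_distributive bop_comp +%R.
Proof. by move=> A B D; apply: bop_eqP. Qed.

Lemma bop_compDr : right_distributive bop_comp +%R.
Proof. by move=> A B D; apply: bop_eqP => xi /=; rewrite /= linearD. Qed.

(* The product of the ring B(l^2(I)) = bop is composition of operators. *)
HB.instance Definition _ := GRing.Zmodule_isPzRing.Build bop
  bop_compA bop_comp1l bop_comp1r bop_compDl bop_compDr.
End ell2.

Section cstar_algebras.
Variable R : realType.
Implicit Types I J K : choiceType.

(* A bounded operator on l^2(I) is determined by its matrix coefficients
   (T delta_j)(i); adjoints and spatial tensor products are expressed through
   them. *)
Definition is_adjoint I (T S : bop R I) : Prop :=
  forall i j, S (delta R j) i = conjc (T (delta R i) j).

Definition norm_closure I (A : set (bop R I)) : set (bop R I) :=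
  [set T | forall eps : R, 0 < eps ->
     exists S, A S /\ opnorm_le (T - S : bop R I) eps].

Definition cstar_subalgebra I (A : set (bop R I)) : Prop :=
  [/\ A 0,
      forall (c : R[i]) S T, A S -> A T -> A (c *: S + T),
      forall S T, A S -> A T -> A (S * T),
      forall S T, A S -> is_adjoint S T -> A T &
      norm_closure A `<=` A].

Definition star_homomorphism I J (B : set (bop R I))
    (pi : bop R I -> bop R J) : Prop :=
  [/\ forall (c : R[i]) S T, B S -> B T -> pi (c *: S + T) = c *: pi S + pi T,
      forall S T, B S -> B T -> pi (S * T) = pi S * pi T &
      forall S T, B S -> is_adjoint S T -> is_adjoint (pi S) (pi T)].

(* X = S (x) T, as an operator on l^2(I) (x) l^2(K) = l^2(I * K). *)
Definition is_tensor I K (S : bop R I) (T : bop R K)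
    (X : bop R (I * K)%type) : Prop :=
  forall i j k l,
    X (delta R (j, l)) (i, k) = S (delta R j) i * T (delta R l) k.

Definition algebraic_tensor I K (B : set (bop R I)) (A : set (bop R K)) :
    set (bop R (I * K)%type) :=
  [set X | exists n (b : 'I_n -> bop R I) (a : 'I_n -> bop R K)
                  (t : 'I_n -> bop R (I * K)%type),
     (forall m, [/\ B (b m), A (a m) & is_tensor (b m) (a m) (t m)]) /\
     X = \sum_(m < n) t m].

Definition min_tensor I K (B : set (bop R I)) (A : set (bop R K)) :
    set (bop R (I * K)%type) :=
  norm_closure (algebraic_tensor B A).

(* Y = (pi (x) id)(X), where pi (x) id : B (x)_min A -> pi(B) (x)_min A is the
   continuous extension of sum_m b_m (x) a_m |-> sum_m pi(b_m) (x) a_m: the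
   graph of the former is the norm closure of the graph of the latter. *)
Definition min_tensor_map I J K (B : set (bop R I)) (A : set (bop R K))
    (pi : bop R I -> bop R J)
    (X : bop R (I * K)%type) (Y : bop R (J * K)%type) : Prop :=
  forall eps : R, 0 < eps ->
    exists n (b : 'I_n -> bop R I) (a : 'I_n -> bop R K)
           (t : 'I_n -> bop R (I * K)%type) (s : 'I_n -> bop R (J * K)%type),
      [/\ forall m, [/\ B (b m), A (a m), is_tensor (b m) (a m) (t m) &
                       is_tensor (pi (b m)) (a m) (s m)],
          opnorm_le (X - \sum_(m < n) t m : bop R (I * K)%type) eps &
          opnorm_le (Y - \sum_(m < n) s m : bop R (J * K)%type) eps].

(* A is exact if - (x)_min A preserves short exact sequences of C*-algebras.
   Such a sequence is 0 -> ker pi -> B -> pi(B) -> 0 for a *-homomorphism pi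
   between concrete C*-algebras. For the minimal tensor product, injectivity on
   the left, surjectivity on the right and the inclusion of ker pi (x)_min A in
   the kernel of pi (x) id always hold, so exactness is the remaining
   inclusion. *)
Definition exact_cstar K (A : set (bop R K)) : Prop :=
  forall I J (B : set (bop R I)) (pi : bop R I -> bop R J),
    cstar_subalgebra B -> star_homomorphism B pi ->
    forall X : bop R (I * K)%type,
      min_tensor_map B A pi X 0 -> min_tensor (B `&` [set b | pi b = 0]) A X.

End cstar_algebras.

Section regular_representation.
Variables (R : realType) (G : groupType).

Lemma normsq_comp (I : choiceType) (e e' : I -> I) (f : I -> R[i]) :
  cancel e e' -> cancel e' e -> normsq (f \o e) = normsq f.
Proof.
move=> eK e'K; rewrite /normsq [RHS](@reindex_esum _ _ _ setT _ e)//.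
split=> // [x y _ _ /(can_inj eK)//|y _]; by exists (e' y).
Qed.

Section reindexing.
Variables (I : choiceType) (e e' : I -> I) (eK : cancel e e') (e'K : cancel e' e).

Lemma reindex_square_summable (xi : ell2 R I) :
  xi \o e \in @square_summable R I.
Proof. by apply/asboolP; rewrite (normsq_comp _ eK e'K); have /asboolP := valP xi. Qed.

Definition reindex_ell2 (xi : ell2 R I) : ell2 R I :=
  Ell2 (reindex_square_summable xi).

Lemma reindex_bounded_linear : reindex_ell2 \in @bounded_linear R I.
Proof.
apply/asboolP; split=> [c u v|]; first exact: val_inj.
by exists 1 => xi; rewrite expr1n mul1e /= (normsq_comp _ eK e'K).
Qed.

Definition reindex_bop : bop R I := Bop reindex_bounded_linear.
End reindexing.

(* (lreg g xi)(s) = xi(g^-1 s) and (rreg g xi)(s) = xi(s g). *)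
Definition lreg (g : G) : bop R G :=
  reindex_bop (@mulVKg G g) (@mulKg G g).
Definition rreg (g : G) : bop R G :=
  reindex_bop (@mulgK G g) (@mulgVK G g).

Definition reduced_cstar : set (bop R G) :=
  norm_closure [set T | exists n (c : 'I_n -> R[i]) (g : 'I_n -> G),
    T = \sum_(m < n) c m *: lreg (g m)].

Definition exact_group : Prop := exact_cstar reduced_cstar.

(* The group von Neumann algebra L(G), as the commutant of the right regular
   representation. *)
Definition commutes_rreg : {pred bop R G} :=
  [pred T | `[< forall g, T * rreg g = rreg g * T >]].

Lemma commutes_rreg_subring : subring_closed commutes_rreg.
Proof.
split=> [|S T /asboolP cS /asboolP cT|S T /asboolP cS /asboolP cT];
  apply/asboolP => g.
- by rewrite mul1r mulr1.
- by rewrite mulrBl mulrBr cS cT.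
- by rewrite -mulrA cT mulrA cS mulrA.
Qed.

HB.instance Definition _ := GRing.isSubringClosed.Build _ commutes_rreg
  commutes_rreg_subring.

Record groupvN := GroupvN {groupvN_op :> bop R G; _ : groupvN_op \in commutes_rreg}.
HB.instance Definition _ := [isSub for groupvN_op].
HB.instance Definition _ := [Choice of groupvN by <:].
HB.instance Definition _ :=
  GRing.SubChoice_isSubPzRing.Build _ _ groupvN commutes_rreg_subring.

Lemma lreg_commutes (g : G) : lreg g \in commutes_rreg.
Proof.
apply/asboolP => h; apply: bop_eqP => xi; apply: val_inj; apply/funext => s /=.
by rewrite mulgA.
Qed.

Definition lvN (g : G) : groupvN := GroupvN (lreg_commutes g).

Definition vNtrace (T : groupvN) : R[i] := T (delta R 1%g) 1%g.

(* Lueck's dimension of the L(G)-module Z / B, for B a submodule of Z: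
   the supremum of the dimensions of the finitely generated projective
   submodules P of Z / B. Such a P is the image of the linear map
   L(G)^n -> Z / B with e_i |-> h_i + B, whose kernel is the kernel of
   v |-> v A for an idempotent A; then P is isomorphic to L(G)^n A and
   dim P = sum_i vNtrace (A i i). *)
Definition lueck_dim (V : lmodType groupvN) (Z B : set V) : \bar R :=
  ereal_sup [set d | exists n (A : 'M[groupvN]_n) (h : 'I_n -> V),
    [/\ A *m A = A,
        forall i, Z (h i),
        forall v : 'rV[groupvN]_n,
          B (\sum_(i < n) v 0 i *: h i) <-> v *m A = 0 &
        d = (complex.Re (\sum_(i < n) vNtrace (A i i)))%:E]].

(* The homology of G with coefficients in L(G), a right G-module through
   T . g = T * lvN g, from the inhomogeneous bar complex: the n-chains are the
   finitely supported functions from G^n to L(G), with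
   d1 (T [g]) = T . g - T and d2 (T [g | h]) = T . g [h] - T [gh] + T [g]. *)
Definition bar_d1 (c : G -> groupvN) : groupvN :=
  \sum_(g \in [set: G]) (c g * lvN g - c g).

Definition bar_d2 (e : G * G -> groupvN) : G -> groupvN := fun k =>
  \sum_(g \in [set: G]) (e (g, k) * lvN g - e (g, (g^-1 * k)%g) + e (k, g)).

Definition finsupp_chain (X : Type) (c : X -> groupvN) : Prop :=
  finite_set [set x | c x <> 0].

Definition cycles1 : set (G -> groupvN^o) :=
  [set c | finsupp_chain c /\ bar_d1 c = 0].

Definition boundaries1 : set (G -> groupvN^o) :=
  [set c | exists e, finsupp_chain e /\ c = bar_d2 e].

(* Lueck's definition: the dimension of H_1(G; L(G)). *)
Definition first_l2_betti : \bar R := lueck_dim cycles1 boundaries1.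

End regular_representation.

Section proper_proximality.
Variables (R : realType) (G : groupType).
Implicit Types f : G -> R[i].

Definition linfty : set (G -> R[i]) :=
  [set f | exists M : R, forall s, normc (f s) <= M].

Definition vanishes_at_infinity : set (G -> R[i]) :=
  [set f | forall eps : R, 0 < eps -> finite_set [set s | eps <= normc (f s)]].

Definition right_translate (t : G) f : G -> R[i] := fun s => f (s * t)%g.
Definition left_translate (t : G) f : G -> R[i] := fun s => f (t^-1 * s)%g.

Definition small_at_infinity : set (G -> R[i]) :=
  [set f | linfty f /\
           forall t, vanishes_at_infinity (f - right_translate t f)].

(* Only the values of phi on A matter: phi stands for a functional on A. In
   R[i], 0 <= z means that z is real and nonnegative. *)
Definition is_state (A : set (G -> R[i])) (phi : (G -> R[i]) -> R[i]) : Prop :=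
  [/\ forall (c : R[i]) f1 f2, A f1 -> A f2 ->
        phi (c *: (f1 : G -> R[i]^o) + f2) = c * phi f1 + phi f2,
      forall f, A f -> (forall s, 0 <= f s) -> 0 <= phi f &
      phi (cst 1) = 1].

Definition properly_proximal : Prop :=
  ~ exists phi, is_state small_at_infinity phi /\
      forall t f, small_at_infinity f -> phi (left_translate t f) = phi f.

End proper_proximality.

(* Main.v *)
Require Import Defs.
From HB Require Import structures.
From mathcomp Require Import all_boot all_order all_algebra finmap.
From mathcomp Require Import all_classical all_reals.
From mathcomp Require Import ereal esum topology normedtype sequences.
From mathcomp Require Import complex lra ring.

(* If the first l^2-Betti number of G is positive, a dimension count over L(G)
   along an exhaustion of G by finite sets, followed by a Mittag-Leffler
   argument, yields a cocycle b : G -> l^2(G) for the left regular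
   representation lambda and a 1-cycle c that pairs nontrivially with b. Since
   cycles annihilate coboundaries, b is not inner, hence unbounded; and G is not
   amenable, since along Folner sets the same dimension count shows that every
   cocycle is a limit of coboundaries.

   By non-amenability, a Hahn-Banach argument in l^1(G) gives bounded functions
   T_k with sum_k (T_k - k T_k) bounded below by a positive constant. The
   functions u |-> <T_k u, u> / max(|u|, r)^2 on l^2(G), together with a bump at
   the origin, transport this to the affine action g.u = lambda_g u + b(g): they
   are bounded, vary like 1/|u|, and exclude an invariant mean.

   Evaluated at u = b(h) such a function is almost right invariant only where
   |b(h)| is large, as b(ht) = b(h) + lambda_h b(t). Where |b(h)| is small, b(h)
   is replaced by its truncation to a finite set X_n, on which lambda_h b(t) is
   negligible, and one averages over all n below the level of h in an
   exhaustion (X_n). Truncation fails to be left equivariant only on the shells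
   X_(n+2) \ X_n; these are essentially disjoint, so that on average they carry
   a negligible part of b(h). The averages lie in S(G) and satisfy
   sum_i (Q_i - s_i Q_i) >= c > 0 off a finite set, which no invariant state on
   S(G) allows. *)

Set Implicit Arguments.
Unset Strict Implicit.
Unset Printing Implicit Defensive.
Import Order.TTheory GRing.Theory Num.Theory.
Import numFieldNormedType.Exports.
Import ComplexField.Normc.

Local Open Scope classical_set_scope.
Local Open Scope ring_scope.
Local Open Scope complex_scope.

(** Two devices carry the argument. Restriction maps between spaces of partial cocycles are not
    surjective, and in general Hilbert spaces closures of images do not commute with decreasing
    intersections. The dimension over L(G) is finite, faithful and continuous along decreasing
    sequences, so [rank_nullity] forces them to commute ([image_bigcap]); dense images then replace
    the surjectivity of the usual Mittag-Leffler condition. The inequality of an affine certificate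
    holds at every vector of l^2(G), not only at the values of b. It can therefore also be applied
    at a truncation of b(h), which is no longer a value of the cocycle, and it survives convex
    combinations of the two. The radius r_n below which truncation takes over obeys two opposite
    demands. The errors |b(t)| / r_n must vanish, so r_n tends to infinity. The shells up to N
    carry, weighted by the cutoff, an energy of at most 2 r_N^2 whatever h is, hence by
    Cauchy-Schwarz a sum of order N^(1/2) r_N, which must be o(N). The choice r_n = (n+1)^(1/4)
    meets both. *)

Section real_arith.
Variable R : realFieldType.

Lemma eq_opp0 (x : R) : x = - x -> x = 0. Proof. lra. Qed.

Lemma polarization_additive (a b c d e f : R) :
  a + (b + c) = d + (e + f) -> (a - d) / 4 = (e - b) / 4 + (f - c) / 4.
Proof. lra. Qed.

Lemma polarization_scale (a b c d s r : R) : s ^+ 2 = r ->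
  a + s ^+ 2 * b = c + s ^+ 2 * d -> (a - c) / 4 = r * ((d - b) / 4).
Proof. by move=> <-; lra. Qed.

End real_arith.

(** * The Hilbert space l^2 *)

Section ell2_norm.
Variables (R : realType) (J : choiceType).
Local Notation C := R[i].
Implicit Types (u v w : ell2 R J) (z : C).

Definition abs2 z : R := complex.Re z ^+ 2 + complex.Im z ^+ 2.

Lemma normc_abs2 z : normc z ^+ 2 = abs2 z.
Proof. by case: z => a b; rewrite /normc /abs2 sqr_sqrtr ?addr_ge0 ?sqr_ge0. Qed.

Lemma abs2_ge0 z : 0 <= abs2 z.
Proof. by rewrite addr_ge0 ?sqr_ge0. Qed.

Lemma abs2_0 : abs2 0 = 0.
Proof. by rewrite /abs2 /= expr0n addr0. Qed.

Lemma abs2_eq0 z : abs2 z = 0 -> z = 0.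
Proof.
case: z => a b; rewrite /abs2 /= => /eqP.
by rewrite paddr_eq0 ?sqr_ge0// !sqrf_eq0 => /andP[/eqP-> /eqP->].
Qed.

Lemma normsqE (f : J -> C) : normsq f = (\esum_(i in [set: J]) (abs2 (f i))%:E)%E.
Proof. by rewrite /normsq; apply: eq_esum => i _; rewrite normc_abs2. Qed.

Lemma fsets_sumE (X : {fset J}) (a : J -> R) :
  (\sum_(i \in [set` X]) (a i)%:E)%E = (\sum_(i <- X) a i)%:E.
Proof. by rewrite fsbig_finite//= set_fsetK sumEFin. Qed.

Lemma normsq_leP (f : J -> C) (M : R) :
  (normsq f <= M%:E)%E <-> forall X : {fset J}, \sum_(i <- X) abs2 (f i) <= M.
Proof.
rewrite normsqE; split=> [h X|h].
  rewrite -lee_fin -fsets_sumE; apply: le_trans h.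
  by apply: esum_ge; exists [set` X] => //; split.
apply: ge_ereal_sup => /= _ [F [finF _] <-].
by rewrite -(fset_setK finF) fsets_sumE lee_fin.
Qed.

Definition nsq u : R := fine (normsq u).

Lemma nsqE u : normsq u = (nsq u)%:E.
Proof.
rewrite /nsq fineK// ge0_fin_numE ?normsq_ge0//.
by have /asboolP := valP u.
Qed.

Lemma nsq_leP u (M : R) :
  nsq u <= M <-> forall X : {fset J}, \sum_(i <- X) abs2 (u i) <= M.
Proof. by rewrite -lee_fin -nsqE; exact: normsq_leP. Qed.

Lemma nsq_sum_le u (X : {fset J}) : \sum_(i <- X) abs2 (u i) <= nsq u.
Proof. by have [+ _] := nsq_leP u (nsq u); apply. Qed.

Lemma nsq_ge0 u : 0 <= nsq u.
Proof. by rewrite -lee_fin -nsqE normsq_ge0. Qed.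

Lemma abs2_le_nsq u i : abs2 (u i) <= nsq u.
Proof. by have := nsq_sum_le u [fset i]%fset; rewrite big_seq_fset1. Qed.

Lemma nsq_approx u (e : R) : 0 < e ->
  exists X : {fset J}, nsq u < \sum_(i <- X) abs2 (u i) + e.
Proof.
move=> e0; apply: contrapT => /forallNP h.
have : nsq u <= nsq u - e.
  by apply/nsq_leP => X; have /negP := h X; rewrite -leNgt; lra.
lra.
Qed.

Lemma ell2P u v : (forall i, u i = v i) -> u = v.
Proof. by move=> uv; apply: val_inj; apply/funext. Qed.

Lemma ell2_of_bound (f : J -> C) (M : R) :
  (forall X : {fset J}, \sum_(i <- X) abs2 (f i) <= M) ->
  exists2 u : ell2 R J, ell2_fun u = f & nsq u <= M.
Proof.
move=> /normsq_leP fM.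
have sf : f \in @square_summable R J by apply/asboolP; apply: le_lt_trans fM (ltry _).
exists (Ell2 sf) => //; exact/nsq_leP/normsq_leP.
Qed.

(** Sums in the extended reals add but do not subtract well. Identities between norms are therefore
    arranged as equalities of two sums of squares, which can be checked at each coordinate. *)
Lemma nsq_lin_eq (s t : seq (ell2 R J)) :
  (forall i, \sum_(u <- s) abs2 (u i) = \sum_(u <- t) abs2 (u i)) ->
  \sum_(u <- s) nsq u = \sum_(u <- t) nsq u.
Proof.
have sumE r : (\sum_(u <- r) normsq (u : ell2 R J))%E =
    (\esum_(i in [set: J]) (\sum_(u <- r) abs2 (u i))%:E)%E.
  under [RHS]eq_esum do rewrite -sumEFin.
  rewrite esum_sum; last by move=> *; rewrite lee_fin abs2_ge0.
  by apply: eq_bigr => u _; rewrite normsqE.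
move=> st; apply: EFin_inj; rewrite -!sumEFin.
under eq_bigr do rewrite -nsqE; under [RHS]eq_bigr do rewrite -nsqE.
by rewrite !sumE; apply: eq_esum => i _; rewrite st.
Qed.

Lemma ell2E0 i : (0 : ell2 R J) i = 0. Proof. by []. Qed.
Lemma ell2ED u v i : (u + v) i = u i + v i. Proof. by []. Qed.
Lemma ell2EN u i : (- u) i = - u i. Proof. by []. Qed.
Lemma ell2EZ z u i : (z *: u) i = z * u i. Proof. by []. Qed.
Definition ell2E := (ell2E0, ell2ED, ell2EN, ell2EZ).

Lemma nsq_pol4 u1 u2 u3 u4 :
  (forall i, abs2 (u1 i) + abs2 (u2 i) = abs2 (u3 i) + abs2 (u4 i)) ->
  nsq u1 + nsq u2 = nsq u3 + nsq u4.
Proof.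
move=> h; have := @nsq_lin_eq [:: u1; u2] [:: u3; u4].
by rewrite !big_cons !big_nil !addr0; apply => i; rewrite !big_cons !big_nil !addr0.
Qed.

Lemma eq_nsq u v : (forall i, abs2 (u i) = abs2 (v i)) -> nsq u = nsq v.
Proof.
move=> h; have := @nsq_lin_eq [:: u] [:: v].
by rewrite !big_cons !big_nil !addr0; apply => i; rewrite !big_cons !big_nil !addr0.
Qed.

(** The real part of the usual inner product, by polarization; the imaginary part is found by
    pairing with ['i *: v]. *)
Definition ell2_dot u v : R := (nsq (u + v) - nsq (u - v)) / 4.

Ltac gen_nsq := repeat match goal with |- context [nsq ?u] => move: (nsq u) => ? end.

Ltac pointwise := move=> i; rewrite !ell2E /abs2;
  repeat match goal with |- context [ell2_fun ?u ?i] =>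
    case: (ell2_fun u i) => ? ? end; rewrite /=; try ring.

Lemma ell2_dotC u v : ell2_dot u v = ell2_dot v u.
Proof.
rewrite /ell2_dot [u + v]addrC; congr ((_ - _) / _).
by apply: eq_nsq; pointwise.
Qed.

Lemma ell2_dotDl u v w : ell2_dot (u + v) w = ell2_dot u w + ell2_dot v w.
Proof.
have := @nsq_lin_eq [:: u + v + w; u - w; v - w] [:: u + v - w; u + w; v + w].
rewrite !big_cons !big_nil !addr0 => h; apply: polarization_additive; apply: h.
by move=> i; rewrite !big_cons !big_nil !addr0; move: i; pointwise.
Qed.

Lemma ell2_dot_conj z u v : ell2_dot (z *: u) v = ell2_dot u (conjc z *: v).
Proof.
suff : nsq (z *: u + v) + nsq (u - conjc z *: v) =
    nsq (z *: u - v) + nsq (u + conjc z *: v) by rewrite /ell2_dot; gen_nsq => ?; lra.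
by apply: nsq_pol4; case: z => a b; pointwise.
Qed.

Lemma ell2_dotNl u v : ell2_dot (- u) v = - ell2_dot u v.
Proof.
have := ell2_dotDl (- u) u v; rewrite addNr.
suff -> : ell2_dot 0 v = 0 by move=> /eqP; rewrite eq_sym addr_eq0 => /eqP.
by have /eqP := ell2_dotDl 0 0 v; rewrite addr0 -subr_eq0 opprD addNKr oppr_eq0 => /eqP.
Qed.

Lemma ell2_dotZl (r : R) u v : ell2_dot (r%:C *: u) v = r * ell2_dot u v.
Proof.
have pos (k : R) w : nsq (k%:C *: w) = k ^+ 2 * nsq w.
  have le (k' : R) (w' : ell2 R J) : nsq (k'%:C *: w') <= k' ^+ 2 * nsq w'.
    apply/nsq_leP => X; under eq_bigr do rewrite ell2EZ.
    rewrite (eq_bigr (fun i => k' ^+ 2 * abs2 (w' i))); last first.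
      by move=> i _; rewrite /abs2; case: (ell2_fun _ _) => a b /=; ring.
    by rewrite -mulr_sumr ler_wpM2l ?sqr_ge0 ?nsq_sum_le.
  have [->|k0] := eqVneq k 0.
    by rewrite expr0n mul0r; apply/eqP; rewrite eq_le nsq_ge0 andbT;
      have := le 0 w; rewrite expr0n mul0r.
  apply/eqP; rewrite eq_le le /=.
  have := le k^-1 (k%:C *: w); rewrite scalerA -rmorphM mulVf// scale1r.
  by rewrite exprVn mulrC ler_pdivlMr ?exprn_even_gt0// mulrC.
(* With s^2 = r', the cross terms cancel in |r'u + v|^2 + |s(u - v)|^2 = |r'u - v|^2 + |s(u + v)|^2,
   an identity of sums of squares. *)
have main (r' : R) : 0 <= r' -> ell2_dot (r'%:C *: u) v = r' * ell2_dot u v.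
  move=> r0; have := sqr_sqrtr r0; set s := Num.sqrt r' => sE.
  suff : nsq (r'%:C *: u + v) + nsq (s%:C *: (u - v)) =
      nsq (r'%:C *: u - v) + nsq (s%:C *: (u + v)).
    by rewrite !pos; exact: polarization_scale.
  by rewrite -sE; apply: nsq_pol4; pointwise.
have [r0|r0] := leP 0 r; first exact: main.
have := main (- r); rewrite rmorphN scaleNr ell2_dotNl mulNr => /(_ _)/oppr_inj; apply.
by rewrite oppr_ge0 ltW.
Qed.

Lemma ell2_dotE u : ell2_dot u u = nsq u.
Proof.
have N0 : nsq (u - u) = 0.
  apply/eqP; rewrite eq_le nsq_ge0 andbT; apply/nsq_leP => X.
  by rewrite subrr big1// => i _; rewrite abs2_0.
have := @nsq_lin_eq [:: u + u] [:: u; u; u; u].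
rewrite !big_cons !big_nil !addr0 /ell2_dot N0 => h; suff {}/h : forall i,
  \sum_(x <- [:: u + u]) abs2 (x i) = \sum_(x <- [:: u; u; u; u]) abs2 (x i) by gen_nsq; lra.
by move=> i; rewrite !big_cons !big_nil !addr0; move: i; pointwise.
Qed.

Lemma nsq_eq0 u : nsq u = 0 -> u = 0.
Proof.
move=> u0; apply: ell2P => i; apply: abs2_eq0; apply/eqP; rewrite eq_le abs2_ge0.
by have := abs2_le_nsq u i; rewrite u0 andbT.
Qed.

Lemma nsq_delta i : nsq (delta R i) = 1.
Proof.
apply/eqP; rewrite eq_le; apply/andP; split; last first.
  by have := abs2_le_nsq (delta R i) i; rewrite /= eqxx /abs2 /= expr0n/= expr1n addr0.
apply/nsq_leP => X.
have dE k : k \in X -> k != i -> abs2 (delta R i k) = 0.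
  by move=> _ /negPf /= ->; exact: abs2_0.
have [iX|iX] := boolP (i \in X).
  rewrite (big_fsetD1 i)//= big_seq big1 ?addr0 ?eqxx.
    by rewrite /abs2 /= expr0n expr1n addr0.
  by move=> k; rewrite !inE => /andP[/negPf /= -> _]; exact: abs2_0.
rewrite big_seq big1// => k kX; apply: dE => //.
by apply: contraNneq iX => <-.
Qed.

Lemma ell2_dot_delta u i : ell2_dot u (delta R i) = complex.Re (u i).
Proof.
have [u' [u'i uE]] : exists u', u' i = 0 /\ u = u' + u i *: delta R i.
  exists (u - u i *: delta R i); split; last by rewrite subrK.
  by rewrite !ell2E /= eqxx mulr1 subrr.
have d0 : ell2_dot u' (delta R i) = 0.
  rewrite /ell2_dot (_ : nsq (u' + _) = nsq (u' - delta R i)) ?subrr ?mul0r//.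
  apply: eq_nsq => j; rewrite !ell2E /=.
  have [->|_] := eqVneq j i; last by rewrite oppr0.
  by rewrite u'i !add0r /abs2 /= oppr0 sqrrN.
rewrite {1}uE ell2_dotDl d0 add0r.
set z := u i.
have zE : z = (complex.Re z)%:C + (complex.Im z)%:C * 'i.
  by case: z => a b; apply/eqP; rewrite eq_complex /=; apply/andP; split; apply/eqP; ring.
have i0 : ell2_dot ('i *: delta R i) (delta R i) = 0.
  have : ell2_dot ('i *: delta R i) (delta R i) =
      - ell2_dot ('i *: delta R i) (delta R i).
    rewrite {1}ell2_dot_conj (_ : conjc 'i = - 'i :> C); last first.
      by apply/eqP; rewrite eq_complex /= oppr0 !eqxx.
    by rewrite ell2_dotC scaleNr ell2_dotNl.
  exact: eq_opp0.
rewrite {1}zE scalerDl ell2_dotDl ell2_dotZl ell2_dotE nsq_delta mulr1.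
by rewrite -scalerA ell2_dotZl i0 mulr0 addr0.
Qed.

End ell2_norm.

(** A complex Hilbert space is recorded through the real part of its inner product. [dot_conj] makes
    conjugation the adjoint of scaling, which determines the complex inner product. *)
HB.mixin Record isHilbert (R : realType) V of GRing.Lmodule R[i] V := {
  dot : V -> V -> R;
  dotC : forall u v, dot u v = dot v u;
  dotDl : forall u v w, dot (u + v) w = dot u w + dot v w;
  dotZl : forall (r : R) u v, dot (r%:C *: u) v = r * dot u v;
  dot_conj : forall (z : R[i]) u v, dot (z *: u) v = dot u (conjc z *: v);
  dot_ge0 : forall u, 0 <= dot u u;
  dot_eq0 : forall u, dot u u = 0 -> u = 0;
  hilbert_complete : forall u : nat -> V,
    (forall e : R, 0 < e -> exists n0 : nat, forall m n, (n0 <= m)%N -> (n0 <= n)%N ->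
       dot (u m - u n) (u m - u n) <= e) ->
    exists l, forall e : R, 0 < e -> exists n0 : nat, forall n, (n0 <= n)%N ->
       dot (u n - l) (u n - l) <= e }.

#[short(type="hilbertType")]
HB.structure Definition Hilbert (R : realType) :=
  {V of GRing.Lmodule R[i] V & isHilbert R V}.

Notation sqn u := (dot u u).

Section real_sequences.
Variable R : realType.

Lemma le_of_sqr (a b : R) : 0 <= b -> a ^+ 2 <= b ^+ 2 -> a <= b.
Proof. by move=> b0; case: (lerP 0 a) => [a0|]; [rewrite ler_sqr | move=> /ltW; lra]. Qed.

Lemma sqr_le_of_norm (a b : R) : `|a| <= b -> a ^+ 2 <= b ^+ 2.
Proof.
move=> ab; have b0 : 0 <= b := le_trans (normr_ge0 a) ab.
by rewrite -(real_normK (num_real a)) ler_sqr ?nnegrE.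
Qed.

Lemma real_cauchy_lim (a : nat -> R) :
  (forall e : R, 0 < e -> exists n0 : nat, forall m n, (n0 <= m)%N -> (n0 <= n)%N ->
     `|a m - a n| <= e) ->
  exists l, forall e : R, 0 < e -> exists n0 : nat, forall n, (n0 <= n)%N ->
     `|a n - l| <= e.
Proof.
move=> h; have : cvgn a.
  apply/cauchy_cvgP/cauchy_exP => e e0.
  have [n0 hn] := h (e / 2) ltac:(lra).
  exists (a n0), n0 => //= m mn; rewrite /ball /=.
  by apply: le_lt_trans (hn _ _ (leqnn _) mn) _; lra.
move=> /cvgrPdist_le ca; exists (limn a) => e e0.
have [n0 _ hn] := ca e e0; exists n0 => n nn; rewrite distrC.
exact: hn.
Qed.

End real_sequences.

Section ell2_complete.
Variables (R : realType) (J : choiceType).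

Lemma abs2D_le (z w : R[i]) : abs2 (z + w) <= 2 * abs2 z + 2 * abs2 w.
Proof.
case: z w => a b [c d]; rewrite /abs2 /=.
have := sqr_ge0 (a - c); have := sqr_ge0 (b - d); rewrite !sqrrB !sqrrD; lra.
Qed.

Lemma ell2_complete (u : nat -> ell2 R J) :
  (forall e : R, 0 < e -> exists n0 : nat, forall m n, (n0 <= m)%N -> (n0 <= n)%N ->
     nsq (u m - u n) <= e) ->
  exists l, forall e : R, 0 < e -> exists n0 : nat, forall n, (n0 <= n)%N ->
     nsq (u n - l) <= e.
Proof.
move=> cu.
have /choice[l hl] : forall i, exists z : R[i], forall e : R, 0 < e ->
    exists n0 : nat, forall n, (n0 <= n)%N -> abs2 (u n i - z) <= e.
  move=> i.
  have part (f : R[i] -> R) : (forall z, `|f z| ^+ 2 <= abs2 z) ->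
      {morph f : x y / x - y} ->
      exists l : R, forall e : R, 0 < e -> exists n0 : nat, forall n, (n0 <= n)%N ->
     `|f (u n i) - l| <= e.
    move=> f2 fB; apply: real_cauchy_lim => e e0.
    have [n0 hn] := cu (e ^+ 2) (exprn_gt0 _ e0); exists n0 => m n mn nn.
    rewrite -fB; apply: le_of_sqr (ltW e0) _.
    apply: (le_trans (f2 _)); apply: (le_trans _ (hn _ _ mn nn)).
    exact: abs2_le_nsq (u m - u n) i.
  have [a ha] : exists l : R, forall e : R, 0 < e -> exists n0 : nat,
      forall n, (n0 <= n)%N -> `|complex.Re (u n i) - l| <= e.
    apply: (part (fun z => complex.Re z)); last by case=> ? ? [].
    by move=> z; rewrite real_normK ?num_real// lerDl sqr_ge0.
  have [b hb] : exists l : R, forall e : R, 0 < e -> exists n0 : nat,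
      forall n, (n0 <= n)%N -> `|complex.Im (u n i) - l| <= e.
    apply: (part (fun z => complex.Im z)); last by case=> ? ? [].
    by move=> z; rewrite real_normK ?num_real// lerDr sqr_ge0.
  exists (a +i* b) => e e0.
  pose e' := Num.sqrt (e / 2).
  have e'0 : 0 < e' by rewrite sqrtr_gt0; lra.
  have [na hna] := ha _ e'0; have [nb hnb] := hb _ e'0.
  exists (maxn na nb) => n; rewrite geq_max => /andP[/hna h1 /hnb h2].
  move: (sqr_le_of_norm h1) (sqr_le_of_norm h2); rewrite sqr_sqrtr; last by lra.
  by rewrite /abs2; case: (u n i) => c d /=; lra.
(* The index m at which [u m] is close to l on X depends on X, but the Cauchy estimate from n to m
   does not; hence n0 is uniform in X. *)
have bound (e : R) : 0 < e -> exists n0 : nat, forall n, (n0 <= n)%N ->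
    forall X : {fset J}, \sum_(i <- X) abs2 (u n i - l i) <= e.
  move=> e0; have [n0 hn] := cu (e / 4) ltac:(lra); exists n0 => n nn X.
  have [m mn hm] : exists2 m : nat, (n0 <= m)%N &
      \sum_(i <- X) abs2 (u m i - l i) <= e / 4.
    pose k : R := (size X).+1%:R.
    have k0 : 0 < k by rewrite ltr0n.
    suff [m mn hm] : exists2 m : nat, (n0 <= m)%N & forall i, i \in (X : seq J) ->
        abs2 (u m i - l i) <= e / 4 / k.
      exists m => //; rewrite big_seq.
      apply: (@le_trans _ _ (\sum_(i <- X | i \in X) e / 4 / k)).
        by apply: ler_sum => i; exact: hm.
      rewrite -big_seq big_const_seq count_predT iter_addr addr0.
      rewrite -[X in X <= _]mulr_natr mulrAC ler_pdivrMr// ler_wpM2l ?ler_nat//.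
      by rewrite ltW// divr_gt0.
    have ek0 : 0 < e / 4 / k by rewrite divr_gt0//; lra.
    elim: (X : seq J) => [|i s [m mn hm]]; first by exists n0.
    have : exists m' : nat, forall p, (m' <= p)%N -> forall j, j \in i :: s ->
        abs2 (u p j - l j) <= e / 4 / k.
      elim: (i :: s) => [|j t [p hp]]; first by exists 0.
      have [q hq] := hl j _ ek0; exists (maxn p q) => r.
      rewrite geq_max => /andP[pr qr] j'; rewrite inE => /predU1P[->|/hp]; last exact.
      exact: hq.
    move=> [m' hm']; exists (maxn n0 m'); rewrite ?leq_maxl// => j.
    by apply: hm'; rewrite leq_maxr.
  have := hn n m nn mn; have := nsq_sum_le (u n - u m) X.
  have : \sum_(i <- X) abs2 (u n i - l i) <= 2 * \sum_(i <- X) abs2 ((u n - u m) i) +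
      2 * \sum_(i <- X) abs2 (u m i - l i).
    rewrite !mulr_sumr -big_split /=; apply: ler_sum => i _.
    have -> : u n i - l i = (u n - u m) i + (u m i - l i).
      by rewrite ell2ED ell2EN addrA subrK.
    exact: abs2D_le.
  lra.
have [n0 h0] := bound 1 ltr01.
(* Here w is [u n0 - l], square summable by [bound]; so l itself is [u n0 - w]. *)
have [w wE _] := ell2_of_bound (h0 n0 (leqnn _)).
exists (u n0 - w) => e e0; have [n1 h1] := bound e e0; exists n1 => n nn.
apply/nsq_leP => X; apply: le_trans (h1 n nn X).
by apply: ler_sum => i _; rewrite !ell2E wE subKr.
Qed.

Lemma ell2_dot_ge0 (u : ell2 R J) : 0 <= ell2_dot u u.
Proof. by rewrite ell2_dotE nsq_ge0. Qed.

Lemma ell2_dot_eq0 (u : ell2 R J) : ell2_dot u u = 0 -> u = 0.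
Proof. by rewrite ell2_dotE => /nsq_eq0. Qed.

Lemma ell2_dot_complete (u : nat -> ell2 R J) :
  (forall e : R, 0 < e -> exists n0 : nat, forall m n, (n0 <= m)%N -> (n0 <= n)%N ->
     ell2_dot (u m - u n) (u m - u n) <= e) ->
  exists l, forall e : R, 0 < e -> exists n0 : nat, forall n, (n0 <= n)%N ->
     ell2_dot (u n - l) (u n - l) <= e.
Proof.
move=> cu; have [e e0|l hl] := @ell2_complete u.
  by have [n0 hn] := cu e e0; exists n0 => m n mn nn; rewrite -ell2_dotE; exact: hn.
exists l => e e0; have [n0 hn] := hl e e0.
by exists n0 => n nn; rewrite ell2_dotE; exact: hn.
Qed.

HB.instance Definition _ := isHilbert.Build R (ell2 R J)
  (@ell2_dotC R J) (@ell2_dotDl R J) (@ell2_dotZl R J) (@ell2_dot_conj R J)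
  ell2_dot_ge0 ell2_dot_eq0 ell2_dot_complete.
End ell2_complete.

(** * Hilbert spaces *)

Section hilbert_theory.
Variables (R : realType) (V : hilbertType R).
Implicit Types (u v w : V) (W : set V) (r : R) (z : R[i]).

Lemma dotDr u v w : dot u (v + w) = dot u v + dot u w.
Proof. by rewrite dotC dotDl dotC [dot w u]dotC. Qed.

Lemma dot0l v : dot 0 v = 0.
Proof. by apply: (@addrI _ (dot 0 v)); rewrite -dotDl !addr0. Qed.

Lemma dot0r v : dot v 0 = 0. Proof. by rewrite dotC dot0l. Qed.

Lemma dotNl u v : dot (- u) v = - dot u v.
Proof. by apply/eqP; rewrite -addr_eq0 -dotDl addNr dot0l. Qed.

Lemma dotNr u v : dot u (- v) = - dot u v.
Proof. by rewrite dotC dotNl dotC. Qed.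

Lemma dotBl u v w : dot (u - v) w = dot u w - dot v w.
Proof. by rewrite dotDl dotNl. Qed.

Lemma dotBr u v w : dot u (v - w) = dot u v - dot u w.
Proof. by rewrite dotDr dotNr. Qed.

Lemma dotZr r u v : dot u (r%:C *: v) = r * dot u v.
Proof. by rewrite dotC dotZl dotC. Qed.

Definition nrm u : R := Num.sqrt (sqn u).

Lemma nrm_ge0 u : 0 <= nrm u. Proof. exact: sqrtr_ge0. Qed.

Lemma nrm_sqr u : nrm u ^+ 2 = sqn u. Proof. by rewrite sqr_sqrtr ?dot_ge0. Qed.

Lemma nrm0 : nrm 0 = 0. Proof. by rewrite /nrm dot0l sqrtr0. Qed.

Lemma nrmN u : nrm (- u) = nrm u. Proof. by rewrite /nrm dotNl dotNr opprK. Qed.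

Lemma nrmBC u v : nrm (u - v) = nrm (v - u). Proof. by rewrite -nrmN opprB. Qed.

Lemma nrm_eq0 u : nrm u = 0 -> u = 0.
Proof. by move=> u0; apply: dot_eq0; rewrite -nrm_sqr u0 expr0n. Qed.

Lemma dot_self_scale z u : sqn (z *: u) = abs2 z * sqn u.
Proof.
rewrite dot_conj scalerA (_ : conjc z * z = (abs2 z)%:C) ?dotZr//.
by case: z => a b; apply/eqP; rewrite eq_complex /abs2 /=; apply/andP; split; apply/eqP; ring.
Qed.

Lemma nrmZ z u : nrm (z *: u) = normc z * nrm u.
Proof.
rewrite /nrm dot_self_scale sqrtrM ?abs2_ge0//; congr (_ * _).
by case: z.
Qed.

Lemma nrmZr r u : nrm (r%:C *: u) = `|r| * nrm u.
Proof. by rewrite nrmZ /normc /= expr0n/= addr0 sqrtr_sqr. Qed.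

Lemma dotDD u v : sqn (u + v) = sqn u + 2 * dot u v + sqn v.
Proof. by rewrite dotDl !dotDr [dot v u]dotC mulr_natl mulr2n !addrA. Qed.

Lemma dotBB u v : sqn (u - v) = sqn u - 2 * dot u v + sqn v.
Proof. by rewrite dotDD dotNr dotNl dotNr opprK mulrN. Qed.

Lemma cauchy_schwarz u v : dot u v <= nrm u * nrm v.
Proof.
have [v0|v0] := eqVneq (nrm v) 0; first by rewrite (nrm_eq0 v0) dot0r nrm0 mulr0.
have vp : 0 < nrm v by rewrite lt_neqAle eq_sym v0 nrm_ge0.
have [u0|u0] := eqVneq (nrm u) 0; first by rewrite (nrm_eq0 u0) dot0l nrm0 mul0r.
have up : 0 < nrm u by rewrite lt_neqAle eq_sym u0 nrm_ge0.
have := dot_ge0 ((nrm v)%:C *: u - (nrm u)%:C *: v).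
rewrite dotBB !dotZl !dotZr -!nrm_sqr.
move: (nrm u) (nrm v) (dot u v) up vp => a b d a0 b0.
have -> : b * (b * a ^+ 2) - 2 * (b * (a * d)) + a * (a * b ^+ 2) =
  2 * (a * b) * (a * b - d) by ring.
by rewrite pmulr_rge0 ?subr_ge0// !mulr_gt0.
Qed.

Lemma nrmD_le u v : nrm (u + v) <= nrm u + nrm v.
Proof.
apply: le_of_sqr; first by rewrite addr_ge0 ?nrm_ge0.
rewrite nrm_sqr dotDD sqrrD !nrm_sqr lerD2r lerD2l -[X in _ <= X]mulr_natl.
by rewrite ler_wpM2l// cauchy_schwarz.
Qed.

Lemma nrmB_le u v w : nrm (u - w) <= nrm (u - v) + nrm (v - w).
Proof. by apply: le_trans (nrmD_le _ _); rewrite addrA subrK. Qed.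

Lemma ler_dist_nrm u v : `|nrm u - nrm v| <= nrm (u - v).
Proof.
have := nrmD_le (u - v) v; have := nrmD_le (v - u) u; rewrite !subrK (nrmBC v u).
by move=> h1 h2; rewrite ler_norml; apply/andP; split; lra.
Qed.

Definition tends (x : nat -> V) l :=
  forall e : R, 0 < e -> exists n0 : nat, forall n, (n0 <= n)%N -> nrm (x n - l) <= e.

Lemma nrm_complete (x : nat -> V) :
  (forall e : R, 0 < e -> exists n0 : nat, forall m n, (n0 <= m)%N -> (n0 <= n)%N ->
     nrm (x m - x n) <= e) -> exists l, tends x l.
Proof.
move=> cx; have [e e0|l hl] := @hilbert_complete R V x.
  have [n0 hn] := cx (Num.sqrt e) ltac:(by rewrite sqrtr_gt0); exists n0 => m n mn nn.
  rewrite -nrm_sqr -(sqr_sqrtr (ltW e0)) ler_sqr ?nnegrE ?nrm_ge0 ?sqrtr_ge0//.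
  exact: hn.
exists l => e e0; have [n0 hn] := hl (e ^+ 2) ltac:(by rewrite exprn_gt0).
by exists n0 => n nn; apply: le_of_sqr (ltW e0) _; rewrite nrm_sqr; exact: hn.
Qed.

Definition hclosure W : set V := [set v | forall e : R, 0 < e -> exists2 w, W w & nrm (v - w) <= e].

Lemma sub_hclosure W : W `<=` hclosure W.
Proof. by move=> w Ww e e0; exists w => //; rewrite subrr nrm0 ltW. Qed.

Lemma hclosureS W1 W2 : W1 `<=` W2 -> hclosure W1 `<=` hclosure W2.
Proof. by move=> h v Wv e e0; have [w /h ? ?] := Wv e e0; exists w. Qed.

Lemma hclosureK W : hclosure (hclosure W) `<=` hclosure W.
Proof.
move=> v hv e e0; have [w hw vw] := hv (e / 2) ltac:(lra).
have [w' Ww' ww'] := hw (e / 2) ltac:(lra); exists w' => //.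
by apply: le_trans (nrmB_le v w w') _; lra.
Qed.

Lemma tends_hclosure W (x : nat -> V) l :
  (exists n0 : nat, forall n, (n0 <= n)%N -> W (x n)) -> tends x l -> hclosure W l.
Proof.
move=> [m hm] xl e e0; have [n0 hn] := xl e e0.
exists (x (maxn m n0)); first by apply: hm; rewrite leq_maxl.
by rewrite nrmBC hn ?leq_maxr.
Qed.

(* The last two hypotheses on q are strong convexity and lower semicontinuity. *)
Lemma exists_minimizer (D : set V) (q : V -> R) (B : R) :
  D !=set0 -> (forall x, D x -> B <= q x) ->
  (forall x y, D x -> D y -> exists2 m, D m &
     q m + sqn (x - y) / 4 <= (q x + q y) / 2) ->
  (forall l c, (forall e : R, 0 < e -> exists x, [/\ D x, nrm (x - l) <= e & q x <= c + e]) ->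
     D l /\ q l <= c) ->
  exists2 l, D l & forall x, D x -> q l <= q x.
Proof.
move=> [x0 Dx0] qB conv lsc; pose E := [set q x | x in D].
have infE : has_inf E.
  by split; [exists (q x0), x0 | exists B => _ [x Dx <-]; exact: qB].
have le_inf x : D x -> inf E <= q x by move=> Dx; apply: ge_inf; [case: infE | exists x].
have /choice[x hx] : forall n : nat, exists x, D x /\ q x <= inf E + n.+1%:R^-1.
  move=> n; have n0 : (0 : R) < n.+1%:R^-1 by rewrite invr_gt0 ltr0n.
  have [_ [y Dy <-] qy] := inf_adherent n0 infE.
  by exists y; split => //; exact: ltW.
have small (e : R) : 0 < e -> exists n0 : nat, forall n, (n0 <= n)%N -> n.+1%:R^-1 <= e.
  move=> e0; exists (Num.truncn e^-1) => n nn.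
  rewrite invf_ple ?posrE ?ltr0n//.
  apply: le_trans (ltW (truncnS_gt _)) _; by rewrite ler_nat.
have [e e0|l xl] := @nrm_complete x.
  have [n0 hn] := small (e ^+ 2 / 4) ltac:(by rewrite divr_gt0 ?exprn_gt0).
  exists n0 => m n mn nn; apply: le_of_sqr (ltW e0) _; rewrite nrm_sqr.
  have [y Dy] := conv _ _ (hx m).1 (hx n).1.
  have := le_inf y Dy; have := (hx m).2; have := (hx n).2.
  have := hn m mn; have := hn n nn.
  move: (dot _ _) (q y) (q (x m)) (q (x n)) (inf E) (m.+1%:R^-1) (n.+1%:R^-1) (e ^+ 2).
  by move=> *; lra.
have [|Dl ql] := lsc l (inf E).
  move=> e e0; have [n1 h1] := xl e e0; have [n2 h2] := small e e0.
  exists (x (maxn n1 n2)); split; [exact: (hx _).1 | by rewrite h1 ?leq_maxl |].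
  apply: le_trans (hx _).2 _; by rewrite lerD2l h2 ?leq_maxr.
by exists l => // y /le_inf; exact: le_trans.
Qed.

Lemma dotBC u v : sqn (u - v) = sqn (v - u).
Proof. by rewrite -opprB dotNl dotNr opprK. Qed.

Lemma dot_lsc v l (c : R) :
  (forall e : R, 0 < e -> exists x, nrm (x - l) <= e /\ sqn (x - v) <= c + e) ->
  sqn (l - v) <= c.
Proof.
move=> h; have c0 : 0 <= c.
  apply/ler_addgt0Pr => e e0; have [x [_]] := h e e0.
  by apply: le_trans; exact: dot_ge0.
rewrite -nrm_sqr -(sqr_sqrtr c0); set s := Num.sqrt c.
have s0 : 0 <= s by exact: sqrtr_ge0.
suff : nrm (l - v) <= s by rewrite ler_sqr ?nnegrE ?nrm_ge0.
apply/ler_addgt0Pr => e e0.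
have ep : 0 < Num.min (e / 2) (e ^+ 2 / 4).
  by rewrite lt_min !divr_gt0 ?exprn_gt0.
have [x [xl]] := h _ ep; rewrite -nrm_sqr -(sqr_sqrtr c0) -/s => qx.
have : nrm (x - v) <= s + e / 2.
  apply: le_of_sqr; first by lra.
  apply: le_trans qx _; have : Num.min (e / 2) (e ^+ 2 / 4) <= e ^+ 2 / 4 by rewrite ge_min lexx orbT.
  by move=> h1; nra.
have : nrm (x - l) <= e / 2 by apply: le_trans xl _; rewrite ge_min lexx.
by have := nrmB_le l x v; rewrite (nrmBC l x); lra.
Qed.

Definition hsub W := [/\ W 0, forall z u v, W u -> W v -> W (z *: u + v) &
  hclosure W `<=` W].

Lemma hsub_closure W : W 0 -> (forall z u v, W u -> W v -> W (z *: u + v)) ->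
  hsub (hclosure W).
Proof.
move=> W0 Wl; split; [exact: sub_hclosure | | exact: hclosureK].
move=> z u v hu hv e e0.
have zp : 0 < 2 * (normc z + 1).
  by have : 0 <= normc z by [case: z => a b; exact: sqrtr_ge0]; lra.
have [u' Wu' uu'] := hu (e / (2 * (normc z + 1))) (divr_gt0 e0 zp).
have [v' Wv' vv'] := hv (e / 2) ltac:(lra).
exists (z *: u' + v'); first exact: Wl.
rewrite opprD addrACA -scalerBr; apply: le_trans (nrmD_le _ _) _.
rewrite nrmZ; have z0 : 0 <= normc z by case: (z) => a b; exact: sqrtr_ge0.
have : normc z * nrm (u - u') <= e / 2.
  apply: le_trans (ler_wpM2l z0 uu') _.
  rewrite mulrA ler_pdivrMr//; move: (normc z) z0 => t t0; nra.
by move: (normc z * _) vv' => t; lra.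
Qed.

Lemma hsubZ W z u : hsub W -> W u -> W (z *: u).
Proof. by case=> W0 Wl _ Wu; rewrite -[_ *: _]addr0; exact: Wl. Qed.

Lemma hsubD W u v : hsub W -> W u -> W v -> W (u + v).
Proof. by case=> _ Wl _ Wu Wv; rewrite -[u]scale1r; exact: Wl. Qed.

Lemma hsubB W u v : hsub W -> W u -> W v -> W (u - v).
Proof. by move=> hW Wu Wv; apply: hsubD => //; rewrite -scaleN1r; exact: hsubZ. Qed.

Lemma hsub_setI W1 W2 : hsub W1 -> hsub W2 -> hsub (W1 `&` W2).
Proof.
move=> [a1 b1 c1] [a2 b2 c2]; split=> // [z u v [? ?] [? ?]|v hv].
  by split; [exact: b1|exact: b2].
by split; [apply: c1|apply: c2]; apply: hclosureS hv => ? [].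
Qed.

Lemma hsub_bigcap (W : nat -> set V) : (forall n, hsub (W n)) -> hsub (\bigcap_n W n).
Proof.
move=> hW; split=> [n _|z u v Wu Wv n _|v hv n _]; have [a b c] := hW n => //.
  by apply: b; [exact: Wu|exact: Wv].
by apply: c; apply: hclosureS hv => w; exact.
Qed.

Lemma projection_exists W v : hsub W ->
  exists p, W p /\ forall w, W w -> dot (v - p) w = 0.
Proof.
move=> hW; have [W0 Wl Wc] := hW.
have [||||p Wp pmin] := @exists_minimizer W (fun w => sqn (v - w)) 0.
- by exists 0.
- by move=> x _; exact: dot_ge0.
- move=> x y Wx Wy; exists ((2^-1 : R)%:C *: (x + y)); first by apply: hsubZ => //; exact: hsubD.
  rewrite le_eqVlt; apply/orP; left; apply/eqP.
  rewrite !dotBB !dotZl !dotZr !dotDD [dot v (x + y)]dotDr.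
  by field.
- move=> l c h; split.
    apply: Wc => e e0; have [x [Wx xl _]] := h e e0; exists x => //.
    by rewrite nrmBC.
  rewrite -dotBC; apply: dot_lsc => e e0; have [x [_ xl qx]] := h e e0.
  by exists x; rewrite // dotBC.
exists p; split=> // w Ww.
have main t : 0 <= t ^+ 2 * sqn w - 2 * t * dot (v - p) w.
  have := pmin (p + t%:C *: w) (hsubD hW Wp (hsubZ t%:C hW Ww)).
  rewrite opprD addrA [X in _ <= X]dotBB dotZl !dotZr => h.
  by move: (sqn (v - p)) (dot _ w) (sqn w) h => a b c; lra.
have [w0|w0] := eqVneq (sqn w) 0; first by rewrite (dot_eq0 w w0) dot0r.
have wp : 0 < sqn w by rewrite lt_neqAle eq_sym w0 dot_ge0.
have := main (dot (v - p) w / sqn w).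
move: (dot (v - p) w) (sqn w) w0 wp => a b b0 bp.
have -> : (a / b) ^+ 2 * b - 2 * (a / b) * a = - (a ^+ 2 / b) by field.
rewrite oppr_ge0 pmulr_lle0 ?invr_gt0// => a0.
by apply/eqP; rewrite -sqrf_eq0 eq_le a0 sqr_ge0.
Qed.

Definition proj W v := xget 0 [set p | W p /\ forall w, W w -> dot (v - p) w = 0].

Section projection.
Variables (W : set V) (hW : hsub W).

Lemma projP v : W (proj W v) /\ forall w, W w -> dot (v - proj W v) w = 0.
Proof.
by rewrite /proj; case: xgetP => [p _ //|]; have [p hp] := projection_exists v hW => /(_ p).
Qed.

Lemma proj_in v : W (proj W v). Proof. exact: (projP v).1. Qed.

Lemma proj_orth v w : W w -> dot (v - proj W v) w = 0.
Proof. exact: (projP v).2. Qed.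

Lemma proj_uniq v p : W p -> (forall w, W w -> dot (v - p) w = 0) -> proj W v = p.
Proof.
move=> Wp hp; apply/eqP; rewrite -subr_eq0; apply/eqP/dot_eq0.
have Wd : W (proj W v - p) by apply: hsubB => //; exact: proj_in.
have -> : sqn (proj W v - p) =
    dot (v - p) (proj W v - p) - dot (v - proj W v) (proj W v - p).
  by rewrite -dotBl opprB [v - p + _]addrC addrA subrK.
by rewrite hp// proj_orth// subrr.
Qed.

Lemma proj_id v : W v -> proj W v = v.
Proof. by move=> Wv; apply: proj_uniq => // w _; rewrite subrr dot0l. Qed.

Lemma proj_linear z u v : proj W (z *: u + v) = z *: proj W u + proj W v.
Proof.
apply: proj_uniq; first by case: hW => _ Wl _; apply: Wl; exact: proj_in.
move=> w Ww; rewrite opprD addrACA -scalerBr dotDl dot_conj.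
by rewrite !proj_orth ?addr0//; exact: hsubZ.
Qed.

Lemma proj_pythagoras v : sqn v = sqn (proj W v) + sqn (v - proj W v).
Proof.
have h := proj_orth v (proj_in v).
have -> : sqn v = sqn (proj W v + (v - proj W v)).
  by rewrite addrC subrK.
by rewrite (dotDD (proj W v)) (dotC (proj W v) (v - _)) h mulr0 addr0.
Qed.

Lemma proj_dot_le v : sqn (proj W v) <= sqn v.
Proof. by rewrite [leRHS]proj_pythagoras lerDl dot_ge0. Qed.

Lemma proj_nrm_le v : nrm (proj W v) <= nrm v.
Proof. by rewrite ler_wsqrtr// proj_dot_le. Qed.

Lemma proj_self v : dot (proj W v) v = sqn (proj W v).
Proof.
by rewrite -[X in dot _ X = _](subrK (proj W v)) dotDr dotC proj_orth ?add0r//; exact: proj_in.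
Qed.

Lemma proj_dist_le v w : W w -> sqn (v - proj W v) <= sqn (v - w).
Proof.
move=> Ww; have -> : v - w = (v - proj W v) + (proj W v - w) by rewrite addrA subrK.
rewrite (dotDD (v - proj W v)) (proj_orth v (w := _ - w)).
  by rewrite mulr0 addr0 lerDl dot_ge0.
by apply: hsubB => //; exact: proj_in.
Qed.

End projection.

Lemma proj_sub W1 W2 v : hsub W1 -> hsub W2 -> W1 `<=` W2 ->
  proj W1 (proj W2 v) = proj W1 v.
Proof.
move=> h1 h2 s12; apply/esym; apply: proj_uniq => //; first exact: proj_in.
move=> w Ww; have -> : v - proj W1 (proj W2 v) =
    (v - proj W2 v) + (proj W2 v - proj W1 (proj W2 v)) by rewrite addrA subrK.
by rewrite dotDl !proj_orth ?addr0//; exact: s12.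
Qed.

Lemma proj_dot_le_sub W1 W2 v : hsub W1 -> hsub W2 -> W1 `<=` W2 ->
  sqn (proj W1 v) <= sqn (proj W2 v).
Proof. by move=> h1 h2 s12; rewrite -(proj_sub v h1 h2 s12); exact: proj_dot_le. Qed.

Lemma proj_sub_eq W1 W2 v : hsub W1 -> hsub W2 -> W1 `<=` W2 ->
  sqn (proj W1 v) = sqn (proj W2 v) -> proj W1 v = proj W2 v.
Proof.
move=> h1 h2 s12; rewrite (proj_pythagoras h1 (proj W2 v)) proj_sub//.
move=> /eqP; rewrite -subr_eq0 opprD addrA subrr add0r oppr_eq0 => /eqP/dot_eq0.
by move=> /eqP; rewrite subr_eq0 => /eqP.
Qed.

(** By Pythagoras |P_m v - P_n v|^2 = |P_m v|^2 - |P_n v|^2 for m <= n, so the convergence of a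
    decreasing sequence of reals makes the projections Cauchy. Their limit has the two properties
    that characterize the projection onto the intersection. *)
Lemma proj_bigcap (W : nat -> set V) v : (forall n, hsub (W n)) ->
  (forall m n, (m <= n)%N -> W n `<=` W m) ->
  tends (fun n => proj (W n) v) (proj (\bigcap_n W n) v).
Proof.
move=> hW dec; pose a n := sqn (proj (W n) v).
have diff m n : (m <= n)%N ->
    sqn (proj (W m) v - proj (W n) v) = a m - a n.
  move=> mn; have := proj_pythagoras (hW n) (proj (W m) v).
  rewrite proj_sub//; last exact: dec.
  by rewrite /a => ->; rewrite [X in _ = X - _]addrC addrK.
have a_dec m n : (m <= n)%N -> a n <= a m.
  by move=> mn; rewrite -subr_ge0 -diff// dot_ge0.
pose E := range a.
have infE : has_inf E.
  by split; [exists (a 0%N), 0%N | exists 0 => _ [n _ <-]; exact: dot_ge0].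
have le_inf n : inf E <= a n by apply: ge_inf; [case: infE | exists n].
have [e e0|l hl] := @nrm_complete (fun n => proj (W n) v).
  have [_ [n0 _ <-] hn] := inf_adherent (exprn_gt0 2 e0) infE; exists n0.
  suff h m n : (n0 <= m)%N -> (m <= n)%N -> nrm (proj (W m) v - proj (W n) v) <= e.
    move=> m n mn nn; have [h1|/ltnW h1] := leqP m n; first exact: h.
    by rewrite nrmBC; exact: h.
  move=> nm mn; apply: le_of_sqr (ltW e0) _; rewrite nrm_sqr diff//.
  have := le_inf n; have := a_dec _ _ nm; move: (inf E) (e ^+ 2) hn => i f; lra.
suff -> : proj (\bigcap_n W n) v = l by [].
have hI := hsub_bigcap hW.
apply: proj_uniq => // [n _|w Ww].
  have [_ _] := hW n; apply; apply: tends_hclosure hl.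
  by exists n => m nm; apply: (dec _ _ nm); exact: proj_in.
apply/eqP; rewrite -normr_eq0 eq_le normr_ge0 andbT; apply/ler_addgt0Pl => e e0.
rewrite addr0; have wp : 0 < nrm w + 1 by have := nrm_ge0 w; lra.
have [n0 hn] := hl (e / (nrm w + 1)) (divr_gt0 e0 wp).
have := hn n0 (leqnn _).
have -> : dot (v - l) w = dot (proj (W n0) v - l) w.
  have -> : v - l = (v - proj (W n0) v) + (proj (W n0) v - l) by rewrite addrA subrK.
  by rewrite dotDl proj_orth ?add0r//; exact: Ww.
move=> h; have cs : `|dot (proj (W n0) v - l) w| <= nrm (proj (W n0) v - l) * nrm w.
  rewrite ler_norml cauchy_schwarz andbT lerNl -dotNl.
  by apply: le_trans (cauchy_schwarz _ _) _; rewrite nrmN.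
apply: le_trans cs _; apply: le_trans (ler_wpM2r (nrm_ge0 _) h) _.
by rewrite mulrAC ler_pdivrMr// ler_wpM2l ?(ltW e0)// lerDl.
Qed.

End hilbert_theory.

(** * Finite powers of a Hilbert space *)

Section hilbert_pi.
Variables (R : realType) (I : finType) (V : hilbertType R).
Implicit Types u v w : I -> V.

Definition pi_dot u v : R := \sum_i dot (u i) (v i).

Lemma pi_dotC u v : pi_dot u v = pi_dot v u.
Proof. by apply: eq_bigr => i _; rewrite dotC. Qed.

Lemma pi_dotDl u v w : pi_dot (u + v) w = pi_dot u w + pi_dot v w.
Proof. by rewrite /pi_dot -big_split; apply: eq_bigr => i _ /=; rewrite -dotDl. Qed.

Lemma pi_dotZl (r : R) u v : pi_dot (r%:C *: u) v = r * pi_dot u v.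
Proof. by rewrite /pi_dot mulr_sumr; apply: eq_bigr => i _; rewrite -dotZl. Qed.

Lemma pi_dot_conj (z : R[i]) u v : pi_dot (z *: u) v = pi_dot u (conjc z *: v).
Proof. by apply: eq_bigr => i _; rewrite -dot_conj. Qed.

Lemma pi_dot_ge0 u : 0 <= pi_dot u u.
Proof. by apply: sumr_ge0 => i _; exact: dot_ge0. Qed.

Lemma pi_dot_eq0 u : pi_dot u u = 0 -> u = 0.
Proof.
move=> /eqP; rewrite psumr_eq0; last by move=> i _; exact: dot_ge0.
by move=> /allP h; apply/funext => i; apply/dot_eq0/eqP/h; rewrite mem_index_enum.
Qed.

Lemma dot_le_pi u i : sqn (u i) <= pi_dot u u.
Proof. by rewrite /pi_dot (bigD1 i)//= lerDl sumr_ge0// => j _; exact: dot_ge0. Qed.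

Lemma pi_complete (u : nat -> I -> V) :
  (forall e : R, 0 < e -> exists n0 : nat, forall m n, (n0 <= m)%N -> (n0 <= n)%N ->
     pi_dot (u m - u n) (u m - u n) <= e) ->
  exists l, forall e : R, 0 < e -> exists n0 : nat, forall n, (n0 <= n)%N ->
     pi_dot (u n - l) (u n - l) <= e.
Proof.
move=> cu.
have /choice[l hl] : forall i, exists l : V, forall e : R, 0 < e ->
    exists n0 : nat, forall n, (n0 <= n)%N -> sqn (u n i - l) <= e.
  move=> i; apply: hilbert_complete => e e0; have [n0 hn] := cu e e0.
  by exists n0 => m n mn nn; apply: le_trans (hn _ _ mn nn); exact: (dot_le_pi (u m - u n)).
exists l => e e0; pose k : R := (#|I|.+1)%:R.
have k0 : 0 < k by rewrite ltr0n.
have /choice[n0 hn] : forall i, exists n0 : nat, forall n, (n0 <= n)%N ->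
    sqn (u n i - l i) <= e / k.
  by move=> i; apply: hl; exact: divr_gt0.
exists (\max_i n0 i)%N => n nn.
apply: (@le_trans _ _ (\sum_(i : I) e / k)).
  by apply: ler_sum => i _; apply: hn; apply: leq_trans nn; exact: leq_bigmax.
rewrite sumr_const -[X in X <= _]mulr_natr mulrAC ler_pdivrMr// ler_wpM2l ?ler_nat ?(ltW e0)//.
Qed.

HB.instance Definition _ := isHilbert.Build R (I -> V)
  pi_dotC pi_dotDl pi_dotZl pi_dot_conj pi_dot_ge0 pi_dot_eq0 pi_complete.

Lemma pi_dotE u v : dot u v = \sum_i dot (u i) (v i). Proof. by []. Qed.

Lemma nrm_le_pi u i : nrm (u i) <= nrm u.
Proof. by rewrite ler_wsqrtr//; exact: dot_le_pi. Qed.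

Lemma nrm_pi_le u : nrm u <= \sum_i nrm (u i).
Proof.
have s0 (P : pred I) : 0 <= \sum_(i | P i) nrm (u i) by apply: sumr_ge0 => i _; exact: nrm_ge0.
apply: le_of_sqr => //; rewrite nrm_sqr pi_dotE expr2 mulr_suml; apply: ler_sum => i _.
rewrite -nrm_sqr expr2 ler_wpM2l ?nrm_ge0// (bigD1 i)//= lerDl; exact: s0.
Qed.

Definition single (i : I) (x : V) : I -> V := fun j => if j == i then x else 0.

Lemma single_sum u : u = \sum_i single i (u i).
Proof.
apply/funext => j; rewrite fct_sumE (bigD1 j)//= /single eqxx big1 ?addr0// => i.
by rewrite eq_sym => /negPf ->.
Qed.

Lemma dot_single u i x : dot u (single i x) = dot (u i) x.
Proof.
rewrite pi_dotE (bigD1 i)//= /single eqxx big1 ?addr0// => j /negPf ->.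
exact: dot0r.
Qed.

Lemma nrm_single i x : nrm (single i x) = nrm x.
Proof. by rewrite /nrm dot_single /single eqxx. Qed.

Lemma single_linear i (z : R[i]) x y : single i (z *: x + y) = z *: single i x + single i y.
Proof.
apply/funext => j; rewrite /single; rewrite !fctE; case: ifP => //= _.
by rewrite scaler0 addr0.
Qed.

End hilbert_pi.

(** * Truncation of square-summable functions *)

Section truncation.
Variables (R : realType) (J : choiceType).
Implicit Types (u v : ell2 R J) (P : pred J) (X Y : {fset J}).

Lemma dot_ell2E u v : dot u v = ell2_dot u v. Proof. by []. Qed.

Lemma nrm_nsq u : nrm u ^+ 2 = nsq u.
Proof. by rewrite nrm_sqr dot_ell2E ell2_dotE. Qed.

Lemma abs2_le_nrm u i : abs2 (u i) <= nrm u ^+ 2.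
Proof. by rewrite nrm_nsq abs2_le_nsq. Qed.

Lemma normc_le_nrm u i : normc (u i) <= nrm u.
Proof. by apply: le_of_sqr; rewrite ?nrm_ge0// normc_abs2 abs2_le_nrm. Qed.

Fact trunc_subproof P u : (fun j => if P j then u j else 0) \in @square_summable R J.
Proof.
have [X|w <- _] := @ell2_of_bound R J (fun j => if P j then u j else 0) (nsq u); last exact: valP.
apply: le_trans (nsq_sum_le u X); apply: ler_sum => i _.
by case: ifP => // _; rewrite abs2_0 abs2_ge0.
Qed.

Definition trunc P u : ell2 R J := Ell2 (trunc_subproof P u).

Lemma truncE P u j : trunc P u j = if P j then u j else 0. Proof. by []. Qed.

Lemma trunc_linear P (z : R[i]) u v : trunc P (z *: u + v) = z *: trunc P u + trunc P v.
Proof. by apply: ell2P => j; rewrite !ell2E /=; case: (P j) => //; rewrite mulr0 addr0. Qed.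

Lemma truncD P u v : trunc P (u + v) = trunc P u + trunc P v.
Proof. by rewrite -[u]scale1r trunc_linear !scale1r. Qed.

Lemma truncB P u v : trunc P (u - v) = trunc P u - trunc P v.
Proof. by rewrite addrC -scaleN1r trunc_linear scaleN1r addrC. Qed.

Lemma nsq_truncC P u : nsq u = nsq (trunc P u) + nsq (trunc (predC P) u).
Proof.
have := @nsq_lin_eq R J [:: u] [:: trunc P u; trunc (predC P) u].
rewrite !big_cons !big_nil !addr0; apply => i; rewrite !big_cons !big_nil !addr0 !truncE /=.
by case: (P i); rewrite /= abs2_0 ?addr0 ?add0r.
Qed.

Lemma subr_trunc P u : u - trunc P u = trunc (predC P) u.
Proof. by apply: ell2P => j; rewrite !ell2E /=; case: (P j); rewrite /= ?subrr ?subr0. Qed.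

Lemma trunc_le P u : nrm (trunc P u) <= nrm u.
Proof.
by apply: le_of_sqr; rewrite ?nrm_ge0// !nrm_nsq (nsq_truncC P u) lerDl nsq_ge0.
Qed.

Lemma trunc_mono P Q u : subpred P Q -> nrm (trunc P u) <= nrm (trunc Q u).
Proof.
move=> PQ; rewrite (_ : trunc P u = trunc P (trunc Q u)) ?trunc_le//.
by apply: ell2P => j; rewrite !truncE; case: ifP => // /PQ ->.
Qed.

Lemma nsq_trunc X u : nsq (trunc (mem X) u) = \sum_(i <- X) abs2 (u i).
Proof.
apply/eqP; rewrite eq_le; apply/andP; split; last first.
  apply: le_trans (nsq_sum_le (trunc (mem X) u) X); rewrite big_seq [leRHS]big_seq.
  by apply: ler_sum => i iX; rewrite truncE /= iX.
apply/nsq_leP => Y; rewrite (bigID (mem X)) /= [X in _ + X <= _]big1 ?addr0; last first.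
  by move=> i /negPf h; rewrite h abs2_0.
rewrite -big_filter [leRHS](bigID (mem Y)) /= -[leLHS]addr0 lerD//; last first.
  by apply: sumr_ge0 => i _; exact: abs2_ge0.
rewrite -[leRHS]big_filter.
rewrite (perm_big [seq i <- X | i \in Y]) /=; last first.
  apply: uniq_perm; rewrite ?filter_uniq ?fset_uniq// => i.
  by rewrite !mem_filter andbC.
rewrite big_seq [leRHS]big_seq; apply: ler_sum => i; rewrite mem_filter => /andP[_ iX].
by rewrite iX.
Qed.

Lemma trunc_tail u (e : R) : 0 < e -> exists X : {fset J}, forall P : pred J,
  {subset X <= P} -> nrm (u - trunc P u) <= e.
Proof.
move=> e0; have [X hX] := nsq_approx u (exprn_gt0 2 e0); exists X => P XP.
apply: le_of_sqr (ltW e0) _; rewrite subr_trunc nrm_nsq.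
have := nsq_truncC P u; have : nsq (trunc (mem X) u) <= nsq (trunc P u).
  by rewrite -!nrm_nsq ler_sqr ?nnegrE ?nrm_ge0//; exact: trunc_mono.
rewrite nsq_trunc; move: (nsq _) (nsq _) (nsq _) (\sum_(_ <- _) _) (e ^+ 2) hX => *.
lra.
Qed.

Lemma trunc_sum X u : trunc (mem X) u = \sum_(g <- X) u g *: delta R g.
Proof.
have sumE (s : seq J) j : (\sum_(g <- s) u g *: delta R g) j =
    \sum_(g <- s) u g * (j == g)%:R.
  by elim: s => [|g s IH]; rewrite ?big_nil ?big_cons// ell2ED IH.
apply: ell2P => j; rewrite truncE sumE /=; case: ifP => jX.
  rewrite (big_fsetD1 j)//= eqxx mulr1 big_seq big1 ?addr0// => g.
  by rewrite !inE eq_sym => /andP[/negPf -> _]; rewrite mulr0.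
rewrite big_seq big1// => g gX; case: eqP => [jg|_]; last by rewrite mulr0.
by rewrite jg gX in jX.
Qed.

End truncation.

(** * The group von Neumann algebra *)

Section groupvN_theory.
Variables (R : realType) (G : groupType).
Local Notation H := (ell2 R G).
Local Notation L := (groupvN R G).
Implicit Types (u v : H) (g h : G) (s t : L) (z : R[i]).

Lemma rregE g u k : rreg R g u k = u (k * g)%g. Proof. by []. Qed.
Lemma lregE g u k : lreg R g u k = u (g^-1 * k)%g. Proof. by []. Qed.

Lemma rreg_comp g h u : rreg R g (rreg R h u) = rreg R (g * h)%g u.
Proof. by apply: ell2P => k; rewrite !rregE mulgA. Qed.

Lemma lreg_comp g h u : lreg R g (lreg R h u) = lreg R (g * h)%g u.
Proof. by apply: ell2P => k; rewrite !lregE invgM mulgA. Qed.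

Lemma rreg_id u : rreg R 1%g u = u.
Proof. by apply: ell2P => k; rewrite rregE mulg1. Qed.

Lemma lreg_id u : lreg R 1%g u = u.
Proof. by apply: ell2P => k; rewrite lregE invg1 mul1g. Qed.

Lemma rregVK g u : rreg R g (rreg R g^-1%g u) = u.
Proof. by rewrite rreg_comp mulgV rreg_id. Qed.

Lemma rreg_delta g h : rreg R g (delta R h) = delta R (h * g^-1)%g.
Proof. by apply: ell2P => k /=; rewrite -(inj_eq (mulIg g^-1%g)) mulgK. Qed.

Lemma nsq_reindex (e e' : G -> G) (eK : cancel e e') (e'K : cancel e' e) u :
  nsq (reindex_ell2 eK e'K u) = nsq u.
Proof. by rewrite /nsq (normsq_comp _ eK e'K). Qed.

Lemma dot_rreg g u v : dot (rreg R g u) (rreg R g v) = dot u v.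
Proof. by rewrite !dot_ell2E /ell2_dot -linearB -linearD /= !nsq_reindex. Qed.

Lemma dot_lreg g u v : dot (lreg R g u) (lreg R g v) = dot u v.
Proof. by rewrite !dot_ell2E /ell2_dot -linearB -linearD /= !nsq_reindex. Qed.

Lemma nrm_lreg g u : nrm (lreg R g u) = nrm u. Proof. by rewrite /nrm dot_lreg. Qed.

Lemma opnorm_leP (I : choiceType) (T : ell2 R I -> ell2 R I) (M : R) : 0 <= M ->
  opnorm_le T M <-> forall x, nrm (T x) <= M * nrm x.
Proof.
move=> M0; split=> h u; have := h u; rewrite !nsqE -EFinM lee_fin -!nrm_nsq -exprMn.
  by move=> h'; apply: le_of_sqr => //; rewrite mulr_ge0 ?nrm_ge0.
by move=> h'; rewrite ler_sqr ?nnegrE ?mulr_ge0 ?nrm_ge0.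
Qed.

Lemma opnorm_le_norm (I : choiceType) (T : ell2 R I -> ell2 R I) (M : R) :
  opnorm_le T M -> opnorm_le T `|M|.
Proof. by move=> h u; rewrite real_normK ?num_real. Qed.

Lemma groupvN_bounded t : exists2 M : R, 0 <= M & forall u, nrm (t u) <= M * nrm u.
Proof.
have [M hM] := bop_bounded t; exists `|M| => //.
exact/(opnorm_leP _ (normr_ge0 M))/opnorm_le_norm.
Qed.

Lemma groupvN_rreg t g u : t (rreg R g u) = rreg R g (t u).
Proof.
have /asboolP/(_ g) h := valP t.
by have := congr1 (fun T : bop R G => T u) h.
Qed.

Lemma groupvN_linear t z u v : t (z *: u + v) = z *: t u + t v.
Proof. by rewrite linearP. Qed.

Lemma groupvN_exists (f : H -> H) (M : R) :
  (forall z u v, f (z *: u + v) = z *: f u + f v) ->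
  (forall u, nrm (f u) <= M * nrm u) ->
  (forall g u, f (rreg R g u) = rreg R g (f u)) -> exists t, forall u, t u = f u.
Proof.
move=> fl fM fr.
have fb : f \in @bounded_linear R G.
  apply/asboolP; split; first exact: fl.
  exists `|M|; apply/opnorm_leP => // u; apply: le_trans (fM u) _.
  by rewrite ler_wpM2r ?nrm_ge0// ler_norm.
have fc : Bop fb \in @commutes_rreg R G.
  by apply/asboolP => g; apply: bop_eqP => u; exact: fr.
by exists (GroupvN fc).
Qed.

Lemma groupvN_mulE s t u : (s * t) u = s (t u). Proof. by []. Qed.
Lemma groupvN_addE s t u : (s + t) u = s u + t u. Proof. by []. Qed.
Lemma groupvN_0E u : (0 : L) u = 0. Proof. by []. Qed.
Lemma groupvN_1E u : (1 : L) u = u. Proof. by []. Qed.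

Lemma groupvN_sumE (I : Type) (r : seq I) (P : pred I) (F : I -> L) u :
  (\sum_(i <- r | P i) F i) u = \sum_(i <- r | P i) F i u.
Proof. by apply: (big_morph (fun t : L => t u)). Qed.

Lemma groupvN_ext s t : (forall u, s u = t u) -> s = t.
Proof. by move=> st; apply: val_inj; apply: bop_eqP. Qed.

Lemma groupvN_approx t u (e : R) : 0 < e -> exists X : {fset G}, forall Y : {fset G},
  (X `<=` Y)%fset -> nrm (t u - \sum_(g <- Y) u g *: t (delta R g)) <= e.
Proof.
move=> e0; have [M M0 hM] := groupvN_bounded t.
have M1 : 0 < M + 1 by lra.
have [X hX] := trunc_tail u (divr_gt0 e0 M1); exists X => Y /fsubsetP XY.
have -> : \sum_(g <- Y) u g *: t (delta R g) = t (trunc (mem Y) u).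
  by rewrite trunc_sum linear_sum; apply: eq_bigr => g _; rewrite linearZ.
rewrite -linearB; apply: le_trans (hM _) _.
have /(ler_wpM2l M0) := hX (mem Y) XY.
move/le_trans; apply; rewrite mulrA ler_pdivrMr// mulrC ler_wpM2l ?(ltW e0)//.
by rewrite lerDl.
Qed.

Lemma delta_rreg g : delta R g = rreg R g^-1%g (delta R 1%g).
Proof. by rewrite rreg_delta invgK mul1g. Qed.

(** The vector delta_1 is separating for L(G): its right translates are all the delta_g, which span
    a dense subspace, and elements of L(G) are bounded and commute with right translations. *)
Lemma groupvN_faithful s t : s (delta R 1%g) = t (delta R 1%g) -> s = t.
Proof.
move=> st; apply: groupvN_ext => u; apply/eqP; rewrite -subr_eq0; apply/eqP/nrm_eq0/eqP.
rewrite eq_le nrm_ge0 andbT; apply/ler_addgt0Pl => e e0; rewrite addr0.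
have [X hX] := groupvN_approx s u (e := e / 2) ltac:(lra).
have [Y hY] := groupvN_approx t u (e := e / 2) ltac:(lra).
have := hX (X `|` Y)%fset (fsubsetUl _ _); have := hY (X `|` Y)%fset (fsubsetUr _ _).
under eq_bigr do rewrite delta_rreg groupvN_rreg -st -groupvN_rreg -delta_rreg.
set w := \sum_(_ <- _) _ => h1 h2; have := nrmB_le (s u) w (t u).
by rewrite (nrmBC w); move: (nrm _) (nrm _) (nrm _) h1 h2 => *; lra.
Qed.

(* Both traces are limits of the sums of s(g) t(g^-1) over finite sets of g. *)
Lemma vNtraceC s t : vNtrace (s * t) = vNtrace (t * s).
Proof.
apply/eqP; rewrite -subr_eq0; apply/eqP/eq0_normc/eqP.
rewrite eq_le; apply/andP; split; last first.
  by case: (_ - _) => a b; exact: sqrtr_ge0.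
apply/ler_addgt0Pl => e e0; rewrite addr0.
have [X hX] := groupvN_approx s (t (delta R 1%g)) (e := e / 2) ltac:(lra).
have [Y hY] := groupvN_approx t (s (delta R 1%g)) (e := e / 2) ltac:(lra).
(* Z contains X and its set of inverses contains Y, so the two approximating sums correspond term by
   term under inversion. *)
pose Z := (X `|` [fset g^-1%g | g in Y])%fset.
pose Z' := [fset g^-1%g | g in Z]%fset.
have YZ : (Y `<=` Z')%fset.
  apply/fsubsetP => g gY; apply/imfsetP; exists g^-1%g; rewrite ?invgK//=.
  by rewrite inE orbC; apply/orP; left; apply/imfsetP; exists g.
have := hX Z (fsubsetUl _ _); have := hY Z' YZ.
set A := \sum_(_ <- _) _; set B := \sum_(_ <- _) _ => hA hB.
have coord (S : {fset G}) (a b : L) :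
    (\sum_(g <- S) b (delta R 1%g) g *: a (delta R g)) 1%g =
    \sum_(g <- S) b (delta R 1%g) g * a (delta R 1%g) g^-1%g.
  rewrite (big_morph (fun u : H => u 1%g) (fun _ _ => erefl) erefl).
  by apply: eq_bigr => g _; rewrite ell2E delta_rreg groupvN_rreg rregE mul1g.
have AB : A 1%g = B 1%g.
  rewrite /A /B !coord /Z' big_imfset /=; last by move=> ? ? _ _; exact: invg_inj.
  by apply: eq_bigr => g _; rewrite invgK mulrC.
have n1 := le_trans (normc_le_nrm _ 1%g) hB; have n2 := le_trans (normc_le_nrm _ 1%g) hA.
move: n1 n2; rewrite !ell2E AB -!groupvN_mulE => n1 n2.
rewrite /vNtrace; set x := (s * t) _ _ in n1 *; set y := (t * s) _ _ in n2 *.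
have -> : x - y = (x - B 1%g) + (- (y - B 1%g)) by rewrite opprB addrA subrK.
apply: le_trans (le_normcD _ _) _; rewrite normcN.
by move: (normc _) (normc _) n1 n2 => *; lra.
Qed.

End groupvN_theory.

(** * Von Neumann dimension *)

Section matrix_operators.
Variables (R : realType) (G : groupType).
Local Notation H := (ell2 R G).
Local Notation L := (groupvN R G).
Implicit Types (z : R[i]) (g : G).

Definition mxop (I J : finType) (M : J -> I -> L) (u : I -> H) : J -> H :=
  fun j => \sum_i M j i (u i).

Definition rtrans (I : finType) g (u : I -> H) : I -> H := fun i => rreg R g (u i).

Section one_matrix.
Variables (I J : finType) (M : J -> I -> L).

Lemma mxop_linear z u v : mxop M (z *: u + v) = z *: mxop M u + mxop M v.
Proof.
apply/funext => j; rewrite !fctE /mxop scaler_sumr -big_split /=.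
by apply: eq_bigr => i _; rewrite groupvN_linear.
Qed.

Lemma mxopD u v : mxop M (u + v) = mxop M u + mxop M v.
Proof. by rewrite -[u]scale1r mxop_linear !scale1r. Qed.

Lemma mxop0 : mxop M 0 = 0.
Proof. by apply: (@addrI _ (mxop M 0)); rewrite -mxopD !addr0. Qed.

Lemma mxopZ z u : mxop M (z *: u) = z *: mxop M u.
Proof. by rewrite -[z *: u]addr0 mxop_linear mxop0 addr0. Qed.

Lemma mxopB u v : mxop M (u - v) = mxop M u - mxop M v.
Proof. by rewrite addrC -scaleN1r mxop_linear scaleN1r addrC. Qed.

Lemma mxop_bounded : exists2 C : R, 0 < C & forall u, nrm (mxop M u) <= C * nrm u.
Proof.
have /choice[C hC] : forall ij : J * I, exists C : R, 0 <= C /\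
    forall u, nrm (M ij.1 ij.2 u) <= C * nrm u.
  by move=> [j i]; have [C C0 hC] := groupvN_bounded (M j i); exists C.
exists (1 + \sum_j \sum_i C (j, i)).
  rewrite ltr_wpDr// sumr_ge0// => j _; rewrite sumr_ge0// => i _; exact: (hC _).1.
move=> u; apply: le_trans (nrm_pi_le _) _.
rewrite mulrDl mul1r -[leLHS]add0r lerD ?nrm_ge0// mulr_suml; apply: ler_sum => j _.
rewrite mulr_suml /mxop; elim/big_ind2: _ => [|x a y b xa yb|i _].
- by rewrite nrm0.
- by apply: le_trans (nrmD_le _ _) _; exact: lerD.
apply: le_trans ((hC (j, i)).2 _) _.
by apply: ler_wpM2l; [exact: (hC _).1 | exact: nrm_le_pi].
Qed.

Lemma mxop_rtrans g u : mxop M (rtrans g u) = rtrans g (mxop M u).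
Proof.
apply/funext => j; rewrite /mxop /rtrans linear_sum; apply: eq_bigr => i _.
exact: groupvN_rreg.
Qed.

Lemma mxop_single i x j : mxop M (single i x) j = M j i x.
Proof.
rewrite /mxop (bigD1 i)//= /single eqxx big1 ?addr0// => k /negPf ->.
by rewrite linear0.
Qed.

End one_matrix.

Lemma mxop_comp (I J K : finType) (M : K -> J -> L) (M' : J -> I -> L) u :
  mxop M (mxop M' u) = mxop (fun k i => \sum_j M k j * M' j i) u.
Proof.
apply/funext => k; rewrite /mxop.
under eq_bigr do rewrite linear_sum.
rewrite exchange_big /=; apply: eq_bigr => i _.
by rewrite groupvN_sumE.
Qed.

Lemma mxop_inj (I J : finType) (M M' : J -> I -> L) :
  (forall u, mxop M u = mxop M' u) -> M = M'.
Proof.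
move=> h; apply/funext => j; apply/funext => i; apply: groupvN_ext => x.
by rewrite -mxop_single h mxop_single.
Qed.

(** Used for orthogonal projections onto Hilbert modules: as matrices over L(G) they acquire a trace
    and supply rows that can be read as algebraic relations. *)
Lemma mxop_exists (I J : finType) (T : (I -> H) -> (J -> H)) (C : R) :
  (forall z u v, T (z *: u + v) = z *: T u + T v) ->
  (forall u, nrm (T u) <= C * nrm u) ->
  (forall g u, T (rtrans g u) = rtrans g (T u)) ->
  exists M : J -> I -> L, forall u, T u = mxop M u.
Proof.
move=> Tl TC Tr.
have /choice[M hM] : forall ji : J * I, exists t : L,
    forall x, t x = T (single ji.2 x) ji.1.
  move=> [j i]; apply: (@groupvN_exists _ _ _ C) => /= [z u v|u|g u].
  - by rewrite single_linear Tl.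
  - by apply: le_trans (nrm_le_pi _ _) _; rewrite -[nrm u](nrm_single i); exact: TC.
  - rewrite -[RHS]/(rtrans g (T (single i u)) j) -Tr; congr (T _ _).
    by apply/funext => k; rewrite /rtrans /single; case: ifP => // _; rewrite linear0.
have T0 : T 0 = 0.
  by apply: (@addrI _ (T 0)); have := Tl 1 0 0; rewrite !scale1r !addr0 => <-.
have TD u v : T (u + v) = T u + T v by rewrite -[u]scale1r Tl !scale1r.
exists (fun j i => M (j, i)) => u; rewrite [in LHS](single_sum u).
rewrite (big_morph T TD T0); apply/funext => j; rewrite fct_sumE /mxop.
by apply: eq_bigr => i _; rewrite hM.
Qed.

Lemma dot_rtrans (I : finType) g (u v : I -> H) : dot (rtrans g u) (rtrans g v) = dot u v.
Proof. by rewrite !pi_dotE; apply: eq_bigr => i _; rewrite dot_rreg. Qed.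

Lemma rtransVK (I : finType) g (u : I -> H) : rtrans g (rtrans g^-1%g u) = u.
Proof. by apply/funext => i; rewrite /rtrans rregVK. Qed.

Lemma rtrans_linear (I : finType) g z (u v : I -> H) :
  rtrans g (z *: u + v) = z *: rtrans g u + rtrans g v.
Proof. by apply/funext => i; rewrite /rtrans linearP. Qed.

Lemma rtransB (I : finType) g (u v : I -> H) : rtrans g (u - v) = rtrans g u - rtrans g v.
Proof. by rewrite addrC -scaleN1r rtrans_linear scaleN1r addrC. Qed.

Lemma nrm_rtrans (I : finType) g (u : I -> H) : nrm (rtrans g u) = nrm u.
Proof. by rewrite /nrm dot_rtrans. Qed.

(* Closed subspaces of l^2(G)^I invariant under right translations: the Hilbert
   L(G)-modules. *)
Definition hmod (I : finType) (W : set (I -> H)) :=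
  hsub W /\ forall g u, W u -> W (rtrans g u).

Lemma hmod_closure (I : finType) (W : set (I -> H)) : W 0 ->
  (forall z u v, W u -> W v -> W (z *: u + v)) ->
  (forall g u, W u -> W (rtrans g u)) -> hmod (hclosure W).
Proof.
move=> W0 Wl Wr; split; first exact: hsub_closure.
move=> g u hu e e0; have [w Ww uw] := hu e e0; exists (rtrans g w); first exact: Wr.
by rewrite -rtransB nrm_rtrans.
Qed.

Lemma hmod_image (I J : finType) (W : set (I -> H)) (M : J -> I -> L) :
  hmod W -> hmod (hclosure [set mxop M w | w in W]).
Proof.
move=> [[W0 Wl _] Wr]; apply: hmod_closure.
- by exists 0 => //; rewrite mxop0.
- by move=> z _ _ [u Wu <-] [v Wv <-]; exists (z *: u + v); [exact: Wl | exact: mxop_linear].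
- by move=> g _ [u Wu <-]; exists (rtrans g u); [exact: Wr | exact: mxop_rtrans].
Qed.

Definition mxker (I J : finType) (M : J -> I -> L) : set (I -> H) := [set u | mxop M u = 0].

Lemma hmod_ker (I J : finType) (M : J -> I -> L) : hmod (mxker M).
Proof.
split; last by move=> g u; rewrite /mxker /= mxop_rtrans => ->;
  apply/funext => j; rewrite /rtrans linear0.
split; first exact: mxop0.
  by move=> z u v; rewrite /mxker /= mxop_linear => -> ->; rewrite scaler0 addr0.
move=> u hu; apply/nrm_eq0/eqP; rewrite eq_le nrm_ge0 andbT.
have [C C0 hC] := mxop_bounded M.
apply/ler_addgt0Pl => e e0; rewrite addr0.
have [w wM uw] := hu (e / C) (divr_gt0 e0 C0).
have := hC (u - w); rewrite mxopB wM subr0 => /le_trans; apply.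
by rewrite mulrC -ler_pdivlMr.
Qed.

Lemma hmod_setT (I : finType) : hmod [set: I -> H].
Proof. by []. Qed.

Lemma hmod_setI (I : finType) (W1 W2 : set (I -> H)) : hmod W1 -> hmod W2 -> hmod (W1 `&` W2).
Proof.
move=> [a1 b1] [a2 b2]; split; first exact: hsub_setI.
by move=> g u [? ?]; split; [exact: b1 | exact: b2].
Qed.

Lemma hmod_bigcap (I : finType) (W : nat -> set (I -> H)) :
  (forall n, hmod (W n)) -> hmod (\bigcap_n W n).
Proof.
move=> hW; split; first by apply: hsub_bigcap => n; exact: (hW n).1.
by move=> g u hu n _; apply: (hW n).2; exact: hu.
Qed.

Lemma proj_rtrans (I : finType) (W : set (I -> H)) g u : hmod W ->
  proj W (rtrans g u) = rtrans g (proj W u).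
Proof.
move=> [hW Wr]; apply: proj_uniq => //; first by apply: Wr; exact: proj_in.
move=> w Ww; rewrite -rtransB -(rtransVK g w) dot_rtrans proj_orth//; exact: Wr.
Qed.

Lemma proj_mxop (I : finType) (W : set (I -> H)) : hmod W ->
  exists P : I -> I -> L, forall u, proj W u = mxop P u.
Proof.
move=> hW; apply: (@mxop_exists _ _ _ 1) => [z u v|u|g u].
- by apply: proj_linear; exact: hW.1.
- by rewrite mul1r; apply: proj_nrm_le; exact: hW.1.
- exact: proj_rtrans.
Qed.

Definition basis (I : finType) (i : I) : I -> H := single i (delta R 1%g).

(* The von Neumann dimension of W, i.e. the trace of the projection onto W. *)
Definition hdim (I : finType) (W : set (I -> H)) : R :=
  \sum_i sqn (proj W (basis i)).

Lemma hdim_trace (I : finType) (W : set (I -> H)) (P : I -> I -> L) : hmod W ->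
  (forall u, proj W u = mxop P u) -> hdim W = \sum_i complex.Re (vNtrace (P i i)).
Proof.
move=> hW hP; apply: eq_bigr => i _.
rewrite -proj_self; last exact: hW.1.
by rewrite dot_single dot_ell2E ell2_dot_delta hP mxop_single.
Qed.

(** The trace property tr(BA) = tr(AB). It takes the place of Murray-von Neumann equivalence and
    requires no partial isometry: any pair of factorizations will do. *)
Lemma hdim_similar (I J : finType) (W : set (I -> H)) (W' : set (J -> H))
    (A : J -> I -> L) (B : I -> J -> L) : hmod W -> hmod W' ->
  (forall u, proj W u = mxop B (mxop A u)) ->
  (forall u, proj W' u = mxop A (mxop B u)) -> hdim W = hdim W'.
Proof.
move=> hW hW' h h'.
rewrite (hdim_trace hW (P := fun k i => \sum_j B k j * A j i)); last first.
  by move=> u; rewrite h mxop_comp.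
rewrite (hdim_trace hW' (P := fun k i => \sum_j A k j * B j i)); last first.
  by move=> u; rewrite h' mxop_comp.
have trS (K K' : finType) (C : K -> K' -> L) (D : K' -> K -> L) k :
    complex.Re (vNtrace (\sum_j C k j * D j k)) = \sum_j complex.Re (vNtrace (C k j * D j k)).
  by apply: (big_morph (fun t : L => complex.Re (vNtrace t))) => // s t;
    rewrite /vNtrace groupvN_addE ell2ED raddfD.
under eq_bigr do rewrite trS; under [RHS]eq_bigr do rewrite trS.
rewrite exchange_big; apply: eq_bigr => j _; apply: eq_bigr => i _.
by rewrite vNtraceC.
Qed.

Lemma hdim_le (I : finType) (W1 W2 : set (I -> H)) : hmod W1 -> hmod W2 ->
  W1 `<=` W2 -> hdim W1 <= hdim W2.
Proof.
by move=> h1 h2 s12; apply: ler_sum => i _; apply: proj_dot_le_sub => //; [case: h1|case: h2].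
Qed.

Lemma proj_basis_ext (I : finType) (W1 W2 : set (I -> H)) : hmod W1 -> hmod W2 ->
  (forall i, proj W1 (basis i) = proj W2 (basis i)) -> W1 = W2.
Proof.
move=> h1 h2 h; have [P1 hP1] := proj_mxop h1; have [P2 hP2] := proj_mxop h2.
have P12 : P1 = P2.
  apply/funext => j; apply/funext => i; apply: groupvN_faithful.
  by rewrite -!mxop_single -hP1 -hP2; have := h i; rewrite /basis => ->.
apply/seteqP; split=> u Wu.
  by rewrite -(proj_id h1.1 Wu) hP1 P12 -hP2; apply: proj_in; case: h2.
by rewrite -(proj_id h2.1 Wu) hP2 -P12 -hP1; apply: proj_in; case: h1.
Qed.

(** Faithfulness of the dimension. Density statements are obtained from it by counting dimensions
    instead of approximating vectors. *)
Lemma hdim_eq (I : finType) (W1 W2 : set (I -> H)) : hmod W1 -> hmod W2 ->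
  W1 `<=` W2 -> hdim W2 <= hdim W1 -> W1 = W2.
Proof.
move=> h1 h2 s12 le21; apply: proj_basis_ext => // i.
apply: (proj_sub_eq h1.1 h2.1 s12); apply/eqP; rewrite eq_le.
rewrite (proj_dot_le_sub _ h1.1 h2.1 s12) /=.
move: le21; rewrite /hdim (bigD1 i)//= [leRHS](bigD1 i)//=.
have : \sum_(j | j != i) sqn (proj W1 (basis j)) <=
    \sum_(j | j != i) sqn (proj W2 (basis j)).
  by apply: ler_sum => j _; exact: proj_dot_le_sub h1.1 h2.1 s12.
by move: (dot _ _) (dot _ _) (\sum_(_ | _) _) (\sum_(_ | _) _) => *; lra.
Qed.

Lemma tends_dot (V : hilbertType R) (x : nat -> V) l (e : R) : tends x l -> 0 < e ->
  exists n0 : nat, forall n, (n0 <= n)%N -> sqn (x n) <= sqn l + e.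
Proof.
move=> xl e0; have b0 : 0 < 2 * nrm l + 1 by have := nrm_ge0 l; lra.
have dp : 0 < Num.min 1 (e / (2 * nrm l + 1)) by rewrite lt_min ltr01 divr_gt0.
have [n0 hn] := xl _ dp; exists n0 => n nn; rewrite -!nrm_sqr.
have := hn n nn; have := nrmD_le (x n - l) l; rewrite subrK.
set d := nrm (x n - l); rewrite le_min ler_pdivlMr// => h1 /andP[h2 h3].
have := nrm_ge0 (x n - l); rewrite -/d; have := nrm_ge0 (x n); have := nrm_ge0 l.
by move: (nrm l) (nrm (x n)) d h1 h2 h3 => a b d *; nra.
Qed.

(** Normality of the trace: the dimension is a finite sum of squared norms of projections of basis
    vectors, each of which converges by [proj_bigcap]. *)
Lemma hdim_bigcap (I : finType) (W : nat -> set (I -> H)) (e : R) :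
  (forall n, hmod (W n)) -> (forall m n, (m <= n)%N -> W n `<=` W m) -> 0 < e ->
  exists n, hdim (W n) <= hdim (\bigcap_n W n) + e.
Proof.
move=> hW dec e0; pose k : R := (#|I|.+1)%:R.
have k0 : 0 < k by rewrite ltr0n.
have /choice[n0 hn] : forall i : I, exists n0 : nat, forall n, (n0 <= n)%N ->
    sqn (proj (W n) (basis i)) <=
    sqn (proj (\bigcap_n W n) (basis i)) + e / k.
  move=> i; apply: (@tends_dot (I -> H) (fun n => proj (W n) (basis i))).
    by apply: proj_bigcap => // n; exact: (hW n).1.
  exact: divr_gt0.
exists (\max_i n0 i)%N.
apply: (@le_trans _ _ (hdim (\bigcap_n W n) + \sum_(i : I) e / k)).
  by rewrite /hdim -big_split /=; apply: ler_sum => i _; apply: hn; exact: leq_bigmax.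
rewrite lerD2l sumr_const -[X in X <= _]mulr_natr mulrAC ler_pdivrMr//.
by rewrite ler_wpM2l ?ler_nat ?(ltW e0).
Qed.

End matrix_operators.

Ltac gen_dot := repeat match goal with |- context [dot ?u ?v] => move: (dot u v) => ? end.

(** * Rank-nullity for Hilbert modules *)

Section rank_nullity.
Variables (R : realType) (G : groupType).
Local Notation H := (ell2 R G).
Local Notation L := (groupvN R G).
Implicit Types (z : R[i]) (g : G).

Lemma hmod_preimage (I J : finType) (M : J -> I -> L) (W : set (J -> H)) :
  hmod W -> hmod [set u | W (mxop M u)].
Proof.
move=> [[W0 Wl Wc] Wr]; split; last by move=> g u /= Wu; rewrite mxop_rtrans; exact: Wr.
split=> [|z u v /= Wu Wv|u hu] /=; first by rewrite mxop0.
  by rewrite mxop_linear; exact: Wl.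
apply: Wc => e e0; have [C C0 hC] := mxop_bounded M.
have [w /= Ww uw] := hu (e / C) (divr_gt0 e0 C0).
exists (mxop M w) => //; rewrite -mxopB; apply: le_trans (hC _) _.
by rewrite mulrC -ler_pdivlMr.
Qed.

Section graph.
Variables (I J : finType) (W : set (I -> H)) (hW : hmod W).
Implicit Types (M : J -> I -> L).

Definition pair_vec (x : I -> H) (y : J -> H) : I + J -> H :=
  fun s => match s with inl i => x i | inr j => y j end.

Lemma dot_sum_index (x y : I + J -> H) :
  dot x y = dot (x \o inl) (y \o inl) + dot (x \o inr) (y \o inr).
Proof. by rewrite !pi_dotE big_sumType. Qed.

Definition inl_mx : I -> I + J -> L :=
  fun i s => match s with inl i' => (i == i')%:R | inr _ => 0 end.

Lemma inl_mxE x : mxop inl_mx x = x \o inl.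
Proof.
apply/funext => i; rewrite /mxop big_sumType /= [X in _ + X]big1 ?addr0//.
rewrite (bigD1 i)//= eqxx groupvN_1E big1 ?addr0// => k.
by rewrite eq_sym => /negPf ->.
Qed.

Definition graph_mx M : I + J -> I -> L :=
  fun s i => match s with inl i' => (i' == i)%:R | inr j => M j i end.

Lemma graph_mxE M w : mxop (graph_mx M) w = pair_vec w (mxop M w).
Proof.
apply/funext => -[i|j]//; rewrite /mxop /= (bigD1 i)//= eqxx groupvN_1E.
by rewrite big1 ?addr0// => k; rewrite eq_sym => /negPf ->.
Qed.

Definition cograph_mx M : J -> I + J -> L :=
  fun j s => match s with inl i => - M j i | inr j' => (j == j')%:R end.

Lemma cograph_mxE M x : mxop (cograph_mx M) x = x \o inr - mxop M (x \o inl).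
Proof.
apply/funext => j; rewrite /mxop big_sumType /= addrC; congr (_ + _).
  rewrite (bigD1 j)//= eqxx groupvN_1E big1 ?addr0// => k.
  by rewrite eq_sym => /negPf ->.
transitivity (- mxop M (x \o inl) j) => //; rewrite /mxop -sumrN.
by apply: eq_bigr => i _.
Qed.

(** Graphs replace polar decomposition in the proof of rank-nullity. The graph of n M over W has the
    dimension of W for every n, and as n grows it tilts towards the direct sum of the kernel of M in
    W and the closure of M(W). *)
Definition graph M : set (I + J -> H) :=
  [set x | W (mxop inl_mx x)] `&` mxker (cograph_mx M).

Lemma hmod_graph M : hmod (graph M).
Proof. by apply: hmod_setI; [exact: hmod_preimage | exact: hmod_ker]. Qed.

Lemma graphP M x : graph M x <-> W (x \o inl) /\ x \o inr = mxop M (x \o inl).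
Proof.
rewrite /graph /mxker /= inl_mxE cograph_mxE; split=> -[Wx h]; split=> //.
  by apply/eqP; rewrite -subr_eq0; apply/eqP.
by rewrite h subrr.
Qed.

Lemma graph_in M w : W w -> graph M (pair_vec w (mxop M w)).
Proof. by move=> Ww; apply/graphP. Qed.

(** The maps w to (w, M w) and (w, y) to w are mutually inverse between W and the graph; preceded by
    the projections, they are a factorization as in [hdim_similar]. *)
Lemma hdim_graph M : hdim (graph M) = hdim W.
Proof.
have [P hP] := proj_mxop hW; have hG := hmod_graph M.
have [Q hQ] := proj_mxop hG.
apply/esym; apply: (@hdim_similar _ _ _ _ _ _ (fun s i => \sum_k graph_mx M s k * P k i)
  (fun i s => \sum_k inl_mx i k * Q k s)) => // u.
  rewrite -!mxop_comp -hP -hQ graph_mxE (proj_id hG.1) ?inl_mxE//.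
  by apply: graph_in; apply: proj_in; exact: hW.1.
rewrite -!mxop_comp -hP -hQ inl_mxE graph_mxE.
have /graphP[h1 h2] := proj_in hG.1 u.
rewrite (proj_id hW.1 h1) -h2; by apply/funext => -[].
Qed.

End graph.

Section graph_limit.
Variables (I J : finType) (W : set (I -> H)) (hW : hmod W) (M : J -> I -> L).

Definition scaled n : J -> I -> L := fun j i => M j i *+ n.

Lemma mxop_scaled n u : mxop (scaled n) u = (n%:R : R)%:C *: mxop M u.
Proof.
apply/funext => j; rewrite fctE rmorph_nat scaler_nat /mxop -sumrMnl.
apply: eq_bigr => i _; rewrite /scaled; elim: n => [|n IH]; first by rewrite !mulr0n.
by rewrite !mulrS groupvN_addE IH.
Qed.

Lemma pair_vec_dist (x w : I -> H) (y v : J -> H) :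
  sqn (pair_vec x y - pair_vec w v) =
  sqn (x - w) + sqn (y - v).
Proof. by rewrite dot_sum_index; congr (dot _ _ + dot _ _). Qed.

Lemma dot_pair_vecl (x : I -> H) : dot (pair_vec x (0 : J -> H)) (pair_vec x 0) = sqn x.
Proof. by rewrite dot_sum_index [X in _ + X](dot0l (0 : J -> H)) addr0. Qed.

Lemma dot_pair_vecr (y : J -> H) : dot (pair_vec (0 : I -> H) y) (pair_vec 0 y) = sqn y.
Proof. by rewrite dot_sum_index [X in X + _](dot0l (0 : I -> H)) add0r. Qed.

Lemma pair_vec_eta (x : I + J -> H) : x = pair_vec (x \o inl) (x \o inr).
Proof. by apply/funext => -[]. Qed.

Local Notation Gr n := (graph W (scaled n.+1)).

Let cost (x w : I -> H) (n : nat) : R :=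
  sqn (x - w) + n.+1%:R ^+ 2 * sqn (mxop M w).

Let graph_dist x w n : sqn (pair_vec x 0 - pair_vec w (mxop (scaled n.+1) w)) = cost x w n.
Proof.
by rewrite pair_vec_dist sub0r dotNl dotNr opprK mxop_scaled dotZl dotZr mulrA.
Qed.

Let ker_sub := hmod_setI hW (hmod_ker M).

Lemma proj_ker_le_graph x n :
  sqn (proj (W `&` mxker M) x) <=
  sqn (proj (Gr n) (pair_vec x 0)).
Proof.
(* The pair (p, 0), for p in the kernel, lies on every graph, so (x, 0) is at least as close to the
   graph as x is to the kernel. *)
have hG := (hmod_graph hW (scaled n.+1)).1.
have := proj_pythagoras hG (pair_vec x 0).
have := proj_pythagoras ker_sub.1 x.
have [Wp kp] := proj_in ker_sub.1 x; rewrite /mxker /= in kp.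
have := proj_dist_le hG (pair_vec x 0) (graph_in (scaled n.+1) Wp).
rewrite graph_dist /cost kp dot0l mulr0 addr0.
rewrite (dot_pair_vecl x).
by gen_dot => *; lra.
Qed.

(** A penalty argument. The nearest point of the n-th graph to (x, 0) has a first component [w n]
    minimizing |x - w|^2 + (n+1)^2 |M w|^2. The minima increase and stay below |x|^2, so the
    minimizers converge and the penalty forces their limit into the kernel. *)
Lemma graph_proj_ker x (e : R) : 0 < e -> exists n0 : nat, forall n, (n0 <= n)%N ->
  sqn (proj (Gr n) (pair_vec x 0)) <=
  sqn (proj (W `&` mxker M) x) + e.
Proof.
move=> e0; pose X := pair_vec x (0 : J -> H).
pose p n := proj (Gr n) X; pose w n := p n \o inl.
have hG n : hsub (Gr n) := (hmod_graph hW (scaled n.+1)).1.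
have pG n : Gr n (p n) by exact: proj_in.
have Ww n : W (w n) by have /graphP[] := pG n.
have pE n : p n = pair_vec (w n) (mxop (scaled n.+1) (w n)).
  by rewrite [LHS]pair_vec_eta; have /graphP[_ ->] := pG n.
pose d n := sqn (X - p n).
have dE n : d n = cost x (w n) n by rewrite /d pE graph_dist.
have XX : sqn X = sqn x.
  exact: dot_pair_vecl.
have pyth n : sqn x = sqn (p n) + d n by rewrite -XX; exact: proj_pythagoras.
have d_le n : d n <= sqn x by rewrite (pyth n) lerDr dot_ge0.
(* The point q of the m-th graph above [w n] has cost at most [d n], since its penalty is smaller;
   Pythagoras at the projection [p m] turns the excess over [d m] into a distance. *)
have close m n : (m <= n)%N -> sqn (w n - w m) <= d n - d m.
  move=> mn; pose q := pair_vec (w n) (mxop (scaled m.+1) (w n)).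
  have qG : Gr m q by exact: graph_in.
  have h1 : sqn (X - q) <= d n.
    rewrite dE graph_dist /cost lerD2l ler_wpM2r ?dot_ge0//.
    by rewrite ler_sqr ?nnegrE ?ler0n// ler_nat.
  have h2 : sqn (X - q) = d m + sqn (p m - q).
    have -> : X - q = (X - p m) + (p m - q) by rewrite addrA subrK.
    have h : dot (X - p m) (p m - q) = 0.
      by apply: proj_orth => //; exact: hsubB (hG m) (pG m) qG.
    by rewrite (dotDD (X - p m)) h mulr0 addr0.
  have h3 : sqn (w n - w m) <= sqn (p m - q).
    rewrite [in leRHS](pE m) /q pair_vec_dist -[w n - w m]opprB dotNl dotNr opprK lerDl.
    exact: dot_ge0.
  by move: h1 h2 h3; gen_dot; move: (d m) (d n) => *; lra.
have d_mono m n : (m <= n)%N -> d m <= d n.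
  by move=> /close h; rewrite -subr_ge0; apply: le_trans h; exact: dot_ge0.
have supE : has_sup (range d).
  by split; [exists (d 0%N), 0%N | exists (sqn x) => _ [n _ <-]].
have le_sup n : d n <= sup (range d) by apply: ub_le_sup; [case: supE | exists n].
have [|l wl] := @nrm_complete R (I -> H) w.
  move=> f f0; have [_ [n0 _ <-] hn] := sup_adherent (exprn_gt0 2 f0) supE; exists n0.
  suff h m n : (n0 <= m)%N -> (m <= n)%N -> nrm (w n - w m) <= f.
    move=> m n mn nn; have [h1|/ltnW h1] := leqP m n; last exact: h.
    by rewrite nrmBC; exact: h.
  move=> nm mn; apply: le_of_sqr (ltW f0) _; rewrite nrm_sqr.
  apply: le_trans (close _ _ mn) _.
  have := le_sup n; have := d_mono _ _ nm; move: (d n) (d m) (d n0) (sup _) (f ^+ 2) hn.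
  by move=> *; lra.
have Wl : W l.
  by have [[_ _ Wc] _] := hW; apply: Wc; apply: tends_hclosure wl; exists 0%N.
have [C C0 hC] := mxop_bounded M.
have Ml : mxop M l = 0.
  apply/nrm_eq0/eqP; rewrite eq_le nrm_ge0 andbT; apply/ler_addgt0Pl => f f0; rewrite addr0.
  have [n1 hn1] := wl (f / 2 / C) ltac:(by rewrite !divr_gt0).
  pose n := maxn n1 (Num.truncn (nrm x / (f / 2))).
  have h1 : nrm (mxop M (l - w n)) <= f / 2.
    apply: le_trans (hC _) _; rewrite mulrC -ler_pdivlMr// nrmBC.
    by apply: hn1; rewrite leq_maxl.
  have h2 : nrm (mxop M (w n)) <= f / 2.
    have np : 0 < n.+1%:R :> R by rewrite ltr0n.
    have : n.+1%:R * nrm (mxop M (w n)) <= nrm x.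
      apply: le_of_sqr; rewrite ?nrm_ge0// exprMn !nrm_sqr.
      by apply: le_trans (d_le n); rewrite dE /cost lerDr dot_ge0.
    have f2 : 0 < f / 2 by lra.
    have : nrm x <= n.+1%:R * (f / 2).
      rewrite -ler_pdivrMr//; apply: le_trans (ltW (truncnS_gt _)) _.
      by rewrite ler_nat ltnS leq_maxr.
    move=> a b; have := le_trans b a; by rewrite ler_pM2l.
  have := nrmD_le (mxop M (l - w n)) (mxop M (w n)); rewrite -mxopD subrK.
  by move: (nrm _) (nrm _) (nrm _) h1 h2 => *; lra.
have s0 : 0 <= sup (range d) by apply: le_trans (le_sup 0%N); exact: dot_ge0.
have xl : sqn (x - l) <= sup (range d).
  rewrite -nrm_sqr -(sqr_sqrtr s0) ler_sqr ?nnegrE ?nrm_ge0 ?sqrtr_ge0//.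
  apply/ler_addgt0Pr => f f0; have [n1 hn1] := wl f f0.
  apply: le_trans (nrmB_le _ (w n1) _) _; apply: lerD; last exact: hn1.
  apply: ler_wsqrtr; apply: le_trans (le_sup n1); rewrite dE /cost lerDl.
  by rewrite mulr_ge0 ?sqr_ge0 ?dot_ge0.
have := proj_dist_le ker_sub.1 x (conj Wl Ml); have := proj_pythagoras ker_sub.1 x.
have [_ [n0 _ <-] hn] := sup_adherent e0 supE => h1 h2; exists n0 => n nn.
have := d_mono _ _ nn; have := pyth n; rewrite -/X -/(p n).
move: xl h1 h2 hn; gen_dot; move: (d n) (d n0) (sup _) => *; lra.
Qed.

Lemma graph_proj_image_le y n :
  sqn (proj (Gr n) (pair_vec 0 y)) <=
  sqn (proj (hclosure [set mxop M w | w in W]) y).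
Proof.
have hG := (hmod_graph hW (scaled n.+1)).1; have hI := (hmod_image M hW).1.
have := proj_pythagoras hG (pair_vec 0 y); have := proj_pythagoras hI y.
rewrite (dot_pair_vecr y).
set p := proj (Gr n) _; have /graphP[Wp pE] : Gr n p by exact: (proj_in hG).
have cp : hclosure [set mxop M w | w in W] (p \o inr).
  rewrite pE mxop_scaled; apply: (hsubZ _ hI); apply: sub_hclosure.
  by exists (p \o inl).
have := proj_dist_le hI y cp.
have : sqn (y - (p \o inr)) <= sqn (pair_vec (0 : I -> H) y - p).
  by rewrite [in leRHS](pair_vec_eta p) pair_vec_dist lerDr dot_ge0.
by gen_dot => *; lra.
Qed.

Lemma graph_proj_image y (e : R) : 0 < e -> exists n0 : nat, forall n, (n0 <= n)%N ->
  sqn (proj (hclosure [set mxop M w | w in W]) y) <=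
  sqn (proj (Gr n) (pair_vec 0 y)) + e.
Proof.
move=> e0; have hI := (hmod_image M hW).1.
set Im := hclosure _ in hI *.
have [f f0 hf] : exists2 f : R, 0 < f & forall a : R, 0 <= a ->
    a <= nrm (y - proj Im y) + f -> a ^+ 2 <= nrm (y - proj Im y) ^+ 2 + e / 2.
  have c0 := nrm_ge0 (y - proj Im y); set c := nrm _ in c0 *.
  have b0 : 0 < 2 * c + 1 by lra.
  have dp : 0 < Num.min 1 (e / 2 / (2 * c + 1)) by rewrite lt_min ltr01 !divr_gt0.
  exists (Num.min 1 (e / 2 / (2 * c + 1))) => // a a0 ha.
  have : Num.min 1 (e / 2 / (2 * c + 1)) <= 1 by rewrite ge_min lexx.
  have : Num.min 1 (e / 2 / (2 * c + 1)) * (2 * c + 1) <= e / 2.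
    by rewrite -ler_pdivlMr// ge_min lexx orbT.
  by move: (Num.min _ _) dp ha => m *; nra.
have [_ [w Ww <-] hw] := (proj_in hI y : hclosure _ _) f f0.
have hw' : sqn (y - mxop M w) <= sqn (y - proj Im y) + e / 2.
  rewrite -!nrm_sqr; apply: hf; first exact: nrm_ge0.
  by apply: le_trans (nrmB_le _ (proj Im y) _) _; rewrite lerD2l.
exists (Num.truncn (nrm w ^+ 2 / (e / 2))) => n nn.
have np : 0 < n.+1%:R :> R by rewrite ltr0n.
have hG := (hmod_graph hW (scaled n.+1)).1.
(* The point (w / (n+1), M w) lies on the n-th graph, and its first component tends to 0: every
   vector of M(W) is a limit of points of the graphs. *)
pose w' := ((n.+1%:R : R)^-1)%:C *: w.
have Ww' : W w' by apply: hsubZ => //; case: hW.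
have Mw' : mxop (scaled n.+1) w' = mxop M w.
  by rewrite mxop_scaled mxopZ scalerA -rmorphM mulfV ?gt_eqF// rmorph1 scale1r.
have h2 : sqn w' <= e / 2.
  rewrite dotZl dotZr -nrm_sqr mulrA -expr2 exprVn ler_pdivrMl ?exprn_gt0//.
  have : nrm w ^+ 2 <= n.+1%:R * (e / 2).
    rewrite -ler_pdivrMr; last by lra.
    by apply: le_trans (ltW (truncnS_gt _)) _; rewrite ler_nat ltnS.
  move=> h; apply: (le_trans h); rewrite ler_wpM2r//; first by lra.
  by rewrite expr2 ler_peMr ?ler0n// ler1n.
have := proj_dist_le hG (pair_vec 0 y) (graph_in (scaled n.+1) Ww').
rewrite pair_vec_dist sub0r dotNl dotNr opprK Mw'.
have := proj_pythagoras hG (pair_vec 0 y); have := proj_pythagoras hI y.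
rewrite (dot_pair_vecr y).
move: hw' h2; rewrite -/Im.
by gen_dot => *; lra.
Qed.

(** For every n the trace of the projection onto the graph splits over the summands I and J. The
    first part bounds the dimension of the kernel from above, the second that of the image from
    below, and both bounds become sharp in the limit. *)
Theorem rank_nullity :
  hdim W = hdim (W `&` mxker M) + hdim (hclosure [set mxop M w | w in W]).
Proof.
set K := W `&` mxker M; set Im := hclosure _.
pose a n i := sqn (proj (Gr n) (pair_vec (basis R G i) 0)).
pose b n j := sqn (proj (Gr n) (pair_vec 0 (basis R G j))).
have eL i : basis R G (inl i) = pair_vec (basis R G i) (0 : J -> H).
  by apply/funext => -[k|k]; rewrite /basis /single /=.
have eR j : basis R G (inr j) = pair_vec (0 : I -> H) (basis R G j).
  by apply/funext => -[k|k]; rewrite /basis /single /=.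
have hL n i : sqn (proj (Gr n) (basis R G (inl i))) = a n i.
  by rewrite /a eL.
have hR n j : sqn (proj (Gr n) (basis R G (inr j))) = b n j.
  by rewrite /b eR.
have sL n : \sum_i sqn (proj (Gr n) (basis R G (inl i))) = \sum_i a n i.
  by apply: eq_bigr => i _; exact: hL.
have sR n : \sum_j sqn (proj (Gr n) (basis R G (inr j))) = \sum_j b n j.
  by apply: eq_bigr => i _; exact: hR.
have dE n : hdim W = \sum_i a n i + \sum_j b n j.
  by rewrite -sL -sR -(hdim_graph hW (scaled n.+1)); exact: big_sumType.
have aK n : hdim K <= \sum_i a n i by apply: ler_sum => i _; exact: proj_ker_le_graph.
have bI n : \sum_j b n j <= hdim Im by apply: ler_sum => j _; exact: graph_proj_image_le.
have sum_eps (T : finType) (e : R) : 0 < e -> \sum_(t : T) e / (#|T|.+1)%:R <= e.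
  move=> e0; rewrite sumr_const -[X in X <= _]mulr_natr mulrAC ler_pdivrMr ?ltr0n//.
  by rewrite ler_wpM2l ?ler_nat ?(ltW e0).
apply/eqP; rewrite eq_le; apply/andP; split.
  apply/ler_addgt0Pr => e e0.
  have /choice[n0 hn] : forall i, exists n0 : nat, forall n, (n0 <= n)%N ->
      a n i <= sqn (proj K (basis R G i)) + e / (#|I|.+1)%:R.
    by move=> i; apply: graph_proj_ker; rewrite divr_gt0 ?ltr0n.
  pose n := (\max_i n0 i)%N; rewrite (dE n) addrAC lerD//.
  apply: (@le_trans _ _ (hdim K + \sum_(i : I) e / (#|I|.+1)%:R)); last by rewrite lerD2l sum_eps.
  by rewrite /hdim -big_split; apply: ler_sum => i _; apply: hn; exact: leq_bigmax.
apply/ler_addgt0Pr => e e0.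
have /choice[n0 hn] : forall j, exists n0 : nat, forall n, (n0 <= n)%N ->
    sqn (proj Im (basis R G j)) <= b n j + e / (#|J|.+1)%:R.
  by move=> i; apply: graph_proj_image; rewrite divr_gt0 ?ltr0n.
pose n := (\max_i n0 i)%N; rewrite (dE n) -addrA lerD//.
apply: (@le_trans _ _ (\sum_j b n j + \sum_(j : J) e / (#|J|.+1)%:R)); last by rewrite lerD2l sum_eps.
by rewrite /hdim -big_split; apply: ler_sum => i _; apply: hn; exact: leq_bigmax.
Qed.

End graph_limit.

End rank_nullity.

Ltac gen_hdim := repeat match goal with |- context [hdim ?W] => move: (hdim W) => ? end.

(** * Density by dimension count *)

Section hmod_density.
Variables (R : realType) (G : groupType).
Local Notation H := (ell2 R G).
Local Notation L := (groupvN R G).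

(** The right side is contained in the left, and the dimensions agree: passing from the intersection
    to [W n] raises the dimension by at most e once n is large and does not shrink the kernel, so by
    rank-nullity the image grows by at most e. *)
Lemma image_bigcap (I J : finType) (W : nat -> set (I -> H)) (M : J -> I -> L) :
  (forall n, hmod (W n)) -> (forall m n, (m <= n)%N -> W n `<=` W m) ->
  \bigcap_n hclosure [set mxop M w | w in W n] `<=`
  hclosure [set mxop M w | w in \bigcap_n W n].
Proof.
move=> hW dec; pose A := \bigcap_n W n; have hA : hmod A := hmod_bigcap hW.
have hB n := hmod_image M (hW n); have hC := hmod_image M hA.
suff -> : hclosure [set mxop M w | w in A] = \bigcap_n hclosure [set mxop M w | w in W n].
  by [].
have hB' := hmod_bigcap hB; apply: (hdim_eq hC hB').
  move=> v hv n _; apply: hclosureS hv => _ [w Aw <-]; exists w => //; exact: Aw.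
apply/ler_addgt0Pr => e e0; have [n hn] := hdim_bigcap hW dec e0.
have hBn : hdim (\bigcap_n hclosure [set mxop M w | w in W n]) <=
    hdim (hclosure [set mxop M w | w in W n]).
  by apply: (hdim_le hB' (hB n)) => v; exact.
have hk : hdim (A `&` mxker M) <= hdim (W n `&` mxker M).
  apply: (hdim_le (hmod_setI hA (hmod_ker M)) (hmod_setI (hW n) (hmod_ker M))).
  by move=> v [Av kv]; split => //; exact: Av.
have := rank_nullity (hW n) M; have := rank_nullity hA M.
move: hBn hn hk; rewrite -/A.
gen_hdim => *; lra.
Qed.

Section stage.
Variables (I N E : finType) (h : N -> I -> L) (D : E -> I -> L) (A : N -> N -> L).
Hypothesis annihilate : forall (v : N -> L) (w : E -> L),
  (forall x, \sum_n v n * h n x + \sum_e w e * D e x = 0) ->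
  forall k, \sum_n v n * A n k = 0.

Let col : N + E -> I -> L := fun s => match s with inl n => h n | inr e => D e end.

Let colE u : mxop col u = pair_vec (mxop h u) (mxop D u).
Proof. by apply/funext => -[]. Qed.

Let rng : set (N + E -> H) := hclosure [set mxop col w | w in setT].

Let hrng : hmod rng := hmod_image col (hmod_setT R G I).

Let snd_mx : E -> N + E -> L :=
  fun e s => match s with inl _ => 0 | inr e' => (e == e')%:R end.

Let snd_mxE (x : N + E -> H) : mxop snd_mx x = x \o inr.
Proof.
apply/funext => e; rewrite /mxop big_sumType /= big1 ?add0r//.
rewrite (bigD1 e)//= eqxx groupvN_1E big1 ?addr0// => k.
by rewrite eq_sym => /negPf ->.
Qed.

(** A vector of the closed range with zero E-part is a priori only a limit of (h u, D u) with D u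
    tending to 0. That u may be taken in the kernel of D follows from rank-nullity for [col] on the
    whole space, for [col] on that kernel, for D and for [snd_mx]. *)
Let rng_ker : rng `&` mxker snd_mx = hclosure [set mxop col w | w in mxker D].
Proof.
have hK : hmod (rng `&` mxker snd_mx) := hmod_setI hrng (hmod_ker snd_mx).
have hI : hmod (hclosure [set mxop col w | w in mxker D]).
  by exact: hmod_image col (hmod_ker D).
apply/esym; apply: (hdim_eq hI hK).
  have [_ _ cK] := hK.1; apply: subset_trans cK; apply: hclosureS => _ [w kw <-].
  split; first by apply: sub_hclosure; exists w.
  by rewrite /mxker /= snd_mxE colE; exact: kw.
have kcol : mxker D `&` mxker col = [set: I -> H] `&` mxker col.
  apply/seteqP; split=> w [_ kw]; split=> //.
  by have := congr1 (fun y => y \o inr) kw; rewrite colE.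
have := rank_nullity (hmod_ker D) col; rewrite kcol.
have := rank_nullity (hmod_setT R G I) col; rewrite -/rng.
have := rank_nullity (hmod_setT R G I) D; rewrite setTI.
have := rank_nullity hrng snd_mx.
have : hdim (hclosure [set mxop D w | w in [set: I -> H]]) <=
    hdim (hclosure [set mxop snd_mx w | w in rng]).
  apply: (hdim_le (hmod_image D (hmod_setT R G I)) (hmod_image snd_mx hrng)).
  apply: hclosureS => _ [w _ <-]; exists (mxop col w); last by rewrite snd_mxE colE.
  by apply: sub_hclosure; exists w.
gen_hdim => *; lra.
Qed.

(** The hypothesis concerns algebraic relations between the rows of h and D, the conclusion the
    Hilbert space. The link is that the projection onto the closed range of (h, D) has entries in
    L(G), so the rows of its complement are such relations; they place (A eta, 0) in the range. *)
Lemma stage_density (eta : N -> H) :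
  hclosure [set mxop h w | w in mxker D] (mxop A eta).
Proof.
pose X : N + E -> H := pair_vec (mxop A eta) 0.
suff XR : (rng `&` mxker snd_mx) X.
  move: XR; rewrite rng_ker => hX e e0; have [_ [w kw <-] Xw] := hX e e0.
  exists (mxop h w); first by exists w.
  apply: le_trans Xw; apply: ler_wsqrtr; rewrite colE pair_vec_dist lerDl.
  exact: dot_ge0.
split; last by rewrite /mxker /= snd_mxE.
have [P hP] := proj_mxop hrng.
(* The row [inl i] of 1 - P kills [col], so [annihilate] applies to it. *)
have row0 i k : \sum_n ((i == n)%:R - P (inl i) (inl n)) * A n k = 0.
  apply: (annihilate (w := fun e => - P (inl i) (inr e))) => x.
  have := congr1 (fun M : N + E -> I -> L => M (inl i) x)
    (mxop_inj (M := fun s y => \sum_t P s t * col t y) (M' := col) _).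
  move=> /(_ _) PC; have {}PC : \sum_t P (inl i) t * col t x = col (inl i) x.
    apply: PC => u; rewrite -mxop_comp -hP; apply: proj_id; first exact: hrng.1.
    by apply: sub_hclosure; exists u.
  move: PC; rewrite big_sumType /= => PC.
  under eq_bigr do rewrite mulrBl; under [X in _ + X]eq_bigr do rewrite mulNr.
  rewrite sumrB sumrN -addrA -opprD PC (bigD1 i)//= eqxx mul1r big1 ?addr0 ?subrr//.
  by move=> k'; rewrite eq_sym => /negPf ->; rewrite mul0r.
have inl0 i : (X - proj rng X) (inl i) = 0.
  pose Q n k : L := (n == k)%:R - P (inl n) (inl k).
  have QA : mxop Q (mxop A eta) i = 0.
    by rewrite mxop_comp /mxop big1// => k _; rewrite row0.
  rewrite hP -QA /mxop -[LHS]/(\sum_k A i k (eta k) - \sum_s P (inl i) s (X s)).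
  rewrite big_sumType /= [X in _ - (_ + X)]big1 ?addr0; last by move=> e _; rewrite linear0.
  have QE k x : Q i k x = ((i == k)%:R : L) x - P (inl i) (inl k) x by [].
  rewrite [RHS](eq_bigr _ (fun k _ => QE k _)) big_split /= sumrN; congr (_ - _).
  rewrite [RHS](bigD1 i)//= eqxx groupvN_1E [X in _ + X]big1 ?addr0// => k.
  by rewrite eq_sym => /negPf ->.
(* The residual is orthogonal to [proj rng X], so its squared norm is its pairing with X. This
   vanishes: the residual is 0 on N, and X is 0 on E. *)
have : X - proj rng X = 0.
  apply/dot_eq0; have := proj_orth hrng.1 X (proj_in hrng.1 X) => o.
  rewrite dotBr o subr0 dot_sum_index [Y in Y + _](_ : _ = 0) ?add0r; last first.
    by rewrite pi_dotE big1// => i _; rewrite [(_ \o _) i]inl0 dot0l.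
  exact: dot0r.
by move=> /eqP; rewrite subr_eq0 => /eqP ->; exact: proj_in hrng.1 X.
Qed.

End stage.

End hmod_density.

(** * Cocycles from the first l^2-Betti number *)

Section cocycles.
Variables (R : realType) (G : groupType).
Local Notation H := (ell2 R G).
Local Notation L := (groupvN R G).
Implicit Types (F : {fset G}) (b : G -> H).

Definition cocycle b := forall g k, b (g * k)%g = b g + lreg R g (b k).

Lemma exhaustion : countable [set: G] -> exists F : nat -> {fset G},
  (forall m n, (m <= n)%N -> (F m `<=` F n)%fset) /\ forall g, exists n, g \in F n.
Proof.
move=> /countable_injP[f finj].
have fin n : finite_set [set g | (f g < n)%N].
  apply: (@finite_preimage _ _ [set k | (k < n)%N]); last exact: finite_II.
  by move=> x y _ _; apply: finj; rewrite in_setT.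
exists (fun n => fset_set [set g | (f g < n)%N]); split=> [m n mn|g].
  by apply/fsubsetP => g; rewrite !in_fset_set// !inE /= => /leq_trans; apply.
by exists (f g).+1; rewrite in_fset_set// inE /=.
Qed.

Definition restr F b : F -> H := fun x => b (val x).
Definition ext F (u : F -> H) : G -> H := fun g => if insub g is Some x then u x else 0.

Lemma restr_ext F (u : F -> H) : restr (ext u) = u.
Proof. by apply/funext => x; rewrite /restr /ext valK. Qed.

Definition partial_cocycle F b := forall g k, g \in F -> k \in F -> (g * k)%g \in F ->
  lreg R g (b k) - b (g * k)%g + b g = 0.

(* The part of the dual of bar_d2 that only involves elements of F. *)
Definition cobd_mx F : F * F -> F -> L := fun gk x =>
  if (val gk.1 * val gk.2)%g \in F then
    (if x == gk.2 then lvN R (val gk.1) else 0)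
    - (val x == val gk.1 * val gk.2)%g%:R + (x == gk.1)%:R
  else 0.

Lemma mxop_cobd F b gk : mxop (cobd_mx (F := F)) (restr b) gk =
  if (val gk.1 * val gk.2)%g \in F then
    lreg R (val gk.1) (b (val gk.2)) - b (val gk.1 * val gk.2)%g + b (val gk.1) else 0.
Proof.
case: gk => g k /=; rewrite /mxop /cobd_mx /=; case: ifP => gkF; last by rewrite big1.
pose y := FSetSub gkF.
have E x : ((if x == k then lvN R (val g) else 0) - (val x == val g * val k)%g%:R +
     (x == g)%:R : L) (restr b x) =
    (if x == k then lvN R (val g) else 0 : L) (restr b x) - ((x == y)%:R : L) (restr b x) +
    ((x == g)%:R : L) (restr b x) by [].
rewrite (eq_bigr _ (fun x _ => E x)) big_split /= big_split /= sumrN.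
congr (_ - _ + _).
- rewrite (bigD1 k)//= eqxx big1 ?addr0// => x /negPf ->; exact: groupvN_0E.
- rewrite (bigD1 y)//= eqxx groupvN_1E big1 ?addr0// => x /negPf ->; exact: groupvN_0E.
- rewrite (bigD1 g)//= eqxx groupvN_1E big1 ?addr0// => x /negPf ->; exact: groupvN_0E.
Qed.

Lemma cobd_kerP F b : mxker (cobd_mx (F := F)) (restr b) <-> partial_cocycle F b.
Proof.
split=> [h g k gF kF gkF|h].
  have := congr1 (fun u => u (FSetSub gF, FSetSub kF)) h.
  by rewrite mxop_cobd /= gkF.
apply/funext => -[g k]; rewrite mxop_cobd /=; case: ifP => // gkF.
by apply: h => //; exact: valP.
Qed.

Lemma partial_cocycleS F F' b : (F `<=` F')%fset -> partial_cocycle F' b -> partial_cocycle F b.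
Proof. by move=> /fsubsetP s h g k gF kF gkF; apply: h; exact: s. Qed.

(** [cobd_mx] is the transpose of [bar_d2] on chains supported in F. The chain e bounding c is -w,
    cut down to the pairs whose product stays in F, because the other rows of [cobd_mx] are zero. *)
Lemma cobd_boundary F (w : F * F -> L) (c : G -> L) : (forall x, x \notin F -> c x = 0) ->
  (forall x : F, c (val x) + \sum_gk w gk * cobd_mx gk x = 0) -> boundaries1 (c : G -> L^o).
Proof.
move=> c0 hc.
pose e (p : G * G) : L := if (p.1 * p.2)%g \in F then
  (if (insub p.1, insub p.2) is (Some g, Some k) then - w (g, k) else 0) else 0.
have eF p : e p <> 0 -> [/\ p.1 \in F, p.2 \in F & (p.1 * p.2)%g \in F].
  rewrite /e; case: ifP => // pF.
  by case: insubP => [u uF _|//]; case: insubP => [v vF _|//].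
have e0 p : ~~ [&& p.1 \in F, p.2 \in F & (p.1 * p.2)%g \in F] -> e p = 0.
  by move=> h; apply/eqP; apply: contraNT h => /eqP/eF[-> -> ->].
have eE (g k : F) : e (val g, val k) = if (val g * val k)%g \in F then - w (g, k) else 0.
  by rewrite /e /= !valK.
exists e; split.
  apply: (@sub_finite_set _ _ [set` (F `*` F)%fset]); last exact: finite_fset.
  by move=> [g k] /= /eF[gF kF _]; rewrite /= in_fsetM /= gF kF.
apply/funext => x; rewrite /bar_d2 (fsbigTE F); last first.
  move=> g gF; rewrite !e0 ?mul0r ?subr0 ?addr0//=; rewrite ?(negPf gF) ?andbF//.
have [xF|xF] := boolP (x \in F); last first.
  rewrite c0// big1// => g _; rewrite !e0 ?mul0r ?subr0 ?addr0//= ?(negPf xF) ?andbF//.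
  by rewrite mulVKg (negPf xF) !andbF.
pose y := FSetSub xF; have -> : c x = - \sum_gk w gk * cobd_mx gk y.
  by apply/eqP; rewrite -addr_eq0; apply/eqP; exact: (hc y).
rewrite big_seq_fsetE /= -sumrN.
rewrite (eq_bigr (fun gk => e (val gk.1, val gk.2) *
   ((if y == gk.2 then lvN R (val gk.1) else 0)
    - (x == val gk.1 * val gk.2)%g%:R + (y == gk.1)%:R))); last first.
  by move=> [g k] _; rewrite eE /cobd_mx /=; case: ifP => _; rewrite ?mulr0 ?mul0r ?oppr0// mulNr.
have E gk : e (val gk.1, val gk.2) * ((if y == gk.2 then lvN R (val gk.1) else 0)
    - (x == val gk.1 * val gk.2)%g%:R + (y == gk.1)%:R) =
   (if y == gk.2 then e (val gk.1, val gk.2) * lvN R (val gk.1) else 0)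
   - e (val gk.1, val gk.2) * (x == val gk.1 * val gk.2)%g%:R +
   e (val gk.1, val gk.2) * (y == gk.1)%:R.
  by rewrite mulrDr mulrBr; case: ifP => _; rewrite ?mulr0.
rewrite (eq_bigr _ (fun gk _ => E gk)) !big_split /= !sumrN.
congr (_ - _ + _).
- rewrite -(pair_bigA _ (fun g k : F => if y == k then e (val g, val k) * lvN R (val g) else 0)) /=.
  apply: eq_bigr => g _; rewrite (bigD1 y)//= eqxx big1 ?addr0// => k.
  by rewrite eq_sym => /negPf ->.
- rewrite -(pair_bigA _ (fun g k : F => e (val g, val k) * (x == val g * val k)%g%:R)) /=.
  apply: eq_bigr => g _; have [gxF|gxF] := boolP ((val g)^-1 * x \in F)%g.
    rewrite (bigD1 (FSetSub gxF))//= mulVKg eqxx mulr1 big1 ?addr0// => k kg.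
    case: eqP => [xE|_]; last by rewrite mulr0.
    by case/eqP: kg; apply: val_inj; rewrite /= xE mulKg.
  rewrite e0 ?big1//=; last by rewrite (negPf gxF) andbF.
  move=> k _; case: eqP => [xE|_]; last by rewrite mulr0.
  by rewrite xE mulKg (valP k) in gxF.
- rewrite -(pair_bigA _ (fun g k : F => e (val g, val k) * (y == g)%:R)) /=.
  rewrite [LHS](bigD1 y)//= [X in _ + X]big1 ?addr0; last first.
    by move=> g; rewrite eq_sym => /negPf ->; rewrite big1// => k _; rewrite mulr0.
  by apply: eq_bigr => k _; rewrite eqxx mulr1.
Qed.

End cocycles.

(** * Mittag-Leffler construction of a cocycle *)

Section mittag_leffler.
Variables (R : realType) (G : groupType) (N : finType).
Local Notation H := (ell2 R G).
Local Notation L := (groupvN R G).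
Variables (F : nat -> {fset G}) (h : N -> G -> L) (A : N -> N -> L).
Hypothesis Fmono : forall m n, (m <= n)%N -> (F m `<=` F n)%fset.
Hypothesis Fexh : forall g, exists n, g \in F n.
Hypothesis h_supp : forall n g, g \notin F 0%N -> h n g = 0.
Hypothesis h_free : forall v : N -> L,
  boundaries1 ((fun g => \sum_n v n * h n g) : G -> L^o) -> forall k, \sum_n v n * A n k = 0.

Let hmx m : N -> F m -> L := fun n x => h n (val x).

Let hmxE m b n : mxop (@hmx m) (restr b) n = \sum_(g <- F 0%N) h n g (b g).
Proof.
rewrite /mxop /hmx /restr -(@big_seq_fsetE _ _ _ _ (F m) predT (fun g => h n g (b g))) /=.
apply/esym; apply: big_fset_incl; first exact: Fmono.
by move=> g _ /h_supp ->; exact: groupvN_0E.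
Qed.

Let pc n : set (G -> H) := [set b | partial_cocycle (F n) b].
Let W n m : set (F m -> H) := hclosure [set @restr R G (F m) b | b in pc n].
Arguments W : clear implicits.

Let commute_lr g k (u : H) : lreg R g (rreg R k u) = rreg R k (lreg R g u).
Proof. by apply: ell2P => s; rewrite lregE !rregE lregE mulgA. Qed.

Let hmod_W n m : hmod (W n m).
Proof.
apply: hmod_closure.
- exists 0 => // g k _ _ _.
  by rewrite linear0 subr0 addr0.
- move=> z _ _ [b hb <-] [b' hb' <-]; exists (z *: b + b') => // g k gF kF gkF.
  have := congr2 (fun x y => z *: x + y) (hb g k gF kF gkF) (hb' g k gF kF gkF).
  rewrite scaler0 addr0 => <-; rewrite !fctE linearP.
  by apply: ell2P => x; rewrite !ell2E; ring.
- move=> k _ [b hb <-]; exists (fun g => rreg R k (b g)) => // g g' gF gF' ggF.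
  by rewrite commute_lr -linearB -linearD hb// linear0.
Qed.

Let W_dec m n n' : (n <= n')%N -> W n' m `<=` W n m.
Proof.
move=> nn; apply: hclosureS => _ [b hb <-]; exists b => //.
exact: partial_cocycleS (Fmono nn) hb.
Qed.

(** The stable part, up to closure, of the inverse system of partial cocycles: its elements are
    approximated on [F m] by partial cocycles of every stage. *)
Let V m : set (F m -> H) := \bigcap_n W n m.
Arguments V : clear implicits.

Let res m : F m -> F m.+1 -> L := fun x y => (val x == val y)%:R.

Let resE m b : mxop (@res m) (restr b) = restr b.
Proof.
apply/funext => x; rewrite /mxop /res.
have xF : val x \in F m.+1 by apply: (fsubsetP (Fmono (leqnSn m))); exact: valP.
rewrite (bigD1 (FSetSub xF))//= eqxx groupvN_1E big1 ?addr0// => y yx.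
by rewrite (_ : (_ == _) = false) ?groupvN_0E//; apply: contra_neqF yx => /eqP xy; exact: val_inj.
Qed.

(** Each [W n m] is approximated by restrictions from [W n m.+1], for the same n; [image_bigcap]
    allows passing to the intersection over n. *)
Let V_res m : V m `<=` hclosure [set mxop (@res m) u | u in V m.+1].
Proof.
apply: subset_trans (image_bigcap (fun n => hmod_W n m.+1) (fun n n' => @W_dec m.+1 n n')).
move=> u hu n _; apply: hclosureS (hu n I) => _ [b hb <-].
exists (restr b); last exact: resE.
by apply: sub_hclosure; exists b.
Qed.

(** By [image_bigcap] it is enough to work at one stage n, where [stage_density] applies: a relation
    between the h and the rows of [cobd_mx] exhibits a combination of the h as a boundary, so
    [h_free] kills it. *)
Let A_dense m eta : hclosure [set mxop (@hmx m) u | u in V m] (mxop A eta).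
Proof.
apply: (image_bigcap (fun n => hmod_W n m) (fun n n' => @W_dec m n n')) => n _.
pose p := maxn n m.
have np : (n <= p)%N := leq_maxl _ _.
have mp : (m <= p)%N := leq_maxr _ _.
have ann (v : N -> L) (w : F p * F p -> L) :
    (forall x, \sum_n v n * @hmx p n x + \sum_gk w gk * @cobd_mx R G (F p) gk x = 0) ->
    forall k, \sum_n v n * A n k = 0.
  move=> hvw; apply: h_free; apply: (cobd_boundary (F := F p) (w := w)) => // x xF.
  rewrite big1// => k _; rewrite h_supp ?mulr0//.
  by apply: contra xF; apply: fsubsetP; exact: Fmono.
apply: hclosureS (stage_density ann eta) => _ [u hu <-].
have hb : partial_cocycle (F p) (ext u) by apply/cobd_kerP; rewrite restr_ext.
exists (restr (ext u)).
  apply: sub_hclosure; exists (ext u) => //; exact: partial_cocycleS (Fmono np) hb.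
by apply/funext => k; rewrite -[u in RHS]restr_ext !hmxE.
Qed.

Let V_cocycle m b : V m (restr b) -> partial_cocycle (F m) b.
Proof.
move=> /(_ m I) hb; apply/cobd_kerP; have [[_ _ Kc] _] := hmod_ker (@cobd_mx R G (F m)).
by apply: Kc; apply: hclosureS hb => _ [b' hb' <-]; exact/cobd_kerP.
Qed.

Let V_step m b (e : R) : V m (restr b) -> 0 < e -> exists b', V m.+1 (restr b') /\
  nrm (restr b' - restr b : F m -> H) <= e.
Proof.
move=> hb e0; have [_ [u hu <-] bu] := V_res hb e0; exists (ext u).
by rewrite restr_ext; split => //; rewrite -(resE m (ext u)) restr_ext nrmBC.
Qed.

(** An element of [V 0] with nonzero pairing is lifted from stage to stage with summable errors.
    Every coordinate converges, and the limit inherits each cocycle relation from all late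
    stages. *)
Lemma cocycle_exists (eta : N -> H) : mxop A eta <> 0 ->
  exists b, cocycle b /\ exists n, \sum_(g <- F 0%N) h n g (b g) <> 0.
Proof.
move=> Aeta.
have [b0 [Vb0 hb0]] : exists b0 : G -> H,
    V 0%N (restr b0) /\ mxop (@hmx 0%N) (restr b0) <> 0.
  apply: contrapT => none; apply: Aeta; apply/nrm_eq0/eqP.
  rewrite eq_le nrm_ge0 andbT; apply/ler_addgt0Pl => e e0; rewrite addr0.
  have [_ [u hu <-] ue] := A_dense 0 eta e0; move: ue.
  suff -> : mxop (@hmx 0%N) u = 0 by rewrite subr0.
  apply: contrapT => hu0; apply: none; exists (ext u).
  by rewrite restr_ext.
have [C C0 hC] := mxop_bounded (@hmx 0%N).
have np : 0 < nrm (mxop (@hmx 0%N) (restr b0)).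
  by rewrite lt_neqAle nrm_ge0 andbT eq_sym; apply/eqP => /nrm_eq0.
pose k : R := (#|{: F 0%N}|.+1)%:R.
have k0 : 0 < k by rewrite ltr0n.
(* All corrections together move each coordinate in [F 0] by at most delta, hence the pairing by at
   most C k delta, half of its initial norm. *)
pose delta := nrm (mxop (@hmx 0%N) (restr b0)) / (2 * C * k).
have d0 : 0 < delta by rewrite divr_gt0 ?mulr_gt0.
have e0 m : 0 < delta / 2 ^+ m.+1 by rewrite divr_gt0 ?exprn_gt0.
have /choice[f hf] : forall mb : nat * (G -> H), exists b', V mb.1 (restr mb.2) ->
    V mb.1.+1 (restr b') /\
    nrm (restr b' - restr mb.2 : F mb.1 -> H) <= delta / 2 ^+ mb.1.+1.
  move=> [m b] /=; have [hb|hb] := pselect (V m (restr b)); last by exists 0.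
  by have [b' ?] := V_step hb (e0 m); exists b'.
pose bs := fix bs m := if m is m'.+1 then f (m', bs m') else b0.
have Vbs m : V m (restr (bs m)).
  by elim: m => // m IH; have [] := hf (m, bs m) IH.
have step m g : g \in F m -> nrm (bs m.+1 g - bs m g) <= delta / 2 ^+ m.+1.
  move=> gF; have [_] := hf (m, bs m) (Vbs m); apply: le_trans.
  exact: (nrm_le_pi (restr (bs m.+1) - restr (bs m) : F m -> H) (FSetSub gF)).
have tele m p g : g \in F m ->
    nrm (bs (m + p)%N g - bs m g) <= delta / 2 ^+ m - delta / 2 ^+ (m + p).
  move=> gF; elim: p => [|p IH]; first by rewrite addn0 !subrr nrm0.
  rewrite addnS; apply: le_trans (nrmB_le _ (bs (m + p)%N g) _) _.
  have gF' : g \in F (m + p)%N by apply: (fsubsetP (Fmono (leq_addr p m))).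
  have := step _ _ gF'; rewrite exprS invfM.
  by move: (2 ^+ (m + p))^-1 (2 ^+ m)^-1 IH => x y; move: (nrm _) (nrm _) => *; lra.
have tele' m p g : g \in F m -> nrm (bs (m + p)%N g - bs m g) <= delta / 2 ^+ m.
  move=> /(tele m p) hp; apply: le_trans hp _; rewrite lerBlDr lerDl.
  by rewrite divr_ge0 ?exprn_ge0 ?ltW.
have small (e : R) : 0 < e -> exists m0 : nat, forall m, (m0 <= m)%N -> delta / 2 ^+ m <= e.
  move=> ep; exists (Num.truncn (delta / e)).+1 => m mm.
  rewrite ler_pdivrMr ?exprn_gt0// mulrC -ler_pdivrMr//.
  apply: le_trans (ltW (truncnS_gt _)) _; apply: (@le_trans _ _ m%:R); first by rewrite ler_nat.
  by rewrite -natrX ler_nat ltnW// ltn_expl.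
have /choice[b hb] : forall g, exists l, tends (fun m => bs m g) l.
  move=> g; apply: nrm_complete => e ep; have [n0 gF] := Fexh g.
  have [m0 hm] := small (e / 2) ltac:(lra); exists (maxn n0 m0).
  have gF' : g \in F (maxn n0 m0) by apply: (fsubsetP (Fmono (leq_maxl _ _))).
  move=> m n mm nn; apply: le_trans (nrmB_le _ (bs (maxn n0 m0) g) _) _.
  have := tele' _ (m - maxn n0 m0)%N _ gF'; have := tele' _ (n - maxn n0 m0)%N _ gF'.
  rewrite !subnKC// (nrmBC (bs (maxn _ _) g)); have := hm _ (leq_maxr n0 m0).
  by move: (delta / _) (nrm _) (nrm _) => *; lra.
have b_cocycle : cocycle b.
  move=> g k'; apply/eqP; rewrite eq_sym -subr_eq0; apply/eqP/nrm_eq0/eqP.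
  rewrite eq_le nrm_ge0 andbT; apply/ler_addgt0Pl => e ep; rewrite addr0.
  have [n1 g1] := Fexh g; have [n2 g2] := Fexh k'; have [n3 g3] := Fexh (g * k')%g.
  have [m1 h1] := hb g (e / 3) ltac:(lra); have [m2 h2] := hb k' (e / 3) ltac:(lra).
  have [m3 h3] := hb (g * k')%g (e / 3) ltac:(lra).
  pose m := maxn (maxn (maxn n1 n2) n3) (maxn (maxn m1 m2) m3).
  have [i1 i2 i3 [j1 j2 j3]] : [/\ (n1 <= m)%N, (n2 <= m)%N, (n3 <= m)%N &
    [/\ (m1 <= m)%N, (m2 <= m)%N & (m3 <= m)%N]] by split; [| | |split]; rewrite /m !leq_max leqnn ?orbT.
  have F1 : g \in F m by apply: (fsubsetP (Fmono i1)).
  have F2 : k' \in F m by apply: (fsubsetP (Fmono i2)).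
  have F3 : (g * k')%g \in F m by apply: (fsubsetP (Fmono i3)).
  have rel := V_cocycle (Vbs m) F1 F2 F3.
  have -> : b g + lreg R g (b k') - b (g * k')%g =
      (b g - bs m g) + (lreg R g (b k' - bs m k') + (bs m (g * k')%g - b (g * k')%g)).
    rewrite linearB; have {}rel : bs m (g * k')%g = lreg R g (bs m k') + bs m g.
      by apply/eqP; rewrite eq_sym -subr_eq0 addrAC rel.
    by rewrite rel; apply: ell2P => x; rewrite !ell2E; ring.
  apply: le_trans (nrmD_le _ _) _; have := nrmD_le (lreg R g (b k' - bs m k')) (bs m (g * k')%g - b (g * k')%g).
  rewrite nrm_lreg; have := h1 m j1; have := h2 m j2; have := h3 m j3.
  rewrite (nrmBC (bs m g)) (nrmBC (bs m k')).
  by move: (nrm _) (nrm _) (nrm _) (nrm _) => *; lra.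
exists b; split=> //; apply: contrapT => none.
have hb1 : mxop (@hmx 0%N) (restr b) = 0.
  by apply/funext => n; rewrite hmxE; apply: contrapT => hn; apply: none; exists n.
have near g : g \in F 0%N -> nrm (b0 g - b g) <= delta.
  move=> gF; apply/ler_addgt0Pr => e ep; have [m hm] := hb g e ep.
  apply: le_trans (nrmB_le _ (bs m g) _) _; apply: lerD; last exact: hm.
  by have := tele' _ m _ gF; rewrite add0n expr0 divr1 nrmBC.
have := hC (restr b0 - restr b); rewrite mxopB hb1 subr0.
have : nrm (restr b0 - restr b : F 0%N -> H) <= k * delta.
  apply: le_trans (nrm_pi_le _) _.
  apply: (@le_trans _ _ (\sum_(i : F 0%N) delta)).
    by apply: ler_sum => i _; exact: near (valP i).
  by rewrite sumr_const -mulr_natl ler_wpM2r ?(ltW d0)// ler_nat.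
move=> /(ler_wpM2l (ltW C0)) a /le_trans/(_ a).
rewrite /delta; set x := nrm _ in np *.
have -> : C * (k * (x / (2 * C * k))) = x / 2.
  by field; rewrite !gt_eqF.
lra.
Qed.

End mittag_leffler.

Section betti.
Variables (R : realType) (G : groupType).
Local Notation H := (ell2 R G).
Local Notation L := (groupvN R G).

(** A positive supremum is witnessed by cycles h and an idempotent A of positive trace, so A is
    nonzero. That a combination of the h bounding in the complex is killed by A is exactly the
    freeness asked by [cocycle_exists]. *)
Lemma betti_cocycle : countable [set: G] -> (0 < first_l2_betti R G)%E ->
  exists (b : G -> H) (F : {fset G}) (c : G -> L),
    [/\ cocycle b, \sum_(g <- F) (c g * lvN R g - c g) = 0 &
        \sum_(g <- F) c g (b g) <> 0].
Proof.
move=> cG b0; have [F [Fmono Fexh]] := exhaustion cG.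
have [d [n [A [h [AA hZ hB dE]]]] d0] : exists2 d : \bar R,
    exists n (A : 'M[L]_n) (h : 'I_n -> G -> L^o),
    [/\ A *m A = A, forall i, cycles1 (h i),
        forall v : 'rV[L]_n,
          boundaries1 (\sum_(i < n) v 0 i *: h i) <-> v *m A = 0 &
        d = (complex.Re (\sum_(i < n) vNtrace (A i i)))%:E] & (0 < d)%E.
  apply: contrapT => none; move: b0; apply/negP; rewrite -leNgt.
  apply: ge_ereal_sup => d hd; rewrite leNgt; apply/negP => d0; apply: none.
  by exists d.
pose F0 := fset_set (\bigcup_(i in [set: 'I_n]) [set g | h i g <> 0%R]).
have supp i g : g \notin F0 -> h i g = 0.
  move=> gF; apply: contrapT => hg; move/negP: gF; apply.
  rewrite in_fset_set; first by rewrite inE; exists i.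
  by apply: bigcup_finite => // k _; exact: (hZ k).1.
have [eta Aeta] : exists eta : 'I_n -> H, mxop (fun i k => A i k) eta <> 0.
  apply: contrapT => none; move: d0; rewrite dE big1 ?ltxx// => i _.
  rewrite /vNtrace -(mxop_single (fun i k => A i k)).
  suff -> : mxop (fun i k => A i k) (single i (delta R 1%g)) = 0 by [].
  by apply: contrapT => h'; apply: none; exists (single i (delta R 1%g)).
(* F0 is joined to every stage so that already stage 0 contains the supports of all the cycles. *)
have [|||||b [cb [i hi]]] := @cocycle_exists R G 'I_n (fun m => F m `|` F0)%fset
    (fun i g => h i g) (fun i k => A i k) _ _ _ _ eta.
- by move=> m m' mm; apply: fsetSU; exact: Fmono.
- by move=> g; have [m gm] := Fexh g; exists m; rewrite inE gm.
- by move=> i g; rewrite inE negb_or => /andP[_]; exact: supp.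
- move=> v hv k; have := (hB (\row_i v i)).1.
  have -> : \sum_(i < n) (\row_i v i) 0 i *: h i = (fun g => \sum_i v i * h i g) :> (G -> L^o).
    by apply/funext => g; rewrite fct_sumE; apply: eq_bigr => i _; rewrite mxE.
  move=> /(_ hv)/(congr1 (fun M : 'rV[L]_n => M 0 k)); rewrite !mxE => {2}<-.
  by apply: eq_bigr => i _; rewrite mxE.
- exact: Aeta.
exists b, (F 0%N `|` F0)%fset, (h i); split=> //.
have := (hZ i).2; rewrite /bar_d1 (fsbigTE (F 0%N `|` F0)%fset)// => g.
by rewrite inE negb_or => /andP[_ /supp ->]; rewrite mul0r subr0.
Qed.

End betti.

(** * Bounded cocycles and amenable groups *)

Section bounded_cocycles.
Variables (R : realType) (G : groupType).
Local Notation H := (ell2 R G).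
Local Notation L := (groupvN R G).
Implicit Types (b : G -> H).

(** The pairing of c with the coboundary of x is the operator d1 c applied to x. *)
Lemma cycle_pairing_coboundary (F : {fset G}) (c : G -> L) (x : H) :
  \sum_(g <- F) (c g * lvN R g - c g) = 0 ->
  \sum_(g <- F) c g (lreg R g x - x) = 0.
Proof.
move=> /(congr1 (fun t : L => t x)); rewrite groupvN_sumE groupvN_0E => h.
rewrite -[RHS]h; by apply: eq_bigr => g _; rewrite linearB.
Qed.

(* The Chebyshev centre of the orbit of 0 under the affine action of b is fixed. *)
Lemma bounded_cocycle_inner b (M : R) : cocycle b -> (forall g, nrm (b g) <= M) ->
  exists x, forall g, b g = lreg R g x - x.
Proof.
move=> cb bM; pose q (x : H) : R := sup (range (fun g => sqn (x - b g))).
have hs x : has_sup (range (fun g => sqn (x - b g))).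
  split; first by exists (sqn (x - b 1%g)), 1%g.
  exists ((nrm x + M) ^+ 2) => _ [g _ <-]; rewrite -nrm_sqr.
  have h : nrm (x - b g) <= nrm x + M.
    by apply: le_trans (nrmD_le _ _) _; rewrite nrmN lerD2l.
  by rewrite ler_sqr ?nnegrE ?nrm_ge0//; exact: le_trans (nrm_ge0 _) h.
have q_ge x g : sqn (x - b g) <= q x by apply: ub_le_sup; [case: (hs x)|exists g].
have q_le x (c : R) : (forall g, sqn (x - b g) <= c) -> q x <= c.
  by move=> h; apply: ge_sup; [case: (hs x) | move=> _ [g _ <-]].
have conv x y : exists m : H, q m + sqn (x - y) / 4 <= (q x + q y) / 2.
  exists ((2^-1 : R)%:C *: (x + y)); rewrite -lerBrDr; apply: q_le => g.
  rewrite lerBrDr; apply: (@le_trans _ _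
     ((sqn (x - b g) + sqn (y - b g)) / 2)); last first.
    by have := q_ge x g; have := q_ge y g; gen_dot; move: (q x) (q y) => *; lra.
  rewrite le_eqVlt; apply/orP; left; apply/eqP.
  rewrite !dotBB !dotZl !dotZr !dotDD [dot (x + y) (b g)]dotDl.
  by gen_dot => *; field.
have [||||l _ lmin] := @exists_minimizer R H setT q 0.
- by exists 0.
- by move=> x _; apply: le_trans (q_ge x 1%g); exact: dot_ge0.
- by move=> x y _ _; have [m hm] := conv x y; exists m.
- move=> l c h; split=> //; apply: q_le => g; apply: dot_lsc => e e0.
  have [x [_ xl qx]] := h e e0; exists x; split=> //.
  exact: le_trans (q_ge x g) qx.
exists (- l) => g; pose l' := lreg R g l + b g.
have ql' : q l' <= q l.
  apply: q_le => h; apply: le_trans (q_ge l (g^-1 * h)%g).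
  have E : l' - b h = lreg R g (l - b (g^-1 * h)%g).
    have -> : b h = b g + lreg R g (b (g^-1 * h)%g) by rewrite -cb mulVKg.
    by rewrite linearB /l'; apply: ell2P => s; rewrite !ell2E; ring.
  by rewrite E dot_lreg.
have [m hm] := conv l l'; have := lmin m I.
have d0 := dot_ge0 (l - l') => qm.
have : l - l' = 0.
  apply: dot_eq0; apply/eqP; rewrite eq_le d0 andbT.
  by move: hm ql' qm; gen_dot; move: (q _) (q _) (q _) => *; lra.
move=> /eqP; rewrite subr_eq0 /l' => /eqP lE; rewrite linearN opprK.
by rewrite {2}lE addKr.
Qed.

End bounded_cocycles.

Section orthogonality.
Variables (R : realType) (V : hilbertType R).
Implicit Types (u v w : V) (X : set V).

Lemma dot_eq0_closure v u : hclosure [set x | dot x v = 0] u -> dot u v = 0.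
Proof.
move=> hu; apply/eqP; rewrite -normr_eq0 eq_le normr_ge0 andbT.
apply/ler_addgt0Pl => e e0; rewrite addr0.
have v0 : 0 < nrm v + 1 by have := nrm_ge0 v; lra.
have [x /= xv ux] := hu (e / (nrm v + 1)) (divr_gt0 e0 v0).
have -> : dot u v = dot (u - x) v by rewrite dotBl xv subr0.
have cs y : dot y v <= nrm y * nrm v := cauchy_schwarz y v.
have : `|dot (u - x) v| <= nrm (u - x) * nrm v.
  by rewrite ler_norml cs andbT lerNl -dotNl; apply: le_trans (cs _) _; rewrite nrmN.
move/le_trans; apply; apply: le_trans (ler_wpM2r (nrm_ge0 _) ux) _.
by rewrite mulrAC ler_pdivrMr// ler_wpM2l ?(ltW e0)// lerDl.
Qed.

(** [dot] is only a real part, so complex orthogonality has to quantify over the scalar z. *)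
Definition perp X : set V := [set u | forall (z : R[i]) w, X w -> dot u (z *: w) = 0].

Lemma perp_dot X u w : perp X u -> X w -> dot u w = 0.
Proof. by move=> hu Xw; rewrite -[w]scale1r; exact: hu. Qed.

Lemma hsub_perp X : hsub (perp X).
Proof.
split=> [z w _|z u v hu hv z' w Xw|u hu z w Xw]; first by rewrite dot0l.
  by rewrite dotDl dot_conj scalerA hu// hv// addr0.
by apply: dot_eq0_closure; apply: hclosureS hu => x; exact.
Qed.

(* One Gram-Schmidt step. *)
Lemma adjoin_vector (E : set V) u : hsub E -> exists (E' : set V) w,
  [/\ hsub E', E `<=` E', E' u, sqn w <= 1 &
      forall x, sqn (proj E' x) =
        sqn (proj E x) + (dot x w ^+ 2 + dot x ('i *: w) ^+ 2)].
Proof.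
move=> hE; have [Eu|Eu] := pselect (E u).
  exists E, 0; split=> // [|x]; first by rewrite dot0l ler01.
  by rewrite scaler0 dot0r expr0n !addr0.
pose u' := u - proj E u.
have u'p : 0 < nrm u'.
  rewrite lt_neqAle nrm_ge0 andbT eq_sym; apply/eqP => /nrm_eq0/eqP.
  by rewrite subr_eq0 => /eqP uE; apply: Eu; rewrite uE; exact: (proj_in hE).
pose w := ((nrm u')^-1)%:C *: u'.
have ww : sqn w = 1.
  by rewrite dotZl dotZr -nrm_sqr mulrA -expr2 -exprMn mulVf ?expr1n ?gt_eqF.
have wE (z : R[i]) e : E e -> dot w (z *: e) = 0.
  move=> Ee; rewrite dotZl (proj_orth hE) ?mulr0//; exact: hsubZ.
have iw : dot w ('i *: w) = 0.
  have : dot w ('i *: w) = - dot w ('i *: w).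
    rewrite {1}dotC dot_conj (_ : conjc 'i = - 'i :> R[i]) ?scaleNr ?dotNr//.
    by apply/eqP; rewrite eq_complex /= oppr0 !eqxx.
  exact: eq_opp0.
pose S : set V := [set x | exists e z, E e /\ x = e + z *: w].
have E0 : E 0 by case: hE.
have hS : hsub (hclosure S).
  apply: hsub_closure; first by exists 0, 0; rewrite scale0r addr0.
  move=> z _ _ [e [c [Ee ->]]] [e' [c' [Ee' ->]]].
  exists (z *: e + e'), (z * c + c'); split.
    by apply: hsubD => //; exact: hsubZ.
  by rewrite scalerDr scalerA addrACA -scalerDl.
have zE (z : R[i]) : z = (complex.Re z)%:C + (complex.Im z)%:C * 'i.
  by case: z => a b; apply/eqP; rewrite eq_complex /=; apply/andP; split; apply/eqP; ring.
have dot_zw x (z : R[i]) : dot x (z *: w) =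
    complex.Re z * dot x w + complex.Im z * dot x ('i *: w).
  by rewrite {1}(zE z) scalerDl dotDr dotZr -scalerA dotZr.
have ii : sqn ('i *: w) = 1.
  by rewrite dot_self_scale ww mulr1 /abs2 /= expr0n expr1n add0r.
(* This is the complex inner product of x and w. *)
pose c x : R[i] := dot x w +i* dot x ('i *: w).
have PE x : proj (hclosure S) x = proj E x + c x *: w.
  apply: proj_uniq => //.
    by apply: sub_hclosure; exists (proj E x), (c x); split=> //; exact: (proj_in hE).
  move=> y yS; rewrite dotC; apply: dot_eq0_closure; apply: hclosureS yS.
  move=> _ [e [z [Ee ->]]] /=; rewrite dotC opprD addrA dotBl !dotDr proj_orth// add0r.
  rewrite [dot (c x *: w) e]dot_conj wE// add0r dotBl.
  have -> : dot (proj E x) (z *: w) = 0.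
    by rewrite dotC dot_conj; apply: wE; exact: (proj_in hE x).
  rewrite subr0 (dot_zw x z) (dot_zw (c x *: w) z) (dotC (c x *: w) w).
  rewrite (dotC (c x *: w) ('i *: w)) (dot_zw w (c x)) (dot_zw ('i *: w) (c x)).
  by rewrite ww (dotC ('i *: w) w) iw ii /c /=; ring.
exists (hclosure S), w; split=> //.
- by move=> e Ee; apply: sub_hclosure; exists e, 0; rewrite scale0r addr0.
- apply: sub_hclosure; exists (proj E u), (nrm u')%:C; split; first exact: (proj_in hE).
  by rewrite scalerA -rmorphM mulfV ?gt_eqF// rmorph1 scale1r addrC subrK.
- by rewrite ww.
- move=> x; rewrite PE dotDD dot_self_scale ww mulr1 dotC dot_conj.
  by rewrite (wE _ _ (proj_in hE x)) mulr0 addr0.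
Qed.

End orthogonality.

Section span_trace.
Variables (R : realType) (K : finType) (J : choiceType).
Local Notation V := (K -> ell2 R J).

Lemma span_trace (s : seq V) : exists E : set V,
  [/\ hsub E, forall v, v \in s -> E v & forall X : {fset J},
    \sum_k \sum_(g <- X) sqn (proj E (single k (delta R g)))
      <= (size s)%:R].
Proof.
elim: s => [|u s [E [hE sE trE]]].
  exists (perp setT); split; [exact: hsub_perp | by [] | move=> X].
  rewrite big1// => k _; rewrite big1// => g _.
  by apply: (perp_dot (X := setT)) => //; apply: proj_in; exact: hsub_perp.
have [E' [w [hE' EE' E'u w1 trE']]] := adjoin_vector u hE.
exists E'; split=> // [v|X].
  by rewrite inE => /predU1P[->//|/sE/EE'].
under eq_bigr do under eq_bigr do rewrite trE'.
under eq_bigr do rewrite big_split /=.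
rewrite big_split /= -[X in _ <= X%:R]addn1 natrD lerD//.
apply: le_trans w1; rewrite pi_dotE; apply: ler_sum => k _.
rewrite dot_ell2E ell2_dotE; apply: le_trans (nsq_sum_le (w k) X).
apply: ler_sum => g _; rewrite ![dot (single _ _) _]dotC !dot_single.
rewrite !dot_ell2E !ell2_dot_delta /abs2 fctE ell2EZ.
by case: (w k g) => a b /=; rewrite mul0r mul1r sub0r sqrrN.
Qed.

End span_trace.

(** * Cocycles along Folner sets *)

Section folner.
Variables (R : realType) (G : groupType).
Local Notation H := (ell2 R G).
Local Notation L := (groupvN R G).

Definition boundary_size (K A : {fset G}) : nat :=
  \sum_(k <- K) (count (fun a => (k^-1 * a)%g \notin A) A + count (fun a => (k * a)%g \notin A) A).

Definition folner := forall (K : {fset G}) (e : R), 0 < e ->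
  exists2 A : {fset G}, A != fset0 & (boundary_size K A)%:R <= e * #|` A|%:R.

Lemma dot_trunc (P : pred G) (u v : H) : dot (trunc P u) v = dot u (trunc P v).
Proof.
have orth (x y : H) : dot (trunc P x) (trunc (predC P) y) = 0.
  rewrite dot_ell2E /ell2_dot (_ : nsq (_ + _) = nsq (trunc P x - trunc (predC P) y)).
    by rewrite subrr mul0r.
  apply: eq_nsq => i; rewrite !ell2E /=; case: (P i) => /=; rewrite ?oppr0 ?addr0 ?add0r//.
  by rewrite /abs2; case: (y i) => a b /=; rewrite !sqrrN.
transitivity (dot (trunc P u) (trunc P v)).
  by rewrite -[in LHS](subrK (trunc P v) v) subr_trunc dotDr orth add0r.
by rewrite -[in RHS](subrK (trunc P u) u) subr_trunc dotDl
  [dot (trunc (predC P) u) _]dotC orth add0r.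
Qed.

Lemma delta_combE (X : {fset G}) (f : G -> R[i]) x :
  (\sum_(y <- X) f y *: delta R y : H) x = if x \in X then f x else 0.
Proof.
have sumE (s : seq G) : (\sum_(g <- s) f g *: delta R g : H) x =
    \sum_(g <- s) f g * (x == g)%:R.
  by elim: s => [|g s IH]; rewrite ?big_nil ?big_cons// ell2ED IH.
rewrite sumE; case: ifP => xX.
  rewrite (big_fsetD1 x)//= eqxx mulr1 big_seq big1 ?addr0// => g.
  by rewrite !inE eq_sym => /andP[/negPf -> _]; rewrite mulr0.
rewrite big_seq big1// => g gX; case: eqP => [xg|_]; last by rewrite mulr0.
by rewrite xg gX in xX.
Qed.

Lemma coboundary_cocycle (x : H) : cocycle (fun g => lreg R g x - x).
Proof.
move=> g k; rewrite -[LHS]/(lreg R (g * k)%g x - x).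
rewrite -[RHS]/(lreg R g x - x + lreg R g (lreg R k x - x)).
have -> : lreg R g (lreg R k x - x) = lreg R (g * k)%g x - lreg R g x.
  by rewrite -(lreg_comp g k x); exact: linearB.
by rewrite [RHS]addrC addrA subrK.
Qed.

Section harmonic.
Variable K : {fset G}.
Local Notation V := (K -> H).

Definition coboundary (x : H) : V := fun k => lreg R (val k) x - x.

Lemma coboundary_linear z x y :
  coboundary (z *: x + y) = z *: coboundary x + coboundary y.
Proof.
apply/funext => k; rewrite /coboundary !fctE linearP.
by apply: ell2P => s; rewrite !ell2E; ring.
Qed.

Lemma coboundary_rtrans g x : rtrans g (coboundary x) = coboundary (rreg R g x).
Proof.
apply/funext => k; rewrite /rtrans /coboundary linearB; congr (_ - _).
by apply: ell2P => s; rewrite rregE !lregE rregE mulgA.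
Qed.

Definition cocycle_space : set V := hclosure [set @restr R G K b | b in @cocycle R G].

Lemma hmod_cocycle_space : hmod cocycle_space.
Proof.
apply: hmod_closure.
- by exists (fun=> 0) => // g k; rewrite linear0 addr0.
- move=> z _ _ [b hb <-] [b' hb' <-]; exists (z *: b + b') => // g k.
  by rewrite !fctE hb hb' linearP scalerDr addrACA.
- move=> g _ [b hb <-]; exists (fun k => rreg R g (b k)) => // k l.
  rewrite hb linearD; congr (_ + _).
  by apply: ell2P => s; rewrite rregE !lregE rregE mulgA.
Qed.

(** A model on K of reduced first cohomology: limits of cocycles modulo limits of coboundaries,
    realized as an orthogonal complement so that it has a dimension. *)
Definition harmonic : set V := cocycle_space `&` perp (range coboundary).

Lemma hmod_harmonic : hmod harmonic.
Proof.
split; first by apply: hsub_setI; [case: hmod_cocycle_space | exact: hsub_perp].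
move=> g u [Uu pu]; split; first exact: hmod_cocycle_space.2.
move=> z _ [x _ <-]; rewrite -(rtransVK g (z *: coboundary x)) dot_rtrans.
have -> : rtrans g^-1%g (z *: coboundary x) = z *: coboundary (rreg R g^-1%g x).
  by rewrite -coboundary_rtrans; apply/funext => k; rewrite /rtrans fctE linearZ.
by apply: pu; exists (rreg R g^-1%g x).
Qed.

Section counting.
Variable A : {fset G}.

Let chi (v : V) : V := fun k => trunc (mem A) (v k).

Let chi_linear z u v : chi (z *: u + v) = z *: chi u + chi v.
Proof. by apply/funext => k; rewrite /chi !fctE trunc_linear. Qed.

Let chi0 : chi 0 = 0.
Proof. by apply/funext => k; apply: ell2P => s; rewrite truncE if_same. Qed.

Let chiZ z u : chi (z *: u) = z *: chi u.
Proof. by rewrite -[z *: u]addr0 chi_linear chi0 addr0. Qed.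

Let chiB u v : chi (u - v) = chi u - chi v.
Proof. by rewrite addrC -scaleN1r chi_linear scaleN1r addrC. Qed.

Let chi_dot u v : dot (chi u) v = dot u (chi v).
Proof. by rewrite !pi_dotE; apply: eq_bigr => k _; rewrite dot_trunc. Qed.

Let chi_idem u : chi (chi u) = chi u.
Proof. by apply/funext => k; apply: ell2P => s; rewrite /chi !truncE; case: (mem A s). Qed.

Let chi_le u : nrm (chi u) <= nrm u.
Proof.
have h : sqn (chi u) = dot (chi u) u by rewrite chi_dot chi_idem -chi_dot.
have := cauchy_schwarz (chi u) u; rewrite -h -nrm_sqr.
have [->|n0] := eqVneq (nrm (chi u)) 0; first by rewrite nrm_ge0.
by rewrite expr2 ler_pM2l// lt_neqAle eq_sym n0 nrm_ge0.
Qed.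

Let interior y := (y \in A) && all (fun k => (k * y)%g \in A) K.

Let bd : seq G := flatten [seq [seq (k^-1 * a)%g | a <- A & (k^-1 * a)%g \notin A]
  ++ [seq a <- A | (k * a)%g \notin A] | k <- K].

Let size_bd : size bd = boundary_size K A.
Proof.
rewrite /bd size_flatten /shape -map_comp sumnE big_map; apply: eq_bigr => k _ /=.
by rewrite size_cat size_map !size_filter.
Qed.

Let A' : {fset G} := (A `|` [fset (k^-1 * a)%g | k in K, a in A])%fset.

Let bdP y : y \in A' -> ~~ interior y -> y \in bd.
Proof.
rewrite inE => /orP[yA|/imfset2P[k /= kK [a /= aA yE]]].
  rewrite /interior yA /= => /allPn[k kK kyA]; apply/flatten_mapP; exists k => //.
  by rewrite mem_cat !mem_filter kyA yA orbT.
have [yA|yA _] := boolP (y \in A).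
  rewrite /interior yA /= => /allPn[l lK lyA]; apply/flatten_mapP; exists l => //.
  by rewrite mem_cat !mem_filter lyA yA orbT.
apply/flatten_mapP; exists k => //; rewrite mem_cat; apply/orP; left.
by apply/mapP; exists a; rewrite // mem_filter aA -yE yA.
Qed.

Let chi_interior y : interior y -> chi (coboundary (delta R y)) = coboundary (delta R y).
Proof.
move=> /andP[yA /allP yK]; apply/funext => k; apply: ell2P => s.
rewrite /chi truncE; case: ifP => // /negbT sA.
rewrite /coboundary ell2ED ell2EN lregE /=.
have -> : (s == y) = false by apply: contraNF sA => /eqP ->.
have -> : ((val k)^-1 * s == y)%g = false.
  apply: contraNF sA => /eqP E; rewrite -(mulVKg (val k) s) E.
  by apply: yK; exact: valP.
by rewrite oppr0 addr0.
Qed.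

(** Among all functions on G, b is the coboundary of f(y) = - b(y)(y), as follows by evaluating b(x)
    = b(k) + lambda_k b(k^-1 x) at x. This f need not be square summable, but on A only its values
    on A' are seen. *)
Let chi_cocycle b : cocycle b -> exists f : G -> R[i],
  chi (restr b) = \sum_(y <- A') f y *: chi (coboundary (delta R y)).
Proof.
move=> cb; pose f y : R[i] := - b y y; exists f.
have -> : \sum_(y <- A') f y *: chi (coboundary (delta R y)) =
    chi (coboundary (\sum_(y <- A') f y *: delta R y)).
  rewrite (big_morph coboundary (id1 := 0) (op1 := +%R)); last 2 first.
  - by move=> x y; rewrite -[x]scale1r coboundary_linear !scale1r.
  - by apply/funext => k; rewrite /coboundary linear0 subrr.
  rewrite (big_morph chi (id1 := 0) (op1 := +%R)) //; last first.
    by move=> x y; rewrite -[x]scale1r chi_linear !scale1r.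
  apply: eq_bigr => y _; rewrite -chiZ; congr chi.
  have c0 : coboundary 0 = 0 by apply/funext => k; rewrite /coboundary linear0 subrr.
  by rewrite -[f y *: delta R y]addr0 coboundary_linear c0 addr0.
apply/funext => k; apply: ell2P => x; rewrite /chi !truncE; case: ifP => // xA.
rewrite /coboundary ell2ED ell2EN lregE !delta_combE.
have {}xA : x \in A := xA.
have -> : x \in A' by rewrite inE xA.
have -> : ((val k)^-1 * x)%g \in A'.
  by rewrite inE; apply/orP; right; apply/imfset2P; exists (val k); [exact: valP | exists x].
rewrite /f opprK /restr; set y := ((val k)^-1 * x)%g.
have := cb (val k) y; rewrite /y mulVKg => /(congr1 (fun u : H => u x)).
by rewrite ell2E lregE -/y => ->; rewrite addrCA addNr addr0.
Qed.

(** Truncated to A, a harmonic vector is a limit of combinations of truncated coboundaries of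
    delta_y. It is orthogonal to those with y interior, so it lives in a space E spanned by boundary
    contributions, of trace at most their number. On the other side, right invariance gives the
    projection onto [harmonic] trace |A| times its dimension over A. *)
Lemma harmonic_count : #|` A|%:R * hdim harmonic <= (boundary_size K A)%:R.
Proof.
have hh := hmod_harmonic.
pose S0 : set V := perp (perp [set coboundary (delta R y) | y in [set y | interior y]]).
have hS0 : hsub S0 := hsub_perp _.
(* S0 is the closed span of the coboundaries of interior points; q fixes truncated harmonic vectors
   and leaves only boundary terms of a truncated cocycle. *)
pose q v := v - proj S0 v.
have q_linear z u v : q (z *: u + v) = z *: q u + q v.
  by rewrite /q proj_linear// scalerBr opprD addrACA.
have q_le v : nrm (q v) <= nrm v.
  by apply: ler_wsqrtr; rewrite (proj_pythagoras hS0 v) lerDr dot_ge0.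
have [E [hE sE trE]] := span_trace [seq q (chi (coboundary (delta R y))) | y <- bd].
have chiE v : harmonic v -> E (chi v).
  move=> [Uv pv].
  have qv : q (chi v) = chi v.
    rewrite /q (@proj_uniq _ _ _ hS0 _ 0) ?subr0//; first by case: hS0.
    move=> w S0w; rewrite dotC; apply: (perp_dot S0w) => z _ [y iy <-].
    by rewrite chi_dot chiZ chi_interior//; apply: pv; exists (delta R y).
  have [_ _ Ec] := hE; apply: Ec => e e0.
  have [_ [b cb <-] vb] := Uv e e0; exists (q (chi (restr b))); last first.
    rewrite -qv; have -> : q (chi v) - q (chi (restr b)) = q (chi (v - restr b)).
      by rewrite chiB addrC -scaleN1r -q_linear scaleN1r addrC.
    by apply: le_trans (q_le _) _; apply: le_trans (chi_le _) _.
  have [f ->] := chi_cocycle cb.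
  have qD : {morph q : x y / x + y}.
    by move=> x y; rewrite -[x]scale1r q_linear !scale1r.
  have q0 : q 0 = 0 by rewrite /q proj_id ?subrr//; case: hS0.
  rewrite (big_morph q qD q0) big_seq.
  elim/big_ind: _ => [|x y Ex Ey|y yA']; [by case: hE | exact: hsubD | ].
  have -> : q (f y *: chi (coboundary (delta R y))) = f y *: q (chi (coboundary (delta R y))).
    by rewrite -[f y *: _ in LHS]addr0 q_linear q0 addr0.
  apply: hsubZ => //; have [iy|iy] := boolP (interior y); last first.
    by apply: sE; apply/mapP; exists y => //; exact: bdP.
  rewrite chi_interior// /q proj_id ?subrr//; first by case: hE.
  by move=> z w pw; rewrite dotC dot_conj; apply: pw; exists y.
(* The diagonal of the projection onto [harmonic] is constant along right translations; at a point
   of A it is dominated by that of E, since [chi] maps [harmonic] into E. *)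
have key k a : a \in A ->
    sqn (proj harmonic (basis R G k)) <=
    sqn (proj E (single k (delta R a))).
  move=> aA; set d := single k (delta R a).
  have dE : d = rtrans a^-1%g (basis R G k).
    apply/funext => j; rewrite /d /rtrans /basis /single; case: ifP => _; last by rewrite linear0.
    by rewrite rreg_delta invgK mul1g.
  have -> : sqn (proj harmonic (basis R G k)) =
      sqn (proj harmonic d) by rewrite dE proj_rtrans// dot_rtrans.
  set v := proj harmonic d; have hv : harmonic v := proj_in hh.1 d.
  have chid : chi d = d.
    apply/funext => j; rewrite /chi /d /single; apply: ell2P => s; rewrite truncE.
    case: ifP => // /negbT sA; case: ifP => //= _.
    by case: eqP => // sa; case/negP: sA; rewrite sa.
  have vd : sqn v = dot (chi v) (proj E d).
    rewrite -(proj_self hh.1) -/v -[in LHS]chid -chi_dot.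
    have := proj_orth hE d (chiE v hv); rewrite dotBl => /eqP; rewrite subr_eq0 => /eqP h.
    by rewrite dotC h dotC.
  have := cauchy_schwarz (chi v) (proj E d); rewrite -vd => h.
  have {}h : nrm v ^+ 2 <= nrm v * nrm (proj E d).
    by rewrite nrm_sqr; apply: le_trans h _; rewrite ler_wpM2r ?nrm_ge0.
  rewrite -!nrm_sqr; have [->|v0] := eqVneq (nrm v) 0; first by rewrite expr0n sqr_ge0.
  rewrite ler_sqr ?nnegrE ?nrm_ge0//; move: h; rewrite expr2 ler_pM2l//.
  by rewrite lt_neqAle eq_sym v0 nrm_ge0.
have tr := trE A; rewrite size_map size_bd in tr.
apply: le_trans tr; rewrite /hdim mulr_sumr; apply: ler_sum => k _.
rewrite mulr_natl -[in leLHS]sum1_size -sumrMnr.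
by rewrite big_seq [leRHS]big_seq; apply: ler_sum => a aA; rewrite mulr1n; exact: key.
Qed.

End counting.

End harmonic.

Lemma folner_pairing (b : G -> H) (K : {fset G}) (c : G -> L) : folner -> cocycle b ->
  \sum_(g <- K) (c g * lvN R g - c g) = 0 -> \sum_(g <- K) c g (b g) = 0.
Proof.
move=> fol cb hc; have hh := hmod_harmonic K.
have d0 : hdim (harmonic (K := K)) <= 0.
  apply/ler_addgt0Pr => e e0; rewrite add0r; have [A A0 hA] := fol K e e0.
  have := le_trans (harmonic_count K A) hA; rewrite mulrC ler_pM2r//.
  by rewrite ltr0n cardfs_gt0.
have hB : hmod (hclosure (range (coboundary (K := K)))).
  apply: hmod_closure.
  - by exists 0 => //; apply/funext => k; rewrite /coboundary linear0 subrr.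
  - by move=> z _ _ [x _ <-] [y _ <-]; exists (z *: x + y) => //; rewrite coboundary_linear.
  - by move=> g _ [x _ <-]; exists (rreg R g x) => //; rewrite coboundary_rtrans.
pose v : K -> H := restr b - proj (hclosure (range (coboundary (K := K)))) (restr b).
have hv : harmonic v.
  split.
    apply: (hsubB (hmod_cocycle_space K).1); first by apply: sub_hclosure; exists b.
    apply: (hclosureS _ (proj_in hB.1 (restr b))) => _ [x _ <-].
    exists (fun g => lreg R g x - x) => //; exact: coboundary_cocycle.
  move=> z _ [x _ <-]; apply: (proj_orth hB.1); apply: (hsubZ _ hB.1).
  by apply: sub_hclosure; exists x.
have v0 : v = 0.
  have z1 : hmod [set u : K -> H | u = 0].
    have [[W0 Wl Wc] Wr] := hmod_ker (fun i j : K => (i == j)%:R : L).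
    have kE : mxker (fun i j : K => (i == j)%:R : L) = [set u : K -> H | u = 0].
      apply/seteqP; split=> u /=; rewrite /mxker /=; last by move=> ->; exact: mxop0.
      move=> hu; rewrite -hu; apply/funext => i; rewrite /mxop (bigD1 i)//= eqxx groupvN_1E.
      by rewrite big1 ?addr0// => j; rewrite eq_sym => /negPf ->.
    by rewrite -kE; exact: hmod_ker.
  have E : [set u : K -> H | u = 0] = harmonic (K := K).
    apply: (hdim_eq z1 hh) => [_ ->|]; first by case: hh => -[].
    by apply: le_trans d0 _; apply: sumr_ge0 => i _; exact: dot_ge0.
  by move: hv; rewrite -E.
pose M : unit -> K -> L := fun _ k => c (val k).
have ME u : mxop M (restr u) tt = \sum_(g <- K) c g (u g).
  by rewrite /mxop /M (@big_seq_fsetE _ _ _ _ K predT (fun g => c g (u g))).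
rewrite -ME.
have kB : hclosure (range (coboundary (K := K))) `<=` mxker M.
  have [[_ _ Kc] _] := hmod_ker M; apply: subset_trans Kc; apply: hclosureS => _ [x _ <-].
  apply/funext => -[]; rewrite (ME (fun g => lreg R g x - x)).
  exact: cycle_pairing_coboundary.
have -> : restr b = proj (hclosure (range (coboundary (K := K)))) (restr b).
  by apply/eqP; rewrite -subr_eq0 -/v v0.
by rewrite (kB _ (proj_in hB.1 (restr b))).
Qed.

End folner.

(** * Non-amenability *)

Section sublinear.
Variables (R : realType) (V : lmodType R) (S : set V).
Hypothesis S0 : S 0.
Hypothesis SD : forall u v, S u -> S v -> S (u + v).
Hypothesis SZ : forall (r : R) u, S u -> S (r *: u).

Definition sublinear (q : V -> R) :=
  (forall u v, S u -> S v -> q (u + v) <= q u + q v) /\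
  (forall (r : R) u, 0 <= r -> S u -> q (r *: u) <= r * q u).

Let sub0 q : sublinear q -> q 0 = 0.
Proof.
move=> [qD qZ]; apply/eqP; rewrite eq_le; apply/andP; split.
  by have := qZ 0 0 (lexx _) S0; rewrite scale0r mul0r.
by have := qD 0 0 S0 S0; rewrite addr0; lra.
Qed.

Let subN q u : sublinear q -> S u -> - q (- u) <= q u.
Proof.
move=> hq Su; have := hq.1 u (- u) Su; rewrite subrr sub0//.
have SN : S (- u) by rewrite -scaleN1r; exact: SZ.
by move=> /(_ SN); lra.
Qed.

Let subZ q (r : R) u : sublinear q -> 0 <= r -> S u -> q (r *: u) = r * q u.
Proof.
move=> hq r0 Su; have [->|rn] := eqVneq r 0; first by rewrite scale0r mul0r sub0.
have rp : 0 < r by rewrite lt_neqAle eq_sym rn.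
apply/eqP; rewrite eq_le hq.2//= mulrC -ler_pdivlMr// mulrC.
have := hq.2 r^-1 (r *: u); rewrite scalerA mulVf// scale1r; apply; last exact: SZ.
by rewrite invr_ge0.
Qed.

(* A minimal sublinear functional below p is additive. *)
Lemma dominated_additive (p : V -> R) : sublinear p -> exists f : V -> R,
  (forall u v, S u -> S v -> f (u + v) = f u + f v) /\ (forall u, S u -> f u <= p u).
Proof.
move=> hp; pose below q := sublinear q /\ forall u, S u -> q u <= p u.
pose T := {q : V -> R | below q}.
pose r (a b : T) : bool := `[< forall u, S u -> sval b u <= sval a u >].
have p0 : T by exists p.
have [||A tot|[q [hq qp]] qmin] := @ZL_preorder T p0 r.
- by move=> a; apply/asboolP.
- move=> a b c /asboolP ba /asboolP ac; apply/asboolP => u Su.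
  exact: le_trans (ac u Su) (ba u Su).
- have [A0|/set0P[a0 Aa0]] := eqVneq A set0.
    by exists p0 => s; rewrite A0.
  pose E u := [set sval a u | a in A].
  have infE u : S u -> has_inf (E u).
    move=> Su; split; first by exists (sval a0 u), a0.
    exists (- p (- u)) => _ [a Aa <-]; have [ha ap] := svalP a.
    apply: le_trans (subN ha Su); rewrite lerN2; apply: ap.
    by rewrite -scaleN1r; exact: SZ.
  have inf_lower u a : S u -> A a -> inf (E u) <= sval a u.
    by move=> Su Aa; apply: ge_inf; [case: (infE u Su) | exists a].
  have ge_lower u (c : R) : S u -> (forall a, A a -> c <= sval a u) -> c <= inf (E u).
    move=> Su h; apply: lb_le_inf; first by case: (infE u Su).
    by move=> _ [a Aa <-]; exact: h.
  have hq : sublinear (fun u => inf (E u)) /\ forall u, S u -> inf (E u) <= p u.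
    split; last first.
      by move=> u Su; apply: le_trans (inf_lower u a0 Su Aa0) _; apply: (svalP a0).2.
    split=> [u v Su Sv|c u c0 Su].
      rewrite -lerBlDr; apply: (ge_lower _ _) => // a Aa; rewrite lerBlDr -lerBlDl.
      apply: (ge_lower _ _) => // b Ab; rewrite lerBlDl.
      have [ha _] := svalP a; have [hb _] := svalP b.
      have [/asboolP ab|/asboolP ba] := tot a b Aa Ab.
        apply: le_trans (inf_lower _ b (SD Su Sv) Ab) _; apply: le_trans (hb.1 u v Su Sv) _.
        by rewrite lerD2r; exact: ab.
      apply: le_trans (inf_lower _ a (SD Su Sv) Aa) _; apply: le_trans (ha.1 u v Su Sv) _.
      by rewrite lerD2l; exact: ba.
    have [->|cn] := eqVneq c 0.
      rewrite scale0r mul0r; have [ha _] := svalP a0.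
      by apply: le_trans (inf_lower 0 a0 S0 Aa0) _; rewrite sub0.
    have cp : 0 < c by rewrite lt_neqAle eq_sym cn.
    rewrite mulrC -ler_pdivrMr//; apply: (ge_lower _ _) => // a Aa; rewrite ler_pdivrMr// mulrC.
    have [ha _] := svalP a; apply: le_trans (inf_lower _ a (SZ c Su) Aa) _.
    exact: ha.2.
  exists (exist below _ hq) => a Aa; apply/asboolP => u Su /=; exact: inf_lower.
exists q; split=> // u w Su Sw; apply/eqP; rewrite eq_le hq.1//=.
(* The infimum of [E v] is a sublinear functional of v below q, hence equal to q by minimality; t =
   1 then gives q u + q w <= q (u + w). *)
pose E v := [set q (v + t *: w) - t * q w | t in [set t : R | 0 <= t]].
have infE v : S v -> has_inf (E v).
  move=> Sv; split; first by exists (q (v + 0 *: w) - 0 * q w), 0 => //=.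
  exists (- q (- v)) => _ [t /= t0 <-]; rewrite -subZ// lerBrDl.
  have SN : S (- v) by rewrite -scaleN1r; exact: SZ.
  have := hq.1 (v + t *: w) (- v) (SD Sv (SZ t Sw)) SN.
  by rewrite addrAC subrr add0r; lra.
have inf_lower v (t : R) : S v -> 0 <= t -> inf (E v) <= q (v + t *: w) - t * q w.
  by move=> Sv t0; apply: ge_inf; [case: (infE v Sv) | exists t].
have ge_lower v (c : R) : S v -> (forall t : R, 0 <= t -> c <= q (v + t *: w) - t * q w) ->
    c <= inf (E v).
  move=> Sv h; apply: lb_le_inf; first by case: (infE v Sv).
  by move=> _ [t t0 <-]; exact: h.
have q'_le v : S v -> inf (E v) <= q v.
  move=> Sv; apply: le_trans (inf_lower v 0 Sv (lexx _)) _.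
  by rewrite scale0r addr0 mul0r subr0.
have hq' : sublinear (fun v => inf (E v)) /\ forall v, S v -> inf (E v) <= p v.
  split; last by move=> v Sv; exact: le_trans (q'_le v Sv) (qp v Sv).
  split=> [v v' Sv Sv'|c v c0 Sv].
    rewrite -lerBlDr; apply: (ge_lower _ _) => // t t0; rewrite lerBlDr -lerBlDl.
    apply: (ge_lower _ _) => // s s0; rewrite lerBlDl.
    apply: le_trans (inf_lower _ (t + s) (SD Sv Sv') (addr_ge0 t0 s0)) _.
    have := hq.1 (v + t *: w) (v' + s *: w) (SD Sv (SZ t Sw)) (SD Sv' (SZ s Sw)).
    by rewrite addrACA -scalerDl mulrDl; lra.
  have [->|cn] := eqVneq c 0.
    by rewrite scale0r mul0r; apply: le_trans (q'_le 0 S0) _; rewrite sub0.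
  have cp : 0 < c by rewrite lt_neqAle eq_sym cn.
  rewrite mulrC -ler_pdivrMr//; apply: (ge_lower _ _) => // t t0; rewrite ler_pdivrMr// mulrC.
  apply: le_trans (inf_lower _ (c * t) (SZ c Sv) (mulr_ge0 c0 t0)) _.
  by rewrite -scalerA -scalerDr subZ ?mulrBr ?mulrA//; apply: SD => //; exact: SZ.
have /asboolP h : r (exist below _ hq') (exist below q (conj hq qp)).
  by apply: qmin; apply/asboolP => v Sv /=; exact: q'_le.
have := h u Su => /= h1; have := inf_lower u 1 Su ler01; rewrite scale1r mul1r.
lra.
Qed.

End sublinear.

(** * Isoperimetry and its dual in l^1(G) *)

Section finite_support.
Variables (R : realType) (G : groupType).
Implicit Types (f g : G -> R) (X : {fset G}).

Definition fsupp f := exists X, forall x, x \notin X -> f x = 0.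
Definition total f : R := \sum_(x \in [set: G]) f x.

Lemma totalE X f : (forall x, x \notin X -> f x = 0) -> total f = \sum_(x <- X) f x.
Proof. by move=> h; rewrite /total (fsbigTE X). Qed.

Lemma fsupp2 f g : fsupp f -> fsupp g -> exists X,
  (forall x, x \notin X -> f x = 0) /\ (forall x, x \notin X -> g x = 0).
Proof.
move=> [X hX] [Y hY]; exists (X `|` Y)%fset; split=> x; rewrite inE negb_or => /andP[xX xY].
  exact: hX.
exact: hY.
Qed.

Lemma fsuppD f g : fsupp f -> fsupp g -> fsupp (fun x => f x + g x).
Proof. by move=> hf hg; have [X [h1 h2]] := fsupp2 hf hg; exists X => x xX; rewrite h1// h2// addr0. Qed.

Lemma fsuppZ (r : R) f : fsupp f -> fsupp (fun x => r * f x).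
Proof. by move=> [X h]; exists X => x xX; rewrite h// mulr0. Qed.

Lemma fsupp_norm f : fsupp f -> fsupp (fun x => `|f x|).
Proof. by move=> [X h]; exists X => x xX; rewrite h// normr0. Qed.

Lemma fsupp_shift k f : fsupp f -> fsupp (fun x => f (k * x)%g).
Proof.
move=> [X h]; exists [fset (k^-1 * x)%g | x in X]%fset => x xX; apply: h.
apply: contra xX => xX; apply/imfsetP; exists (k * x)%g => //.
by rewrite mulKg.
Qed.

Lemma totalD f g : fsupp f -> fsupp g -> total (fun x => f x + g x) = total f + total g.
Proof.
move=> hf hg; have [X [h1 h2]] := fsupp2 hf hg.
rewrite !(@totalE X)// ?big_split// => x xX; by rewrite h1// h2// addr0.
Qed.

Lemma totalZ (r : R) f : fsupp f -> total (fun x => r * f x) = r * total f.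
Proof.
by move=> [X h]; rewrite !(@totalE X)// ?mulr_sumr// => x xX; rewrite h// mulr0.
Qed.

Lemma total_le f g : fsupp f -> fsupp g -> (forall x, f x <= g x) -> total f <= total g.
Proof.
by move=> hf hg fg; have [X [h1 h2]] := fsupp2 hf hg; rewrite !(@totalE X)//; apply: ler_sum.
Qed.

Section layer_cake.
Variables (K : {fset G}) (e : R).
Hypothesis isoperimetric : forall A : {fset G}, e * #|` A|%:R <= (boundary_size K A)%:R.

Let ind (A : {fset G}) : G -> R := fun x => (x \in A)%:R.

Let layer_step (A Y : {fset G}) : (A `<=` Y)%fset ->
  (forall k a, k \in K -> a \in A -> (k^-1 * a)%g \in Y) ->
  e * #|` A|%:R <= \sum_(k <- K) \sum_(x <- Y) `|ind A x - ind A (k * x)%g|.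
Proof.
move=> AY kAY; apply: le_trans (isoperimetric A) _.
rewrite /boundary_size natr_sum big_seq [leRHS]big_seq; apply: ler_sum => k kK.
pose f x : R := ((x \in A) && ((k * x)%g \notin A))%:R.
pose g x : R := ((x \notin A) && ((k * x)%g \in A))%:R.
have fg x : `|ind A x - ind A (k * x)%g| = g x + f x.
  rewrite /ind /f /g; case: (x \in A); case: ((k * x)%g \in A) => /=;
  by rewrite ?subrr ?normr0 ?addr0 ?subr0 ?sub0r ?normrN ?normr1 ?add0r.
under eq_bigr do rewrite fg.
rewrite big_split natrD lerD//.
  pose B := [fset (k^-1 * a)%g | a in A]%fset.
  rewrite -(@big_fset_incl _ _ _ _ B); last 2 first.
  - by apply/fsubsetP => _ /imfsetP[a /= aA ->]; exact: kAY.
  - move=> x _ xB; rewrite /g; case kxA: ((k * x)%g \in A); last by rewrite andbF.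
    by case/negP: xB; apply/imfsetP; exists (k * x)%g => //=; rewrite mulKg.
  rewrite big_imfset /=; last by move=> x y _ _; exact: mulgI.
  rewrite -sum1_count natr_sum big_mkcond big_seq [leRHS]big_seq; apply: ler_sum => a aA.
  by rewrite /g mulVKg aA andbT; case: (_ \notin _).
rewrite -(@big_fset_incl _ _ _ _ A) => //; last by move=> x _ /negPf; rewrite /f => ->.
rewrite -sum1_count natr_sum big_mkcond big_seq [leRHS]big_seq; apply: ler_sum => a aA.
by rewrite /f aA /=; case: (_ \notin _).
Qed.

Let min_exists (f : G -> R) (s : seq G) : s != [::] ->
  exists2 a, a \in s & forall b, b \in s -> f a <= f b.
Proof.
elim: s => // x [|y s] IH _; first by exists x; rewrite ?mem_head// => b; rewrite inE => /eqP ->.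
have [a ays am] := IH isT.
have [xa|/ltW ax] := leP (f x) (f a).
  exists x; rewrite ?mem_head// => b; rewrite inE => /predU1P[->//|/am].
  exact: le_trans.
exists a; first by rewrite inE ays orbT.
by move=> b; rewrite inE => /predU1P[->//|/am].
Qed.

(* Peel off the smallest value of mu on its support. *)
Let layer_cake_finite (Y : {fset G}) n : forall (A : {fset G}) (mu : G -> R),
  (#|` A| <= n)%N -> (A `<=` Y)%fset ->
  (forall k a, k \in K -> a \in A -> (k^-1 * a)%g \in Y) ->
  (forall x, x \notin A -> mu x = 0) -> (forall x, 0 <= mu x) ->
  e * \sum_(x <- A) mu x <= \sum_(k <- K) \sum_(x <- Y) `|mu x - mu (k * x)%g|.
Proof.
elim: n => [|n IH] A mu cA AY kAY muA mu0.
  move: cA; rewrite leqn0 cardfs_eq0 => /eqP ->; rewrite big_seq_fset0 mulr0.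
  by apply: sumr_ge0 => k _; apply: sumr_ge0.
have [->|A0] := eqVneq A fset0.
  rewrite big_seq_fset0 mulr0.
  by apply: sumr_ge0 => k _; apply: sumr_ge0.
have [|a0 a0A a0m] := @min_exists mu A.
  by apply: contra A0 => /eqP h; apply/eqP/fsetP => x; rewrite inE -[x \in A]/(x \in (A : seq G)) h.
pose s := mu a0; pose mu' x := mu x - s * ind A x.
pose A' := (A `\ a0)%fset.
have A'A : (A' `<=` A)%fset by exact: fsubD1set.
have mu'0 x : 0 <= mu' x.
  rewrite /mu' /ind; have [xA|xA] := boolP (x \in A); first by rewrite mulr1 subr_ge0 a0m.
  by rewrite mulr0 subr0.
have mu'A x : x \notin A' -> mu' x = 0.
  rewrite !inE negb_and negbK /mu' /ind => /orP[/eqP ->|xA].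
    by rewrite a0A mulr1 subrr.
  by rewrite (negPf xA) mulr0 subr0 muA.
have cA' : (#|` A'| <= n)%N by move: cA; rewrite (cardfsD1 a0 A) a0A.
have := IH A' mu' cA' (fsubset_trans A'A AY)
  (fun k a kK aA => kAY k a kK (fsubsetP A'A _ aA)) mu'A mu'0.
have -> : \sum_(x <- A') mu' x = \sum_(x <- A) mu x - s * #|` A|%:R.
  rewrite (@big_fset_incl _ _ _ _ A' A)//; last by move=> x _; exact: mu'A.
  rewrite sumrB -mulr_sumr; congr (_ - _ * _).
  rewrite -sum1_size natr_sum big_seq [RHS]big_seq; apply: eq_bigr => x xA.
  by rewrite /ind xA.
have := layer_step AY kAY; have s0 : 0 <= s := mu0 a0.
move=> /(ler_wpM2l s0); rewrite mulrA [s * e]mulrC => h1 h2.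
have := lerD h1 h2; rewrite mulr_sumr -big_split /=.
rewrite mulrBr mulrA addrC subrK => /le_trans; apply.
apply: ler_sum => k _; rewrite mulr_sumr -big_split /=; apply: ler_sum => x _.
rewrite /mu' /ind; have [xA|xA] := boolP (x \in A); have [yA|yA] := boolP ((k * x)%g \in A).
- by rewrite subrr normr0 !mulr1 mulr0 add0r opprB addrA subrK.
- rewrite !mulr1 !mulr0 !subr0 (muA _ yA) normr1 mulr1 !subr0.
  by rewrite !ger0_norm ?subr_ge0 ?a0m// addrC subrK.
- rewrite !mulr1 !mulr0 !subr0 (muA _ xA) !sub0r !normrN normr1 mulr1.
  by rewrite !ger0_norm ?subr_ge0 ?a0m// addrC subrK.
- by rewrite !mulr0 !subr0 normr0 mulr0 add0r.
Qed.

(** A nonnegative function is a positive combination of indicators of nested level sets, along which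
    absolute differences add up; so the inequality for sets extends to functions. *)
Lemma layer_cake (mu : G -> R) : fsupp mu -> (forall x, 0 <= mu x) ->
  e * total mu <= \sum_(k <- K) total (fun x => `|mu x - mu (k * x)%g|).
Proof.
move=> [A muA] mu0; rewrite (totalE muA).
pose Y := (A `|` [fset (k^-1 * a)%g | k in K, a in A])%fset.
have kAY k a : k \in K -> a \in A -> (k^-1 * a)%g \in Y.
  by move=> kK aA; rewrite inE; apply/orP; right; apply/imfset2P; exists k => //; exists a.
apply: le_trans (@layer_cake_finite Y _ A mu (leqnn _) (fsubsetUl _ _) kAY muA mu0) _.
rewrite big_seq [leRHS]big_seq; apply: ler_sum => k kK; rewrite (@totalE Y)// => x xY.
rewrite !muA ?subrr ?normr0//; first by apply: contra xY => kxA; rewrite -[x](mulKg k) kAY.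
by apply: contra xY; apply: fsubsetP; exact: fsubsetUl.
Qed.

End layer_cake.

(** Isoperimetry says that D is bounded below on nonnegative functions. A functional on l^1(K x G)
    that separates is a bounded family T, and its value on D delta_y is the sum in the last
    clause. *)
Lemma nonfolner_certificate : ~ folner R G -> exists (K : {fset G}) (T : K -> G -> R) (e : R),
  [/\ 0 < e, forall k x, `|T k x| <= 1 &
      forall y, e <= \sum_k (T k y - T k ((val k)^-1 * y)%g)].
Proof.
move=> /existsNP[K /existsNP[e /not_implyP[e0 hA]]].
have iso (A : {fset G}) : e * #|` A|%:R <= (boundary_size K A)%:R.
  have [->|A0] := eqVneq A fset0; first by rewrite cardfs0 mulr0.
  rewrite leNgt; apply/negP => h; apply: hA; exists A => //; exact: ltW.
pose S : set (K -> G -> R^o) := [set v | forall k, fsupp (v k)].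
pose N1 (v : K -> G -> R^o) : R := \sum_k total (fun x => `|v k x|).
pose D (mu : G -> R) : K -> G -> R^o := fun k x => mu x - mu (val k * x)%g.
pose M : set (G -> R) := [set mu | fsupp mu /\ forall x, 0 <= mu x].
have fsuppB f g : fsupp f -> fsupp g -> fsupp (fun x => f x - g x).
  move=> hf /(fsuppZ (-1)) hg; have [X hX] := fsuppD hf hg.
  by exists X => x xX; rewrite -mulN1r hX.
have DS mu : M mu -> S (D mu).
  by move=> [mus _] k; apply: fsuppB => //; exact: fsupp_shift.
have S0 : S 0 by move=> k; exists fset0.
have SD u v : S u -> S v -> S (u + v).
  by move=> hu hv k; exact: fsuppD (hu k) (hv k).
have SZ (r : R) u : S u -> S (r *: u) by move=> hu k; exact: fsuppZ (hu k).
have N1D u v : S u -> S v -> N1 (u + v) <= N1 u + N1 v.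
  move=> hu hv; rewrite /N1 -big_split /=; apply: ler_sum => k _.
  rewrite -totalD; try exact: fsupp_norm.
  apply: total_le => [||x]; last exact: ler_normD.
    by apply: fsupp_norm; exact: fsuppD.
  by apply: fsuppD; exact: fsupp_norm.
have N1Z (r : R) u : 0 <= r -> S u -> N1 (r *: u) = r * N1 u.
  move=> r0 hu; rewrite /N1 mulr_sumr; apply: eq_bigr => k _.
  rewrite -totalZ; last exact: fsupp_norm.
  by congr total; apply/funext => x; rewrite normrM ger0_norm.
have N1N u : N1 (- u) = N1 u.
  by apply: eq_bigr => k _; congr total; apply/funext => x; rewrite normrN.
have N1_cake mu : M mu -> e * total mu <= N1 (D mu).
  move=> [mus mu0]; apply: le_trans (layer_cake iso mus mu0) _.
  by rewrite (@big_seq_fsetE _ _ _ _ K predT (fun k => total (fun x => `|mu x - mu (k * x)%g|))).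
(* p is the largest room left by the requirements f <= N1 and f (D mu) >= e [total mu]; [N1_cake]
   keeps it above - N1, so the infimum is finite. *)
pose E v := [set N1 (v + D mu) - e * total mu | mu in M].
pose p v := inf (E v).
have M0 : M (fun=> 0) by split=> //; exists fset0.
have D0 : D (fun=> 0) = 0 by apply/funext => k; apply/funext => x; rewrite /D subrr.
have total0 : total (fun=> 0) = 0 by rewrite (@totalE fset0)// big_seq_fset0.
have infE v : S v -> has_inf (E v).
  move=> Sv; split; first by exists (N1 (v + D (fun=> 0)) - e * total (fun=> 0)), (fun=> 0).
  exists (- N1 v) => _ [mu Mmu <-].
  have := N1_cake _ Mmu; have := N1D (v + D mu) (- v).
  have SN : S (- v) by rewrite -scaleN1r; exact: SZ.
  move=> /(_ (SD _ _ Sv (DS _ Mmu)) SN); rewrite N1N addrAC subrr add0r.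
  by move: (N1 _) (N1 _) (N1 _) (e * _) => *; lra.
have p_le v mu : S v -> M mu -> p v <= N1 (v + D mu) - e * total mu.
  by move=> Sv Mmu; apply: ge_inf; [case: (infE v Sv) | exists mu].
have le_p v (c : R) : S v -> (forall mu, M mu -> c <= N1 (v + D mu) - e * total mu) -> c <= p v.
  move=> Sv h; apply: lb_le_inf; first by case: (infE v Sv).
  by move=> _ [mu Mmu <-]; exact: h.
have p_N1 v : S v -> p v <= N1 v.
  by move=> Sv; apply: le_trans (p_le v _ Sv M0) _; rewrite D0 addr0 total0 mulr0 subr0.
have hp : sublinear S p.
  split=> [u v Su Sv|r u r0 Su].
    rewrite -lerBlDr; apply: (le_p _ _ Su) => mu Mmu; rewrite lerBlDr -lerBlDl.
    apply: (le_p _ _ Sv) => nu Mnu; rewrite lerBlDl.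
    have Mn : M (fun x => mu x + nu x).
      by split; [exact: fsuppD Mmu.1 Mnu.1 | move=> x; exact: addr_ge0 (Mmu.2 x) (Mnu.2 x)].
    apply: le_trans (p_le _ _ (SD _ _ Su Sv) Mn) _.
    rewrite (totalD Mmu.1 Mnu.1).
    have -> : u + v + D (fun x => mu x + nu x) = (u + D mu) + (v + D nu).
      rewrite [RHS]addrACA; congr (_ + _); apply/funext => k; apply/funext => x.
      rewrite -[RHS]/(mu x - mu (val k * x)%g + (nu x - nu (val k * x)%g)).
      by rewrite addrACA -opprD.
    have := N1D _ _ (SD _ _ Su (DS _ Mmu)) (SD _ _ Sv (DS _ Mnu)).
    by rewrite mulrDr; move: (N1 _) (N1 _) (N1 _) (e * _) (e * _) => *; lra.
  have [->|rn] := eqVneq r 0.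
    rewrite scale0r mul0r; apply: le_trans (p_N1 0 S0) _.
    by have := N1Z 0 0 (lexx _) S0; rewrite scale0r mul0r => ->.
  have rp : 0 < r by rewrite lt_neqAle eq_sym rn.
  rewrite mulrC -ler_pdivrMr//; apply: (le_p _ _ Su) => mu Mmu; rewrite ler_pdivrMr// mulrC.
  have Mr : M (fun x => r * mu x).
    by split; [exact: fsuppZ Mmu.1 | move=> x; exact: mulr_ge0 r0 (Mmu.2 x)].
  apply: le_trans (p_le _ _ (SZ _ _ Su) Mr) _; rewrite (totalZ _ Mmu.1).
  have -> : r *: u + D (fun x => r * mu x) = r *: (u + D mu).
    rewrite scalerDr; congr (_ + _); apply/funext => k; apply/funext => x.
    by rewrite -[RHS]/(r * (mu x - mu (val k * x)%g)) mulrBr.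
  by rewrite N1Z//; [rewrite mulrBr mulrCA | exact: SD Su (DS _ Mmu)].
have [f [fD fp]] := dominated_additive S0 SD SZ hp.
pose d (k : K) (x : G) : K -> G -> R^o := fun k' x' => ((k' == k) && (x' == x))%:R.
have dS k x : S (d k x).
  by move=> k'; exists [fset x]%fset => y; rewrite inE /d => /negPf ->; rewrite andbF.
have SN v : S v -> S (- v) by move=> Sv; rewrite -scaleN1r; exact: SZ.
have f0 : f 0 = 0 by have := fD 0 0 S0 S0; rewrite addr0; lra.
have fN v : S v -> f (- v) = - f v.
  by move=> Sv; have := fD v (- v) Sv (SN _ Sv); rewrite subrr f0; lra.
have N1d k x : N1 (d k x) <= 1.
  rewrite /N1 (bigD1 k)//= [X in _ + X]big1 ?addr0; last first.
    move=> k' k'k; rewrite (@totalE fset0) ?big_seq_fset0// => y _.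
    by rewrite /d (negPf k'k) normr0.
  rewrite (@totalE [fset x]%fset) ?big_seq_fset1; last first.
    by move=> y; rewrite inE /d => /negPf ->; rewrite andbF normr0.
  by rewrite /d !eqxx normr1.
exists K, (fun k x => f (d k x)), e; split=> // [k x|y].
  rewrite ler_norml; apply/andP; split.
    rewrite lerNl -fN//; apply: le_trans (fp _ (SN _ (dS k x))) _.
    by apply: le_trans (p_N1 _ (SN _ (dS k x))) _; rewrite N1N.
  by apply: le_trans (fp _ (dS k x)) _; apply: le_trans (p_N1 _ (dS k x)) _.
pose dy : G -> R := fun x => (x == y)%:R.
have My : M dy.
  split; last by move=> x; rewrite /dy; case: (x == y).
  by exists [fset y]%fset => x; rewrite inE /dy => /negPf ->.
have -> : \sum_k (f (d k y) - f (d k ((val k)^-1 * y)%g)) = f (D dy).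
  have DE : D dy = \sum_k (d k y - d k ((val k)^-1 * y)%g).
    apply/funext => k; apply/funext => x; rewrite !fct_sumE (bigD1 k)//= big1 ?addr0.
      rewrite !fctE /D /d /dy eqxx /=; congr (_%:R - _%:R).
      by rewrite -(inj_eq (mulgI (val k)^-1%g)) mulKg.
    by move=> k' k'k; rewrite !fctE /d eq_sym (negPf k'k) subrr.
  have dkS k : S (d k y - d k ((val k)^-1 * y)%g) := SD _ _ (dS _ _) (SN _ (dS _ _)).
  rewrite DE; apply/esym; elim: (index_enum _) => [|k s IH]; first by rewrite !big_nil.
  rewrite !big_cons fD ?IH ?fD ?fN//; first exact: SN.
  by elim: s {IH} => [|k' s IH]; rewrite ?big_nil ?big_cons//; exact: SD (dkS k') IH.
(* Taking mu = delta_y in the infimum defining p (- D delta_y) leaves norm 0 and yields at most -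
   e. *)
rewrite -[leRHS]opprK lerNr -fN; last exact: DS.
apply: le_trans (fp _ (SN _ (DS _ My))) _; apply: le_trans (p_le _ _ (SN _ (DS _ My)) My) _.
have -> : N1 (- D dy + D dy) = 0.
  by rewrite addNr; have := N1Z 0 0 (lexx _) S0; rewrite scale0r mul0r.
rewrite (@totalE [fset y]%fset) ?big_seq_fset1 /dy ?eqxx ?mulr1 ?sub0r//.
by move=> x; rewrite inE => /negPf ->.
Qed.

End finite_support.

(** * Slowly varying functions on l^2(G) *)

Section multiplication.
Variables (R : realType) (J : choiceType).
Local Notation H := (ell2 R J).
Implicit Types (u v : H) (S : J -> R).

Lemma nrm_le_pointwise u v : (forall x, abs2 (u x) <= abs2 (v x)) -> nrm u <= nrm v.
Proof.
move=> uv; apply: le_of_sqr; rewrite ?nrm_ge0// !nrm_nsq; apply/nsq_leP => X.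
by apply: le_trans (nsq_sum_le v X); apply: ler_sum.
Qed.

(** For bounded S the product is square summable and [xget] returns it; the default 0 spares
    carrying a bound in the type. *)
Definition mulf S u : H := xget 0 [set v : H | forall x, v x = (S x)%:C * u x].

Lemma abs2M (r : R) (z : R[i]) : abs2 (r%:C * z) = r ^+ 2 * abs2 z.
Proof. by case: z => a b; rewrite /abs2 /=; ring. Qed.

Section bounded.
Variables (S : J -> R) (C : R).
Hypothesis SC : forall x, `|S x| <= C.

Let C0 u : u <> 0 -> 0 <= C.
Proof.
move=> u0; have [x _] : exists x : J, True.
  apply: contrapT => h; apply: u0; apply: ell2P => x; exfalso; apply: h; by exists x.
exact: le_trans (normr_ge0 _) (SC x).
Qed.

Lemma mulf_exists u : exists2 v : H, (forall x, v x = (S x)%:C * u x) & nrm v <= C * nrm u.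
Proof.
have [->|u0] := pselect (u = 0).
  by exists 0 => [x|]; rewrite ?mulr0// nrm0 mulr0.
have [X|v vE vM] := @ell2_of_bound R J (fun x => (S x)%:C * u x) (C ^+ 2 * nsq u).
  apply: (@le_trans _ _ (\sum_(i <- X) C ^+ 2 * abs2 (u i))).
    apply: ler_sum => x _; rewrite abs2M ler_wpM2r ?abs2_ge0//.
    exact: sqr_le_of_norm.
  by rewrite -mulr_sumr ler_wpM2l ?sqr_ge0// nsq_sum_le.
exists v; first by move=> x; rewrite vE.
apply: le_of_sqr; first by rewrite mulr_ge0 ?nrm_ge0//; exact: C0 u0.
by rewrite exprMn !nrm_nsq.
Qed.

Lemma mulfE u x : mulf S u x = (S x)%:C * u x.
Proof.
by rewrite /mulf; case: xgetP => [v _ //|]; have [v vE _] := mulf_exists u => /(_ v).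
Qed.

Lemma mulf_nrm u : nrm (mulf S u) <= C * nrm u.
Proof.
have [v vE vC] := mulf_exists u; rewrite (_ : mulf S u = v)//.
by apply: ell2P => x; rewrite mulfE vE.
Qed.

Lemma mulfB u v : mulf S (u - v) = mulf S u - mulf S v.
Proof. by apply: ell2P => x; rewrite !ell2E !mulfE !ell2E mulrBr. Qed.

Lemma mulf_dot_ge (a : R) u : (forall x, a <= S x) -> a * sqn u <= dot (mulf S u) u.
Proof.
move=> aS; rewrite -subr_ge0 -dotZl -dotBl.
set w := mulf S u - a%:C *: u.
have wE x : w x = (S x - a)%:C * u x.
  by rewrite /w !ell2E mulfE rmorphB mulrBl.
clearbody w.
rewrite dot_ell2E /ell2_dot divr_ge0// subr_ge0.
rewrite -!nrm_nsq ler_sqr ?nnegrE ?nrm_ge0//; apply: nrm_le_pointwise => x.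
rewrite !ell2E wE; have := aS x; case: (u x) => c d; rewrite /abs2 /= => h.
rewrite -subr_ge0; set s := S x - a; have s0 : 0 <= s by rewrite subr_ge0.
have -> : (s * c - 0 * d + c) ^+ 2 + (s * d + 0 * c + d) ^+ 2 -
  ((s * c - 0 * d - c) ^+ 2 + (s * d + 0 * c - d) ^+ 2) = 4 * s * (c ^+ 2 + d ^+ 2) by ring.
by rewrite !mulr_ge0// addr_ge0 ?sqr_ge0.
Qed.

End bounded.

Section radial.
Variables (r : R) (r0 : 0 < r).

Definition rmax u : R := Num.max (nrm u) r.

Lemma rmax_gt0 u : 0 < rmax u.
Proof. by rewrite /rmax lt_max r0 orbT. Qed.

Lemma nrm_le_rmax u : nrm u <= rmax u.
Proof. by rewrite le_max lexx. Qed.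

Lemma r_le_rmax u : r <= rmax u.
Proof. by rewrite le_max lexx orbT. Qed.

Lemma rmax_lip u v : `|rmax u - rmax v| <= nrm (u - v).
Proof.
apply: le_trans (ler_dist_nrm u v); rewrite /rmax.
move: (nrm u) (nrm v) => a b.
have := ler_norm (a - b); have := ler_norm (b - a); rewrite (distrC b).
have := normr_ge0 (a - b); move: `|a - b| => d d0 h1 h2.
by case: (leP a r); case: (leP b r) => hb ha; rewrite ler_norml; apply/andP; split; lra.
Qed.

Definition bump u : R := r / rmax u.

Lemma bump_ge0 u : 0 <= bump u.
Proof. by rewrite divr_ge0 ?ltW ?rmax_gt0. Qed.

Lemma bump_le1 u : bump u <= 1.
Proof. by rewrite ler_pdivrMr ?rmax_gt0// mul1r r_le_rmax. Qed.

Lemma bump_slow u v : rmax u * `|bump u - bump v| <= nrm (u - v).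
Proof.
have := rmax_lip v u; have := rmax_gt0 u; have := rmax_gt0 v; have := r_le_rmax v.
rewrite /bump (nrmBC v); move: (rmax u) (rmax v) (nrm _) => a b d rb b0 a0 h.
have -> : r / a - r / b = r / b * ((b - a) / a) by field; rewrite !gt_eqF.
rewrite !normrM !normfV (gtr0_norm a0) (gtr0_norm b0) (gtr0_norm r0).
have -> : a * (r / b * (`|b - a| / a)) = r / b * `|b - a| by field; rewrite !gt_eqF.
by apply: le_trans h; rewrite ler_piMl// ler_pdivrMr// mul1r.
Qed.

Section quotient.
Variables (T : J -> R).
Hypothesis T1 : forall x, `|T x| <= 1.

(** Outside the ball of radius r this depends only on the direction of u, so a bounded displacement
    changes it by O(1/|u|). Dividing by [rmax u] instead of |u| removes the singularity at the
    origin. *)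
Definition ray u : R := dot (mulf T u) u / rmax u ^+ 2.

Let dot_le u v : `|dot (mulf T u) v| <= nrm u * nrm v.
Proof.
have h w : dot (mulf T u) w <= nrm u * nrm w.
  apply: le_trans (cauchy_schwarz _ _) _; rewrite ler_wpM2r ?nrm_ge0//.
  by have := mulf_nrm T1 u; rewrite mul1r.
have := h v; have := h (- v); rewrite dotNr nrmN => a b.
by rewrite ler_norml b andbT lerNl.
Qed.

Lemma ray_bound u : `|ray u| <= 1.
Proof.
rewrite /ray normrM normfV ler_pdivrMr ?normr_gt0 ?expf_neq0 ?gt_eqF ?rmax_gt0//.
rewrite mul1r [leRHS]ger0_norm ?sqr_ge0//; apply: le_trans (dot_le _ _) _.
by rewrite expr2 ler_pM ?nrm_ge0 ?nrm_le_rmax.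
Qed.

(* Normalize u and v to the ball of radius 1 before comparing the quadratic forms. *)
Lemma ray_slow u v : rmax u * `|ray u - ray v| <= 4 * nrm (u - v).
Proof.
pose u' := ((rmax u)^-1)%:C *: u; pose v' := ((rmax v)^-1)%:C *: v.
have mulfZ (c : R) w : mulf T (c%:C *: w) = c%:C *: mulf T w.
  by apply: ell2P => x; rewrite !ell2E !(mulfE T1) !ell2E mulrCA.
have rayE w : ray w = dot (mulf T (((rmax w)^-1)%:C *: w)) (((rmax w)^-1)%:C *: w).
  by rewrite mulfZ dotZl dotZr /ray mulrA -expr2 exprVn mulrC.
have unit w : nrm (((rmax w)^-1)%:C *: w) <= 1.
  rewrite nrmZr gtr0_norm ?invr_gt0 ?rmax_gt0// mulrC ler_pdivrMr ?rmax_gt0//.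
  by rewrite mul1r nrm_le_rmax.
have d1 : `|ray u - ray v| <= 2 * nrm (u' - v').
  rewrite !rayE -/u' -/v'.
  have -> : dot (mulf T u') u' - dot (mulf T v') v' =
      dot (mulf T (u' - v')) u' + dot (mulf T v') (u' - v').
    by rewrite (mulfB T1) dotBl dotBr addrA subrK.
  apply: le_trans (ler_normD _ _) _.
  have := dot_le (u' - v') u'; have := dot_le v' (u' - v').
  have := unit u; have := unit v; rewrite -/u' -/v'.
  have := nrm_ge0 (u' - v'); have := nrm_ge0 u'; have := nrm_ge0 v'.
  move: (nrm u') (nrm v') (nrm (u' - v')) `|dot _ _| `|dot _ _| => a b c x y *; nra.
have d2 : rmax u * nrm (u' - v') <= 2 * nrm (u - v).
  have -> : u' - v' = ((rmax u)^-1)%:C *: (u - v) + ((rmax u)^-1 - (rmax v)^-1)%:C *: v.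
    rewrite /u' /v' scalerBr rmorphB scalerBl addrA subrK//.
  apply: le_trans (ler_wpM2l (ltW (rmax_gt0 u)) (nrmD_le _ _)) _.
  rewrite !nrmZr mulrDr mulrA (gtr0_norm (x := _^-1)) ?invr_gt0 ?rmax_gt0//.
  rewrite mulfV ?gt_eqF ?rmax_gt0// mul1r mulr_natl mulr2n lerD2l.
  have := rmax_lip v u; have := rmax_gt0 u; have := rmax_gt0 v; have := nrm_le_rmax v.
  rewrite (nrmBC v); have := nrm_ge0 v.
  move: (rmax u) (rmax v) (nrm (u - v)) (nrm v) => a b d n n0 nb b0 a0 h.
  have -> : a^-1 - b^-1 = (b - a) / a / b by field; rewrite !gt_eqF.
  rewrite !normrM !normfV (gtr0_norm a0) (gtr0_norm b0).
  have -> : a * (`|b - a| / a / b * n) = `|b - a| * (n / b) by field; rewrite !gt_eqF.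
  by apply: le_trans h; rewrite ler_piMr// ler_pdivrMr// mul1r.
apply: (le_trans (ler_wpM2l (ltW (rmax_gt0 u)) d1)); rewrite mulrCA.
by move: d2; move: (rmax u * _) => ? ?; rewrite -[4]/(2 * 2)%:R natrM -mulrA ler_wpM2l.
Qed.

End quotient.
End radial.
End multiplication.

(** * Obstruction to an invariant mean for the affine action *)

Section affine_certificate.
Variables (R : realType) (G : groupType).
Local Notation H := (ell2 R G).
Implicit Types (b : G -> H).

(* Slowly varying functions witnessing that the affine action of b on l^2(G)
   carries no invariant mean. *)
Definition affine_certificate b (I : finType) (s : I -> G) (q : I -> H -> R) (C c : R) :=
  [/\ forall i u, `|q i u| <= C,
      forall i u v, `|q i u - q i v| <= C * nrm (u - v),
      forall i u v, nrm u * `|q i u - q i v| <= C * nrm (u - v) &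
      forall u, c <= \sum_i (q i u - q i (lreg R (s i)^-1%g u + b (s i)^-1%g))].

Lemma cocycle1 b : cocycle b -> b 1%g = 0.
Proof.
move=> cb; have := cb 1%g 1%g; rewrite mulg1 lreg_id => h.
by apply: (@addrI _ (b 1%g)); rewrite -h addr0.
Qed.

Lemma cocycleV b g : cocycle b -> b g^-1%g = - lreg R g^-1%g (b g).
Proof.
move=> cb; have := cb g^-1%g g; rewrite mulVg cocycle1// => /esym/eqP.
by rewrite addr_eq0 => /eqP.
Qed.

Lemma ray_lreg (r : R) (T : G -> R) g u : (forall x, `|T x| <= 1) ->
  ray r T (lreg R g^-1%g u) = dot (mulf (fun y => T (g^-1 * y)%g) u) u / rmax r u ^+ 2.
Proof.
move=> T1; have rE : rmax r (lreg R g^-1%g u) = rmax r u by rewrite /rmax nrm_lreg.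
rewrite /ray rE.
rewrite (_ : mulf T (lreg R g^-1%g u) = lreg R g^-1%g (mulf (fun y => T (g^-1 * y)%g) u)).
  by rewrite dot_lreg.
apply: ell2P => x; rewrite (mulfE T1) !lregE (mulfE (C := 1)) ?invgK ?mulKg//.
Qed.

(** The rays detect motion far from the origin, where the translation part of the action is
    negligible. They degenerate near the origin, where a bump takes over: unboundedness of b
    supplies an element moving the ball off itself. *)
Lemma affine_certificate_exists b (K : finType) (gamma : K -> G) (T : K -> G -> R) (e : R) :
  cocycle b -> (forall M, exists g, M <= nrm (b g)) -> 0 < e ->
  (forall k x, `|T k x| <= 1) ->
  (forall y, e <= \sum_k (T k y - T k ((gamma k)^-1 * y)%g)) ->
  exists (I : finType) (s : I -> G) (q : I -> H -> R), affine_certificate b s q (4 + e) (e / 8).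
Proof.
move=> cb unb e0 T1 Te.
pose M := \sum_k 4 * nrm (b (gamma k)^-1%g).
have M0 : 0 <= M by apply: sumr_ge0 => k _; rewrite mulr_ge0 ?nrm_ge0.
(* M / r bounds the total effect of the translations on the rays, here at most e/8; r >= 1 turns
   slow variation into a Lipschitz bound. *)
pose r : R := 1 + 8 / e * M.
have r1 : 1 <= r by rewrite lerDl mulr_ge0// divr_ge0// ltW.
have r0 : 0 < r by exact: lt_le_trans r1.
have Mr : M / r <= e / 8.
  rewrite ler_pdivrMr// /r mulrDr mulr1 mulrA (_ : e / 8 * (8 / e) = 1) ?mul1r.
    by rewrite lerDr divr_ge0// ltW.
  by field; rewrite gt_eqF.
(* The inverse of g0 moves the ball of radius r outside the ball of radius 2r, where the bump is at
   most 1/2. *)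
have [g0 bg0] := unb (3 * r).
pose s (i : unit + K) := match i with inl _ => g0 | inr k => gamma k end.
pose q (i : unit + K) : H -> R :=
  match i with inl _ => fun u => e / 2 * bump r u | inr k => ray r (T k) end.
exists (unit + K : finType)%type, s, q.
have slow i u v : rmax r u * `|q i u - q i v| <= (4 + e) * nrm (u - v).
  have d0 := nrm_ge0 (u - v); case: i => [_|k] /=; last first.
    apply: le_trans (ray_slow r0 (T1 k) u v) _.
    by rewrite ler_wpM2r// lerDl ltW.
  rewrite -mulrBr normrM (gtr0_norm (divr_gt0 e0 _))// mulrCA.
  apply: (@le_trans _ _ (e / 2 * nrm (u - v))).
    by rewrite ler_wpM2l ?divr_ge0 ?(ltW e0)// bump_slow.
  by rewrite ler_wpM2r//; lra.
split.
- move=> [_|k] u /=.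
    have h := bump_le1 r0 u; have h0 := bump_ge0 r0 u.
    rewrite ger0_norm; last by apply: mulr_ge0 h0; lra.
    by move: (bump r u) h h0 => x h h0; nra.
  by apply: le_trans (ray_bound r0 (T1 k) u) _; lra.
- move=> i u v; apply: le_trans (slow i u v); rewrite ler_peMl//.
  exact: le_trans r1 (r_le_rmax r u).
- move=> i u v; apply: le_trans (slow i u v); rewrite ler_wpM2r//.
  exact: nrm_le_rmax.
move=> u; rewrite big_sumType /= (bigD1 tt)//= big1 ?addr0; last by case.
pose S y := \sum_k (T k y - T k ((gamma k)^-1 * y)%g).
have T1' k x : `|T k ((gamma k)^-1 * x)%g| <= 1 by exact: T1.
have SC y : `|S y| <= \sum_(k : K) 2.
  apply: le_trans (ler_norm_sum _ _ _) _; apply: ler_sum => k _.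
  by apply: le_trans (ler_normB _ _) _; have := T1 k y; have := T1' k y; lra.
have main : e * sqn u / rmax r u ^+ 2 <=
    \sum_k (ray r (T k) u - ray r (T k) (lreg R (gamma k)^-1%g u)).
  have E : \sum_k (mulf (T k) u - mulf (fun y => T k ((gamma k)^-1 * y)%g) u) = mulf S u.
    apply: ell2P => x; rewrite (mulfE SC) /S.
    rewrite (big_morph (fun w : H => w x) (fun _ _ => erefl) erefl).
    rewrite rmorph_sum mulr_suml; apply: eq_bigr => k _.
    by rewrite !ell2E (mulfE (T1 k)) (mulfE (T1' k)) rmorphB mulrBl.
  have -> : \sum_k (ray r (T k) u - ray r (T k) (lreg R (gamma k)^-1%g u)) =
      dot (mulf S u) u / rmax r u ^+ 2.
    rewrite -E (big_morph (fun w : H => dot w u) (fun x y => dotDl x y u) (dot0l u)).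
    rewrite mulr_suml; apply: eq_bigr => k _.
    by rewrite (ray_lreg _ _ _ (T1 k)) dotBl mulrBl.
  rewrite ler_wpM2r ?invr_ge0 ?sqr_ge0//; apply: (mulf_dot_ge SC) => y.
  exact: Te.
have err : \sum_k (ray r (T k) u - ray r (T k) (lreg R (gamma k)^-1%g u)) - e / 8 <=
   \sum_k (ray r (T k) u - ray r (T k) (lreg R (gamma k)^-1%g u + b (gamma k)^-1%g)).
  rewrite lerBlDr; apply: le_trans (lerD (lexx _) Mr).
  rewrite /M mulr_suml -big_split /=; apply: ler_sum => k _.
  pose w := lreg R (gamma k)^-1%g u; pose x := b (gamma k)^-1%g; rewrite -/w -/x.
  have := ray_slow r0 (T1 k) w (w + x).
  rewrite opprD addrA subrr add0r nrmN => h.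
  have : r * `|ray r (T k) w - ray r (T k) (w + x)| <= 4 * nrm x.
    by apply: le_trans h; rewrite ler_wpM2r// r_le_rmax.
  rewrite mulrC -ler_pdivlMr// ler_norml => /andP[h1 h2].
  by move: h1 h2; move: (ray _ _ _) (ray _ _ _) (ray _ _ _) (_ / r) => *; lra.
have bump0 := bump_ge0 r0 (lreg R g0^-1%g u + b g0^-1%g).
have bump1 := bump_le1 r0 (lreg R g0^-1%g u + b g0^-1%g).
have nrmE : nrm (lreg R g0^-1%g u + b g0^-1%g) = nrm (u - b g0).
  by rewrite cocycleV// -linearB nrm_lreg.
set B := bump r (_ + _) in bump0 bump1 *.
(* Inside the ball the bump gains at least e/4 against the error e/8. Outside, the rays gain at
   least 7e/8 against a loss of at most e/2 from the bump. *)
have [ur|ru] := leP (nrm u) r.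
  have uE : rmax r u = r by rewrite /rmax; apply/max_idPr.
  have -> : bump r u = 1 by rewrite /bump uE mulfV// gt_eqF.
  have B2 : B <= 2^-1.
    rewrite /B /bump ler_pdivrMr ?rmax_gt0// mulrC ler_pdivlMr//.
    apply: le_trans (nrm_le_rmax _ _); rewrite nrmE.
    by have := nrmB_le (b g0) u 0; rewrite !subr0 (nrmBC (b g0)); lra.
  have : 0 <= e * sqn u / rmax r u ^+ 2.
    by rewrite divr_ge0 ?sqr_ge0// mulr_ge0 ?dot_ge0// ltW.
  move: main err; move: (_ / _ ^+ 2) (\sum_(_ | _) _) (\sum_(_ | _) _) => x y z.
  move=> h1 h2 h3; nra.
have uE : rmax r u = nrm u by rewrite /rmax; apply/max_idPl; exact: ltW.
have u0 : 0 < nrm u by exact: lt_trans ru.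
have E1 : e * sqn u / rmax r u ^+ 2 = e.
  by rewrite uE -nrm_sqr mulfK// expf_neq0// gt_eqF.
have := bump_ge0 r0 u; move: main err; rewrite E1.
move: (\sum_(_ | _) _) (\sum_(_ | _) _) (bump r u) => y z x h1 h2 h3; nra.
Qed.

End affine_certificate.

(** * Averaging along the exhaustion *)

Section null_sequences.
Variable R : realType.
Implicit Types (a : nat -> R).

(** One-sided on purpose: these sequences serve as upper bounds for errors. *)
Definition null a := forall e : R, 0 < e -> exists n0 : nat, forall n, (n0 <= n)%N -> a n <= e.

Lemma nullD a1 a2 : null a1 -> null a2 -> null (fun n => a1 n + a2 n).
Proof.
move=> h1 h2 e e0; have [n1 hn1] := h1 (e / 2) ltac:(lra).
have [n2 hn2] := h2 (e / 2) ltac:(lra).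
exists (maxn n1 n2) => n; rewrite geq_max => /andP[/hn1 x /hn2 y]; lra.
Qed.

Lemma nullZ (c : R) a : 0 <= c -> null a -> null (fun n => c * a n).
Proof.
move=> c0 h e e0; have c1 : 0 < c + 1 by lra.
have [n0 hn] := h (e / (c + 1)) (divr_gt0 e0 c1); exists n0 => n nn.
apply: le_trans (ler_wpM2l c0 (hn n nn)) _.
by rewrite mulrA ler_pdivrMr// mulrC ler_wpM2l ?(ltW e0)// lerDl.
Qed.

Lemma null_sum (I : finType) (a : I -> nat -> R) : (forall i, null (a i)) ->
  null (fun n => \sum_i a i n).
Proof.
move=> h; elim: (index_enum I) => [|i s IH].
  by move=> e e0; exists 0%N => n _; rewrite big_nil ltW.
move=> e e0; have [n0 hn] := nullD (h i) IH e0; exists n0 => n nn.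
by rewrite big_cons; exact: hn.
Qed.

Lemma null_tail a1 a2 (n1 : nat) : null a1 -> null (fun n => if (n < n1)%N then a2 n else a1 n).
Proof.
move=> h e e0; have [n0 hn] := h e e0; exists (maxn n0 n1) => n.
by rewrite geq_max => /andP[nn n1n]; rewrite ltnNge n1n /=; exact: hn.
Qed.

Lemma null_inv : null (fun n => n.+1%:R^-1).
Proof.
move=> e e0; exists (Num.truncn e^-1) => n nn.
rewrite invf_ple ?posrE ?ltr0n//.
apply: le_trans (ltW (truncnS_gt _)) _; by rewrite ler_nat.
Qed.

Lemma null_sqrt a : (forall n, 0 <= a n) -> null a -> null (fun n => Num.sqrt (a n)).
Proof.
move=> a0 h e e0; have [n0 hn] := h (e ^+ 2) (exprn_gt0 _ e0); exists n0 => n nn.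
by rewrite -(ger0_norm (ltW e0)) -sqrtr_sqr ler_wsqrtr// hn.
Qed.

Lemma cesaro a (e : R) : null a -> 0 < e -> exists n0 : nat, forall n, (n0 <= n)%N ->
  forall m, (m <= n)%N -> \sum_(k < m) a k <= e * n%:R.
Proof.
move=> h e0; have [n0 hn] := h (e / 2) ltac:(lra).
pose A := \sum_(k < n0) `|a k|.
have A0 : 0 <= A by apply: sumr_ge0.
exists (Num.truncn (A / (e / 2))).+1 => n nn m mn.
have An : A <= e / 2 * n%:R.
  rewrite mulrC -ler_pdivrMr; last by lra.
  by apply: le_trans (ltW (truncnS_gt _)) _; rewrite ler_nat.
apply: (@le_trans _ _ (A + e / 2 * m%:R)); last first.
  have : e / 2 * m%:R <= e / 2 * n%:R by rewrite ler_wpM2l ?ler_nat// ltW ?divr_gt0.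
  by move=> h2; rewrite [in leRHS](splitr e) mulrDl; exact: lerD.
elim: m {mn} => [|m IH]; first by rewrite big_ord0 mulr0 addr0.
have [mn0|n0m] := ltnP m n0; last first.
  by rewrite big_ord_recr /= -(natr1 m) mulrDr mulr1 addrA lerD// hn.
apply: (@le_trans _ _ A); last first.
  by rewrite lerDl mulr_ge0 ?ler0n//; lra.
rewrite /A -(subnKC mn0) big_split_ord /= -[leLHS]addr0 lerD//.
  by apply: ler_sum => k _; exact: ler_norm.
by apply: sumr_ge0.
Qed.

End null_sequences.

Section filtration.
Variables (R : realType) (G : groupType).
Local Notation H := (ell2 R G).

(** If Z carries all but e of xi, translation by h brings that mass into X only when h lies in X
    Z^-1. *)
Lemma trunc_lreg_vanish (X : {fset G}) (xi : H) (e : R) : 0 < e ->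
  exists Y : {fset G}, forall h, h \notin Y -> nrm (trunc (mem X) (lreg R h xi)) <= e.
Proof.
move=> e0; have [Z hZ] := trunc_tail xi e0.
exists [fset (x * z^-1)%g | x in X, z in Z]%fset => h hY.
apply: le_trans (hZ (mem Z) (fun _ => id)); rewrite -(nrm_lreg h (xi - _)).
apply: nrm_le_pointwise => x; rewrite truncE; case: ifP => xX; last by rewrite abs2_0 abs2_ge0.
rewrite [in leRHS]lregE subr_trunc; rewrite truncE lregE.
case: ifP => //; rewrite /= => /negbFE hxZ; case/negP: hY.
apply/imfset2P; exists x => //; exists (h^-1 * x)%g => //.
by rewrite invgM invgK mulVKg.
Qed.

(** A diagonal construction: X_(n+1) absorbs the products of X_n with the n-th set F_n of an
    exhaustion, and the finitely many h that violate the smallness on X_n for some t in F_n. Each g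
    or t is served from the stage at which it enters F. *)
Lemma filtration_exists (b : G -> H) : countable [set: G] -> exists X : nat -> {fset G},
  [/\ forall n, (X n `<=` X n.+1)%fset,
      forall g, exists n0 : nat, forall n, (n0 <= n)%N -> forall x, x \in X n ->
        ((g * x)%g \in X n.+1) && ((x * g)%g \in X n.+1),
      forall t, exists n0 : nat, forall n, (n0 <= n)%N -> forall h, h \notin X n.+1 ->
        nrm (trunc (mem (X n)) (lreg R h (b t))) <= n.+1%:R^-1 &
      forall g, exists n, g \in X n].
Proof.
move=> cG; have [F [Fmono Fexh]] := exhaustion cG.
have bad n (X : {fset G}) (s : seq G) : exists Y : {fset G}, forall t, t \in s ->
    forall h, h \notin Y -> nrm (trunc (mem X) (lreg R h (b t))) <= n.+1%:R^-1.
  elim: s => [|t s [Y hY]]; first by exists fset0.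
  have [Z hZ] := @trunc_lreg_vanish X (b t) n.+1%:R^-1 ltac:(by rewrite invr_gt0 ltr0n).
  exists (Y `|` Z)%fset => t'; rewrite inE => /predU1P[->|ts] h;
    rewrite inE negb_or => /andP[hY' hZ']; [exact: hZ | exact: (hY _ ts)].
have /choice[f hf] : forall nX : nat * {fset G}, exists X' : {fset G},
    [/\ (nX.2 `<=` X')%fset, (F nX.1 `<=` X')%fset,
      forall g x, g \in F nX.1 -> x \in nX.2 -> ((g * x)%g \in X') && ((x * g)%g \in X') &
      forall t, t \in F nX.1 -> forall h, h \notin X' ->
        nrm (trunc (mem nX.2) (lreg R h (b t))) <= nX.1.+1%:R^-1].
  move=> [n X] /=; have [Y hY] := bad n X (F n).
  exists (X `|` F n `|` [fset (g * x)%g | g in F n, x in X]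
    `|` [fset (x * g)%g | g in F n, x in X] `|` Y)%fset; split.
  - by apply/fsubsetP => x xX; rewrite !inE xX.
  - by apply/fsubsetP => x xX; rewrite !inE xX orbT.
  - move=> g x gF xX; apply/andP; split; rewrite !inE; apply/orP; left.
      by apply/orP; left; apply/orP; right; apply/imfset2P; exists g => //; exists x.
    by apply/orP; right; apply/imfset2P; exists g => //; exists x.
  - by move=> t tF h; rewrite !inE !negb_or => /andP[_ hhY]; exact: hY.
pose X := fix X n := if n is n'.+1 then f (n', X n') else fset0.
have step n := hf (n, X n); rewrite /= in step.
have FX g : exists n0 : nat, forall n, (n0 <= n)%N -> g \in F n.
  by have [n0 gF] := Fexh g; exists n0 => n nn; apply: (fsubsetP (Fmono _ _ nn)).
exists X; split.
- by move=> n; have [] := step n.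
- move=> g; have [n0 hn] := FX g; exists n0 => n nn x xX.
  by have [_ _ h _] := step n; apply: h => //; exact: hn.
- move=> t; have [n0 hn] := FX t; exists n0 => n nn h hX.
  by have [_ _ _ h'] := step n; apply: h' => //; exact: hn.
- move=> g; have [n gF] := Fexh g; exists n.+1.
  by have [_ h _ _] := step n; apply: (fsubsetP h).
Qed.

End filtration.

Section interpolation.
Variables (R : realType) (J : choiceType).
Local Notation H := (ell2 R J).
Implicit Types (u v : H) (P : pred J).

(* Near the origin, q u is replaced by q (trunc P u). *)
Definition interp (r : R) P (q : H -> R) u := (1 - bump r u) * q u + bump r u * q (trunc P u).

Variables (r C : R) (q : H -> R).
Hypotheses (r0 : 0 < r) (qC : forall u, `|q u| <= C).
Hypothesis qlip : forall u v, `|q u - q v| <= C * nrm (u - v).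

Lemma interp_bound P u : `|interp r P q u| <= C.
Proof.
have h0 := bump_ge0 r0 u; have h1 := bump_le1 r0 u; have := qC u; have := qC (trunc P u).
rewrite /interp; move: (bump r u) (q u) (q _) h0 h1 => x y z h0 h1 hz hy.
apply: le_trans (ler_normD _ _) _; rewrite !normrM (ger0_norm h0) (@ger0_norm _ (1 - x)) ?subr_ge0//.
nra.
Qed.

Lemma bump_lip u v : `|bump r u - bump r v| <= nrm (u - v) / r.
Proof.
rewrite ler_pdivlMr// mulrC; apply: le_trans (bump_slow r0 u v).
by rewrite ler_wpM2r// r_le_rmax.
Qed.

(** The weight of q u vanishes for |u| <= r, and beyond r slow variation yields 1/r; the weights
    themselves are 1/r-Lipschitz. Only the truncated part sees the Lipschitz bound of q, and there
    the displacement is truncated too. *)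
Lemma interp_lip P u v : (forall u v, nrm u * `|q u - q v| <= C * nrm (u - v)) ->
  `|interp r P q v - interp r P q u| <= 3 * C * nrm (v - u) / r + C * nrm (trunc P (v - u)).
Proof.
move=> qslow; have C0 : 0 <= C := le_trans (normr_ge0 _) (qC u).
have -> : interp r P q v - interp r P q u = (1 - bump r u) * (q v - q u)
    + (bump r u - bump r v) * (q v - q (trunc P v))
    + bump r u * (q (trunc P v) - q (trunc P u)) by rewrite /interp; ring.
have e1 : `|(1 - bump r u) * (q v - q u)| <= C * nrm (v - u) / r.
  have [ur|ru] := leP (nrm u) r.
    have -> : bump r u = 1 by rewrite /bump /rmax (max_idPr ur) mulfV// gt_eqF.
    by rewrite subrr mul0r normr0 divr_ge0 ?mulr_ge0 ?nrm_ge0// ltW.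
  rewrite ler_pdivlMr// normrM ger0_norm ?subr_ge0 ?bump_le1// nrmBC.
  apply: le_trans (qslow u v); rewrite mulrC mulrA distrC ler_wpM2r//.
  apply: le_trans (ltW ru); rewrite ler_piMr ?(ltW r0)//.
  by rewrite gerBl bump_ge0.
have e2 : `|(bump r u - bump r v) * (q v - q (trunc P v))| <= 2 * C * nrm (v - u) / r.
  rewrite normrM mulrC (mulrC 2) -!mulrA (mulrA C); apply: ler_pM => //.
    by apply: le_trans (ler_normB _ _) _; have := qC v; have := qC (trunc P v); lra.
  by rewrite nrmBC bump_lip.
have e3 : `|bump r u * (q (trunc P v) - q (trunc P u))| <= C * nrm (trunc P (v - u)).
  rewrite normrM ger0_norm ?bump_ge0// truncB.
  apply: le_trans (qlip _ _); rewrite ler_piMl//; exact: bump_le1.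
apply: le_trans (ler_normD _ _) _; apply: lerD e3.
apply: le_trans (ler_normD _ _) _; apply: le_trans (lerD e1 e2) _.
by rewrite le_eqVlt -!mulrA; apply/orP; left; apply/eqP; ring.
Qed.

End interpolation.

Section interpolation_action.
Variables (R : realType) (G : groupType).
Local Notation H := (ell2 R G).
Implicit Types (u v : H) (g : G) (P Q : pred G).

Lemma trunc_lreg_comm g P Q u : (forall y, P y != P (g * y)%g -> Q y) ->
  nrm (trunc P (lreg R g u) - lreg R g (trunc P u)) <= nrm (trunc Q u).
Proof.
move=> PQ; rewrite -(nrm_lreg g (trunc Q u)); apply: nrm_le_pointwise => x.
rewrite ell2ED ell2EN [lreg R g (trunc P u) x]lregE [lreg R g (trunc Q u) x]lregE !truncE lregE.
have := PQ (g^-1 * x)%g; rewrite mulVKg.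
case: (P x); case: (P (g^-1 * x)%g) => h; rewrite ?(h isT) ?subrr ?sub0r ?subr0 ?abs2_0 ?abs2_ge0//.
by case: (u _) => y z; rewrite /abs2 /= !sqrrN.
Qed.

(** The first two terms are a convex combination of increments of q under the affine map at u and at
    its truncation. The rest is the price of letting truncation and the affine map trade places. *)
Lemma interp_act (r C : R) (q : H -> R) P g u v : 0 < r -> (forall u, `|q u| <= C) ->
  (forall u v, `|q u - q v| <= C * nrm (u - v)) ->
  (1 - bump r u) * (q u - q (lreg R g u + v))
    + bump r u * (q (trunc P u) - q (lreg R g (trunc P u) + v))
    - (2 * C * nrm v / r + C * nrm (v - trunc P v)
       + C * (bump r u * nrm (trunc P (lreg R g u) - lreg R g (trunc P u)))) <=
  interp r P q u - interp r P q (lreg R g u + v).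
Proof.
move=> r0 qC qlip; have C0 : 0 <= C := le_trans (normr_ge0 _) (qC u).
set w := lreg R g u + v; set x := lreg R g (trunc P u) + v.
have b0 := bump_ge0 r0 u; have b1 := bump_le1 r0 u.
have e1 : `|(bump r u - bump r w) * (q (trunc P w) - q w)| <= 2 * C * nrm v / r.
  have bE : bump r u = bump r (lreg R g u) by rewrite /bump /rmax nrm_lreg.
  rewrite normrM mulrC -!mulrA mulrA; apply: ler_pM => //.
    by apply: le_trans (ler_normB _ _) _; have := qC w; have := qC (trunc P w); lra.
  rewrite bE; apply: le_trans (bump_lip r0 _ _) _.
  by rewrite /w opprD addrA subrr add0r nrmN.
have e2 : `|bump r u * (q x - q (trunc P w))| <= C * nrm (v - trunc P v)
     + C * (bump r u * nrm (trunc P (lreg R g u) - lreg R g (trunc P u))).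
  rewrite normrM ger0_norm//; apply: le_trans (ler_wpM2l b0 (qlip _ _)) _.
  have : nrm (x - trunc P w) <= nrm (v - trunc P v)
      + nrm (trunc P (lreg R g u) - lreg R g (trunc P u)).
    rewrite (nrmBC (trunc P (lreg R g u))); apply: le_trans (nrmD_le _ _); rewrite le_eqVlt; apply/orP; left.
    by rewrite /x /w truncD opprD addrACA addrC.
  move: (nrm_ge0 (v - trunc P v)); move: (nrm _) (nrm (x - _)) (nrm (v - _)) => Z X Y Y0 h.
  have h' := ler_wpM2l (mulr_ge0 b0 C0) h.
  have : bump r u * (C * Y) <= C * Y by rewrite ler_piMl// mulr_ge0.
  by move: h'; move: (bump r u) => t; lra.
have -> : interp r P q u - interp r P q w = (1 - bump r u) * (q u - q w)
    + bump r u * (q (trunc P u) - q x) + (bump r u * (q x - q (trunc P w))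
    + (bump r u - bump r w) * (q (trunc P w) - q w)) by rewrite /interp; ring.
move: e1 e2; rewrite !ler_norml => /andP[h1 _] /andP[h2 _]; move: h1 h2.
move: (2 * C * _ / r) (C * nrm _) (C * (_ * _)) ((1 - bump r u) * _) => t1 t2 t3 t4.
move: (_ * (q (trunc P u) - _)) (_ * (q x - _)) (_ * (_ - q w)) => t5 t6 t7; lra.
Qed.

(* A point lies in at most two of the shells. *)
Lemma trunc_shells (X : nat -> {fset G}) u N : (forall n, (X n `<=` X n.+1)%fset) ->
  \sum_(n < N) nrm (trunc [pred x | (x \in X n.+2) && (x \notin X n)] u) ^+ 2 <= 2 * nrm u ^+ 2.
Proof.
move=> Xmono; pose s n := nrm (trunc (mem (X n)) u) ^+ 2.
have su n : s n <= nrm u ^+ 2 by rewrite ler_sqr ?nnegrE ?nrm_ge0// trunc_le.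
have E n : nrm (trunc [pred x | (x \in X n.+2) && (x \notin X n)] u) ^+ 2 = s n.+2 - s n.
  have XX x : x \in X n -> x \in X n.+2 by move=> /(fsubsetP (Xmono n))/(fsubsetP (Xmono n.+1)).
  apply/eqP; rewrite eq_sym subr_eq addrC /s !nrm_nsq (nsq_truncC (mem (X n)) (trunc (mem (X n.+2)) u)).
  apply/eqP; congr (_ + _); apply: (congr1 (@nsq R G)); apply: ell2P => x; rewrite !truncE /=.
    by case: ifP => // /XX ->.
  by rewrite andbC; case: (x \in X n).
suff : \sum_(n < N) nrm (trunc [pred x | (x \in X n.+2) && (x \notin X n)] u) ^+ 2 <= s N + s N.+1.
  by move=> h; apply: le_trans h _; have := su N; have := su N.+1; lra.
elim: N => [|N IH]; first by rewrite big_ord0 addr_ge0 ?sqr_ge0.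
rewrite big_ord_recr /= E; apply: le_trans (lerD IH (lexx _)) _.
by rewrite le_eqVlt; apply/orP; left; apply/eqP; ring.
Qed.

(** Since [bump] times |u| is at most the radius, the weights compensate the size of u: the bound
    does not depend on u, hence later not on h. *)
Lemma bump_energy (X : nat -> {fset G}) (r : nat -> R) u N : (forall n, (X n `<=` X n.+1)%fset) ->
  (forall n, 0 < r n) -> (forall n, r n <= r n.+1) ->
  \sum_(n < N) (bump (r n) u * nrm (trunc [pred x | (x \in X n.+2) && (x \notin X n)] u)) ^+ 2
    <= 2 * r N ^+ 2.
Proof.
move=> Xmono r0 rmono; pose d n := nrm (trunc [pred x | (x \in X n.+2) && (x \notin X n)] u).
have [u0|u0] := eqVneq (nrm u) 0.
  rewrite big1 => [|n _]; first by rewrite mulr_ge0 ?sqr_ge0.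
  apply/eqP; rewrite sqrf_eq0 mulf_eq0; apply/orP; right.
  by rewrite eq_le nrm_ge0 andbT -u0 trunc_le.
have up : 0 < nrm u ^+ 2 by rewrite exprn_gt0// lt_neqAle eq_sym u0 nrm_ge0.
rewrite -(ler_pM2r up) mulr_suml.
have rN n : (n <= N)%N -> r n <= r N.
  elim: N => [|N IH]; first by rewrite leqn0 => /eqP ->.
  by rewrite leq_eqVlt => /predU1P[->//|/IH h]; exact: le_trans h (rmono N).
apply: (@le_trans _ _ (\sum_(n < N) r N ^+ 2 * d n ^+ 2)); last first.
  rewrite -mulr_sumr; have := ler_wpM2l (sqr_ge0 (r N)) (trunc_shells u N Xmono).
  by rewrite mulrA (mulrC (_ ^+ 2) 2).
apply: ler_sum => n _; rewrite -!exprMn mulrAC -/(d n).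
have d0 : 0 <= d n by exact: nrm_ge0.
have b0 := bump_ge0 (r0 n) u.
rewrite ler_sqr ?nnegrE; first last.
- exact: mulr_ge0 (ltW (r0 N)) d0.
- exact: mulr_ge0 (mulr_ge0 b0 (nrm_ge0 u)) d0.
apply: ler_wpM2r => //.
apply: le_trans (rN n (ltnW (ltn_ord n))).
rewrite /bump mulrAC ler_pdivrMr; last exact: rmax_gt0.
by apply: ler_wpM2l; [exact: ltW|exact: nrm_le_rmax].
Qed.

End interpolation_action.

Section level_average.
Variables (R : realType).

Lemma sum_bound (a : nat -> R) (C : R) m : (forall n, `|a n| <= C) ->
  `|\sum_(n < m) a n| <= C * m%:R.
Proof.
move=> aC; apply: le_trans (ler_norm_sum _ _ _) _.
apply: (@le_trans _ _ (\sum_(n < m) C)); first by apply: ler_sum.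
by rewrite sumr_const card_ord mulr_natr.
Qed.

Lemma sum_dist (a : nat -> R) (C : R) j k : (forall n, `|a n| <= C) ->
  (j <= k.+1)%N -> (k <= j.+1)%N -> `|\sum_(n < j) a n - \sum_(n < k) a n| <= C.
Proof.
move=> aC jk kj; have C0 : 0 <= C := le_trans (normr_ge0 _) (aC 0%N).
have [h|h|->] := ltngtP j k; last by rewrite subrr normr0.
  have -> : k = j.+1 by apply/eqP; rewrite eqn_leq kj h.
  by rewrite big_ord_recr /= opprD addrA subrr add0r normrN.
have -> : j = k.+1 by apply/eqP; rewrite eqn_leq jk h.
by rewrite big_ord_recr /= addrAC subrr add0r.
Qed.

(** Neighbouring levels give sums differing by at most one term and normalizations differing by a
    relative 1/k, so translating h costs only O(1/k) through the change of level. *)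
Lemma window_dist (a : nat -> R) (C : R) m k : (forall n, `|a n| <= C) ->
  (m <= k.+1)%N -> (k <= m.+1)%N ->
  `|(\sum_(n < m.-2) a n) / m.+1%:R - (\sum_(n < k.-2) a n) / k.+1%:R| <= 2 * C / k.+1%:R.
Proof.
move=> aC mk km; have C0 : 0 <= C := le_trans (normr_ge0 _) (aC 0%N).
set S := \sum_(n < m.-2) a n; set T := \sum_(n < k.-2) a n.
have m0 : 0 < m.+1%:R :> R by rewrite ltr0n.
have k0 : 0 < k.+1%:R :> R by rewrite ltr0n.
have ST : `|S - T| <= C.
  have pred2 i j : (i <= j.+1 -> i.-2 <= j.-2.+1)%N.
    by move: i j => [|[|i]] [|[|j]] //; rewrite !ltnS leqn0 => /eqP ->.
  by apply: sum_dist => //; exact: pred2.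
have SC : `|S / m.+1%:R| <= C.
  rewrite normrM normfV (gtr0_norm m0) ler_pdivrMr//.
  apply: le_trans (sum_bound _ aC) _; apply: ler_wpM2l => //.
  by rewrite ler_nat (leq_trans (leq_pred _)) ?(leq_trans (leq_pred _)).
have km1 : `|k%:R - m%:R| <= 1 :> R.
  rewrite ler_norml; apply/andP; split.
    by rewrite lerBrDr addrC lerBlDr natr1 ler_nat.
  by rewrite lerBlDr addrC natr1 ler_nat.
have -> : S / m.+1%:R - T / k.+1%:R = (S - T + S / m.+1%:R * (k%:R - m%:R)) / k.+1%:R.
  rewrite -[k.+1%:R]natr1 -[m.+1%:R]natr1; move: m0 k0; rewrite -!natr1.
  by move=> m0 k0; field; rewrite !gt_eqF.
rewrite normrM normfV (gtr0_norm k0); apply: ler_wpM2r; first by rewrite invr_ge0 ltW.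
apply: le_trans (ler_normD _ _) _; rewrite normrM.
have : `|S / m.+1%:R| * `|k%:R - m%:R| <= C * 1 by apply: ler_pM.
by move: ST; move: (`|S - T|) (_ * _) => x y; lra.
Qed.

End level_average.

(** * The averaged functions on G *)

Section averaging.
Variables (R : realType) (G : groupType).
Local Notation H := (ell2 R G).
Variables (b : G -> H) (I : finType) (s : I -> G) (q : I -> H -> R) (C c : R).
Hypotheses (cb : cocycle b) (C0 : 0 <= C) (c0 : 0 < c) (cert : affine_certificate b s q C c).
Variable X : nat -> {fset G}.
Hypothesis Xmono : forall n, (X n `<=` X n.+1)%fset.
Hypothesis Xmul : forall g, exists n0 : nat, forall n, (n0 <= n)%N -> forall x, x \in X n ->
  ((g * x)%g \in X n.+1) && ((x * g)%g \in X n.+1).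
Hypothesis Xvanish : forall t, exists n0 : nat, forall n, (n0 <= n)%N -> forall h, h \notin X n.+1 ->
  nrm (trunc (mem (X n)) (lreg R h (b t))) <= n.+1%:R^-1.
Hypothesis Xexh : forall g, exists n, g \in X n.

Let qC i u : `|q i u| <= C. Proof. by have [h _ _ _] := cert. Qed.
Let qlip i u v : `|q i u - q i v| <= C * nrm (u - v). Proof. by have [_ h _ _] := cert. Qed.
Let qslow i u v : nrm u * `|q i u - q i v| <= C * nrm (u - v).
Proof. by have [_ _ h _] := cert. Qed.

Let level h := ex_minn (Xexh h).
(** The fourth root tends to infinity, while its square, which bounds the energy of the shells, is
    o(n). *)
Let rad (n : nat) : R := Num.sqrt (Num.sqrt n.+1%:R).
Let qn n i h := interp (rad n) (mem (X n.+1)) (q i) (b h).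
(** The range n < level - 2 ensures that h is outside X_(n+2), as the smallness of lambda_h b(t) on
    X_(n+1) requires; dividing by level + 1 avoids a zero denominator. *)
Let Q i h := (\sum_(n < (level h).-2) qn n i h) / (level h).+1%:R.

Let rad_gt0 n : 0 < rad n. Proof. by rewrite !sqrtr_gt0 ltr0n. Qed.

Let rad_mono n : rad n <= rad n.+1. Proof. by rewrite !ler_wsqrtr// ler_nat. Qed.

Let null_rad (a : R) : 0 <= a -> null (fun n => a / rad n).
Proof.
move=> a0; apply: nullZ => // e e0.
have inv0 (n : nat) : 0 <= n.+1%:R^-1 :> R by rewrite invr_ge0 ler0n.
have [n0 h] := null_sqrt (fun n => sqrtr_ge0 _) (null_sqrt inv0 (@null_inv R)) e0.
by exists n0 => n /h; rewrite !sqrtrV ?sqrtr_ge0 ?ler0n.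
Qed.

Let Xle m n : (m <= n)%N -> (X m `<=` X n)%fset.
Proof.
elim: n => [|n IH]; first by rewrite leqn0 => /eqP ->.
rewrite leq_eqVlt => /predU1P[->//|/IH h]; exact: fsubset_trans h (Xmono n).
Qed.

Let level_in h : h \in X (level h). Proof. by rewrite /level; case: ex_minnP. Qed.

Let level_le n h : h \in X n -> (level h <= n)%N.
Proof. by rewrite /level; case: ex_minnP => m _; apply. Qed.

Let level_gt n h : h \notin X n -> (n < level h)%N.
Proof.
move=> hX; rewrite ltnNge; apply: contra hX => le.
by apply: (fsubsetP (Xle le)); exact: level_in.
Qed.

Let notin_level n h : (n < level h)%N -> h \notin X n.
Proof. by move=> lt; apply/negP => /level_le; rewrite leqNgt lt. Qed.

Let level_near (f f' : G -> G) (n0 : nat) : cancel f f' ->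
  (forall n, (n0 <= n)%N -> forall x, x \in X n -> (f x \in X n.+1) && (f' x \in X n.+1)) ->
  forall h, h \notin X n0.+1 ->
    (level (f h) <= (level h).+1)%N && (level h <= (level (f h)).+1)%N.
Proof.
move=> fK hf h /level_gt lt; have n0l : (n0 <= level h)%N by rewrite ltnW// ltnW.
apply/andP; split; first by have /andP[/level_le] := hf _ n0l h (level_in h).
rewrite leqNgt; apply/negP => lt2.
(* A level of [f h] below n0 is impossible, as h would then lie in [X n0.+1]. *)
have [n0l'|l'n0] := leqP n0 (level (f h)).
  have /andP[_] := hf _ n0l' _ (level_in (f h)); rewrite fK => /level_le.
  by rewrite leqNgt lt2.
have /andP[_] := hf n0 (leqnn _) (f h) (fsubsetP (Xle (ltnW l'n0)) _ (level_in _)).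
by rewrite fK => /level_le; rewrite leqNgt lt.
Qed.

Let qn_bound n i h : `|qn n i h| <= C.
Proof. exact: interp_bound. Qed.

Let Q_bound i h : `|Q i h| <= C.
Proof.
have l0 : 0 < (level h).+1%:R :> R by rewrite ltr0n.
rewrite normrM normfV (gtr0_norm l0) ler_pdivrMr//.
apply: le_trans (sum_bound _ (fun n => qn_bound n i h)) _; apply: ler_wpM2l => //.
by rewrite ler_nat (leq_trans (leq_pred _)) ?(leq_trans (leq_pred _)).
Qed.

Let Q_window i h h' : (level h' <= (level h).+1)%N -> (level h <= (level h').+1)%N ->
  `|Q i h' - (\sum_(n < (level h).-2) qn n i h') / (level h).+1%:R| <= 2 * C / (level h).+1%:R.
Proof. by move=> h1 h2; apply: (window_dist (fun n => qn_bound n i h')). Qed.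

Let Q_right i t (e : R) : 0 < e ->
  exists Y : {fset G}, forall h, h \notin Y -> `|Q i h - Q i (h * t)%g| <= e.
Proof.
move=> e0; have [n1 hn1] := Xmul t; have [n2 hn2] := Xmul t^-1%g; have [n3 hn3] := Xvanish t.
have near h : h \notin X (maxn n1 n2).+1 ->
    (level (h * t)%g <= (level h).+1)%N && (level h <= (level (h * t)%g).+1)%N.
  apply: (@level_near (fun h => (h * t)%g) (fun h => (h * t^-1)%g)) => [x|n]; first by rewrite mulgK.
  rewrite geq_max => /andP[/hn1 k1 /hn2 k2] x xX.
  by have /andP[_ ->] := k1 _ xX; have /andP[_ ->] := k2 _ xX.
(* Below n3, where t is not yet controlled, the trivial bound is used; finitely many terms do not
   affect Cesaro means. *)
pose a n := if (n < n3)%N then 2 * C else 3 * C * nrm (b t) / rad n + C * n.+1%:R^-1.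
have a_null : null a.
  apply: null_tail; apply: nullD; last exact: nullZ C0 (@null_inv R).
  by apply: null_rad; rewrite !mulr_ge0 ?nrm_ge0.
have step h n : (n < (level h).-2)%N -> `|qn n i h - qn n i (h * t)%g| <= a n.
  move=> lt; rewrite /a; case: ltnP => [_|n3n].
    by apply: le_trans (ler_normB _ _) _; have := qn_bound n i h; have := qn_bound n i (h * t)%g; lra.
  have hX : h \notin X n.+2 by apply: notin_level; rewrite -2!ltn_predRL.
  rewrite distrC; apply: le_trans (interp_lip (rad_gt0 n) (qC i) (qlip i) _ _ _ (qslow i)) _.
  rewrite cb addrAC subrr add0r nrm_lreg lerD2l ler_wpM2l//.
  apply: le_trans (hn3 n.+1 (leqW n3n) h hX) _.
  by rewrite lef_pV2 ?posrE ?ltr0n// ler_nat.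
have [n4 hn4] := cesaro a_null (ltac:(lra) : 0 < e / 2).
have [n5 hn5] := nullZ (mulr_ge0 (ler0n _ 2) C0) (@null_inv R) (ltac:(lra) : 0 < e / 2).
exists (X (maxn (maxn n1 n2).+1 (maxn n4 n5))) => h hX.
have /near/andP[l1 l2] : h \notin X (maxn n1 n2).+1.
  by apply: contra hX; apply: fsubsetP; apply: Xle; rewrite leq_maxl.
have lt := level_gt hX.
have n4l : (n4 <= level h)%N.
  by apply: leq_trans (ltnW lt); rewrite leq_max orbC leq_max leqnn.
have n5l : (n5 <= level h)%N.
  by apply: leq_trans (ltnW lt); rewrite leq_max orbC leq_max leqnn orbT.
have k0 : 0 < (level h).+1%:R :> R by rewrite ltr0n.
have main : `|Q i h - (\sum_(n < (level h).-2) qn n i (h * t)%g) / (level h).+1%:R| <= e / 2.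
  rewrite /Q -mulrBl -sumrB normrM normfV (gtr0_norm k0) ler_pdivrMr//.
  apply: le_trans (ler_norm_sum _ _ _) _.
  apply: (@le_trans _ _ (\sum_(n < (level h).-2) a n)); first by apply: ler_sum => n _; exact: step.
  apply: le_trans (hn4 _ n4l _ _) _; first by rewrite (leq_trans (leq_pred _)) ?leq_pred.
  by rewrite ler_wpM2l ?ler_nat// ltW ?divr_gt0.
have := hn5 _ n5l; have := Q_window i l1 l2; move: main.
rewrite !ler_norml => /andP[h1 h2] /andP[h3 h4] h5; apply/andP.
move: h1 h2 h3 h4 h5; move: (2 * C / _) => y; move: (_ / (level h).+1%:R) => x.
by move: (Q i h) (Q i _) => z w *; split; lra.
Qed.

Let null_trunc (u : H) : null (fun n => nrm (u - trunc (mem (X n.+1)) u)).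
Proof.
move=> e e0; have [Y hY] := trunc_tail u e0.
exists (\max_(y <- Y) level y)%N => n nn; apply: hY => y yY.
apply: (fsubsetP (Xle _) y (level_in y)); apply: leq_trans (leqW nn).
exact: leq_bigmax_seq.
Qed.

Let d h n := bump (rad n) (b h) *
  nrm (trunc [pred x | (x \in X n.+2) && (x \notin X n)] (b h)).

Let d_ge0 h n : 0 <= d h n.
Proof. exact: mulr_ge0 (bump_ge0 (rad_gt0 n) _) (nrm_ge0 _). Qed.

(** Cauchy-Schwarz in the additive form d <= eta + d^2 / eta, with [bump_energy] and [rad N ^+ 2] =
    sqrt(N+1). *)
Let d_sum h N (eta : R) : 0 < eta ->
  \sum_(n < N) d h n <= eta * N%:R + 2 / eta * Num.sqrt N.+1%:R.
Proof.
move=> eta0.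
apply: (@le_trans _ _ (\sum_(n < N) (eta + eta^-1 * d h n ^+ 2))).
  apply: ler_sum => n _; rewrite -(ler_pM2l eta0) mulrDr (mulrA eta eta^-1) mulfV ?gt_eqF// mul1r.
  have := sqr_ge0 (d h n - eta); have := sqr_ge0 eta; have := sqr_ge0 (d h n).
  by move: (d h n) => x; rewrite !expr2; lra.
rewrite big_split /= sumr_const card_ord mulr_natr lerD2l -mulr_sumr.
have := bump_energy (b h) N Xmono rad_gt0 rad_mono; rewrite [rad N ^+ 2]sqr_sqrtr ?sqrtr_ge0// => h'.
rewrite (mulrC 2) -mulrA; apply: ler_wpM2l h'; by rewrite invr_ge0 ltW.
Qed.

Let K := \sum_(i : I) C.

Let K_ge0 : 0 <= K. Proof. exact: sumr_ge0. Qed.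

(** The error splits into a part depending on n alone, which vanishes, and the shell part [d h n],
    which need not be small for a single n and is only controlled after summation. *)
Let step_left : exists2 a : nat -> R, null a & forall h n,
  c - a n - K * d h n <= \sum_i (qn n i h - qn n i ((s i)^-1 * h)%g).
Proof.
have hX g : exists n0 : nat, forall n, (n0 <= n)%N -> forall x, x \in X n ->
    ((g * x)%g \in X n.+1) && ((g^-1 * x)%g \in X n.+1).
  have [n1 h1] := Xmul g; have [n2 h2] := Xmul g^-1%g; exists (maxn n1 n2) => n.
  rewrite geq_max => /andP[/h1 k1 /h2 k2] x xX.
  by have /andP[-> _] := k1 _ xX; have /andP[-> _] := k2 _ xX.
have /choice[m hm] : forall g, exists n0 : nat, forall n, (n0 <= n)%N -> forall x, x \in X n ->
    ((g * x)%g \in X n.+1) && ((g^-1 * x)%g \in X n.+1) := hX.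
pose n1 := (\max_i m (s i)^-1%g)%N.
pose a n := if (n < n1)%N then c + 2 * K else
  \sum_i (2 * C * nrm (b (s i)^-1%g) / rad n
    + C * nrm (b (s i)^-1%g - trunc (mem (X n.+1)) (b (s i)^-1%g))).
exists a.
  apply: null_tail; apply: null_sum => i; apply: nullD; last exact: nullZ C0 (null_trunc _).
  by apply: null_rad; rewrite !mulr_ge0 ?nrm_ge0.
move=> h n; rewrite /a; case: ltnP => [_|n1n].
  apply: (@le_trans _ _ (\sum_(i : I) - (2 * C))).
    rewrite sumrN -mulr_sumr -/K; have := mulr_ge0 K_ge0 (d_ge0 h n).
    by move: (K * d h n) => x; move: K => k; lra.
  apply: ler_sum => i _; have := qn_bound n i h; have := qn_bound n i ((s i)^-1 * h)%g.
  by move: (qn n i h) (qn n i _) => x y; rewrite !ler_norml => /andP[? ?] /andP[? ?]; lra.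
set u := b h; set P := mem (X n.+1); pose be := bump (rad n) u.
have b0 : 0 <= be := bump_ge0 (rad_gt0 n) u.
have b1 : be <= 1 := bump_le1 (rad_gt0 n) u.
have [_ _ _ hc] := cert.
(* The certificate at u with weight 1 - be plus the certificate at [trunc P u] with weight be. *)
have main : c <= \sum_i ((1 - be) * (q i u - q i (lreg R (s i)^-1%g u + b (s i)^-1%g))
   + be * (q i (trunc P u) - q i (lreg R (s i)^-1%g (trunc P u) + b (s i)^-1%g))).
  rewrite big_split /= -!mulr_sumr.
  have h1 : (1 - be) * c <= (1 - be) * \sum_i (q i u - q i (lreg R (s i)^-1%g u + b (s i)^-1%g)).
    by apply: ler_wpM2l => //; rewrite subr_ge0.
  have h2 := ler_wpM2l b0 (hc (trunc P u)).
  apply: le_trans (lerD h1 h2); rewrite -mulrDl subrK mul1r //.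
rewrite -addrA -opprD; apply: le_trans (lerD main (lexx _)) _.
rewrite /K mulr_suml -big_split /= -sumrB; apply: ler_sum => i _.
have -> : qn n i ((s i)^-1 * h)%g = interp (rad n) P (q i) (lreg R (s i)^-1%g u + b (s i)^-1%g).
  by rewrite /qn cb addrC.
apply: le_trans (interp_act P (s i)^-1%g u (b (s i)^-1%g) (rad_gt0 n) (qC i) (qlip i)).
rewrite lerD2l lerN2 lerD2l; apply: ler_wpM2l => //; apply: ler_wpM2l => //.
(* A point whose membership in X_(n+1) changes under the inverse of [s i] lies in X_(n+2) but not in
   X_n. *)
apply: trunc_lreg_comm => y; rewrite /P /=.
have hg := hm (s i)^-1%g; have mn : (m (s i)^-1%g <= n)%N by apply: leq_trans n1n; exact: leq_bigmax.
have Xs x k : x \in X k -> x \in X k.+1 by apply: fsubsetP.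
case: (boolP (y \in X n)) => [yX|_].
  by have /andP[-> _] := hg _ mn _ yX; rewrite Xs.
case: (boolP (y \in X n.+1)) => [/Xs ->//|_].
case: (boolP (_ \in X n.+1)) => // gyX _.
by have /andP[_] := hg _ (leqW mn) _ gyX; rewrite mulKg andbT => ->.
Qed.

Let Q_left : exists M : nat, forall h, h \notin X M ->
  c / 2 <= \sum_i (Q i h - Q i ((s i)^-1 * h)%g).
Proof.
have [a a0 ha] := step_left.
have /choice[m hm] : forall g, exists M : nat, forall h, h \notin X M ->
    (level (g * h)%g <= (level h).+1)%N && (level h <= (level (g * h)%g).+1)%N.
  move=> g; have [n1 h1] := Xmul g; have [n2 h2] := Xmul g^-1%g; exists (maxn n1 n2).+1.
  apply: (@level_near (fun h => (g * h)%g) (fun h => (g^-1 * h)%g)) => [x|n]; first by rewrite mulKg.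
  rewrite geq_max => /andP[/h1 k1 /h2 k2] x xX.
  by have /andP[-> _] := k1 _ xX; have /andP[-> _] := k2 _ xX.
(* The budget, in units of c D: 1/8 for the errors a, 1/8 + 1/8 for the shells by [d_sum], and 1/16
   for the missing three terms and the change of level; more than 1/2 remains. *)
pose eta := c / (8 * (K + 1)).
have K1 : 0 < K + 1 by have := K_ge0; lra.
have eta0 : 0 < eta by rewrite divr_gt0// mulr_gt0.
have Keta : K * eta <= c / 8.
  rewrite /eta mulrA ler_pdivrMr ?mulr_gt0// (_ : c / 8 * (8 * (K + 1)) = c * K + c); last by field.
  by rewrite mulrC lerDl ltW.
have c8 : 0 < c / 8 by rewrite divr_gt0.
have [m1 hm1] := cesaro a0 c8.
have Ke0 : 0 <= K * (2 / eta) by rewrite mulr_ge0// divr_ge0// ltW.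
have inv0 (n : nat) : 0 <= n.+1%:R^-1 :> R by rewrite invr_ge0 ler0n.
have [m2 hm2] := nullZ Ke0 (null_sqrt inv0 (@null_inv R)) c8.
have k30 : 0 <= 2 * K + 3 * c by rewrite addr_ge0 ?mulr_ge0// ltW.
have [m3 hm3] := nullZ k30 (@null_inv R) (ltac:(lra) : 0 < c / 16).
pose m0 := (\max_i m (s i)^-1%g)%N.
exists (maxn m0 (maxn m1 (maxn m2 m3))) => h hX.
have far k : (k <= maxn m0 (maxn m1 (maxn m2 m3)))%N -> h \notin X k.
  by move=> le; apply: contra hX; apply: fsubsetP; exact: Xle.
have lt := ltnW (level_gt hX).
have l1 : (m1 <= level h)%N by apply: leq_trans lt; rewrite !leq_max leqnn !orbT.
have l2 : (m2 <= level h)%N by apply: leq_trans lt; rewrite !leq_max leqnn !orbT.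
have l3 : (m3 <= level h)%N by apply: leq_trans lt; rewrite !leq_max leqnn !orbT.
set D : R := (level h).+1%:R.
have D0 : 0 < D by rewrite ltr0n.
set N := (level h).-2.
have ND : N%:R <= D by rewrite ler_nat (leq_trans (leq_pred _)) ?(leq_trans (leq_pred _)).
have DN : D - 3 <= N%:R.
  by rewrite lerBlDr -natrD ler_nat /N; case: (level h) => [|[|l]]; rewrite //= addn3.
have E1 : \sum_(n < N) a n <= c / 8 * D.
  apply: le_trans (hm1 _ l1 N _) _; first by rewrite (leq_trans (leq_pred _)) ?leq_pred.
  by rewrite ler_wpM2l ?ler_nat// ltW.
have E2 : K * (2 / eta) * Num.sqrt N.+1%:R <= c / 8 * D.
  have sD : 0 < Num.sqrt D by rewrite sqrtr_gt0.
  apply: (@le_trans _ _ (K * (2 / eta) * Num.sqrt D)).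
    apply: ler_wpM2l => //; rewrite ler_wsqrtr// ler_nat.
    by rewrite ltnS (leq_trans (leq_pred _)) ?leq_pred.
  have := hm2 _ l2; rewrite sqrtrV ?(ltW D0)// ler_pdivrMr// => h2.
  have -> : c / 8 * D = c / 8 * Num.sqrt D * Num.sqrt D.
    by rewrite -(mulrA (c / 8)) -expr2 sqr_sqrtr// ltW.
  by apply: ler_wpM2r h2; exact: ltW.
have E3 : 2 * K + 3 * c <= c / 16 * D by have := hm3 _ l3; rewrite ler_pdivrMr.
have E4 : K * \sum_(n < N) d h n <= c / 8 * D + c / 8 * D.
  apply: le_trans (ler_wpM2l K_ge0 (d_sum h N eta0)) _; rewrite mulrDr; apply: lerD.
    by rewrite mulrA; apply: ler_pM Keta ND => //; exact: mulr_ge0 K_ge0 (ltW eta0).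
  by rewrite mulrA.
pose T i h' := \sum_(n < N) qn n i h'.
have E5 : c * N%:R - \sum_(n < N) a n - K * \sum_(n < N) d h n
    <= \sum_i (T i h - T i ((s i)^-1 * h)%g).
  under [leRHS]eq_bigr do rewrite -sumrB.
  rewrite exchange_big /= mulr_sumr mulr_natr -[N in _ *+ N]card_ord -sumr_const -!sumrB.
  by apply: ler_sum => n _; exact: ha.
have E6 : \sum_i (T i h - T i ((s i)^-1 * h)%g) - 2 * K
    <= \sum_i (Q i h - Q i ((s i)^-1 * h)%g) * D.
  rewrite /K mulr_sumr -sumrB; apply: ler_sum => i _.
  have hmi : h \notin X (m (s i)^-1%g).
    apply: far; apply: leq_trans (leq_maxl _ _); exact: leq_bigmax.
  have /andP[w1 w2] := hm _ _ hmi.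
  have := Q_window i w1 w2; rewrite ler_norml => /andP[_].
  rewrite -/N -/(T i _) -/D lerBlDr -mulrDl ler_pdivlMr// => h2.
  have -> : T i h = Q i h * D by rewrite /Q -/N -/(T i h) -/D mulfVK ?gt_eqF.
  by move: h2; rewrite mulrBl; lra.
rewrite -(ler_pM2r D0) mulr_suml; apply: le_trans E6.
move: E1 E3 E4 E5 DN c8; move: (\sum_(n < N) a n) (K * \sum_(n < N) _) (\sum_(_ | _) _) => x y z.
move: (N%:R : R) => w E1 E3 E4 E5 DN c8.
have := ler_wpM2l (ltW c0) DN; have := mulr_ge0 (ltW c0) (ltW D0).
by move: E1 E3 E4 E5; move: (D) (K) => D' K' *; lra.
Qed.

Lemma averaged_certificate : exists f : I -> G -> R,
  [/\ forall i h, `|f i h| <= C,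
      forall i t (e : R), 0 < e ->
        exists Y : {fset G}, forall h, h \notin Y -> `|f i h - f i (h * t)%g| <= e &
      exists Y : {fset G}, forall h, h \notin Y ->
        c / 2 <= \sum_i (f i h - f i ((s i)^-1 * h)%g)].
Proof.
exists Q; split; [exact: Q_bound | exact: Q_right |].
by have [M hM] := Q_left; exists (X M).
Qed.

End averaging.

(** * Invariant means *)

Section invariant_means.
Variables (R : realType) (G : groupType).
Implicit Types (f : G -> R) (S : seq G).

Definition slow f := (exists C : R, forall h, `|f h| <= C) /\
  forall t (e : R), 0 < e ->
    exists Y : {fset G}, forall h, h \notin Y -> `|f h - f (h * t)%g| <= e.

Definition complexify f : G -> R[i] := fun g => (f g)%:C.

Lemma normc_real (x : R) : normc x%:C = `|x|.
Proof. by rewrite /normc /= expr0n /= addr0 sqrtr_sqr. Qed.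

Lemma slow_small f : slow f -> small_at_infinity (complexify f).
Proof.
move=> [[C fC] fs]; split; first by exists C => g; rewrite normc_real.
move=> t e e0; have [Y hY] := fs t (e / 2) ltac:(lra).
apply: sub_finite_set (finite_fset Y) => h /= he; apply: contraPT isT => hh.
have := hY h hh; have : e <= `|f h - f (h * t)%g| by rewrite -normc_real rmorphB.
by move: (`|_|) => x *; lra.
Qed.

Lemma slow_lin (r : R) f1 f2 : slow f1 -> slow f2 -> slow (fun g => r * f1 g + f2 g).
Proof.
move=> [[C1 h1] k1] [[C2 h2] k2]; split.
  exists (`|r| * C1 + C2) => g; apply: le_trans (ler_normD _ _) _.
  by rewrite lerD// normrM ler_wpM2l.
move=> t e e0; have r1 : 0 < `|r| + 1 by rewrite ltr_wpDl.
have [Y1 hY1] := k1 t (e / 2 / (`|r| + 1)) ltac:(by rewrite !divr_gt0).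
have [Y2 hY2] := k2 t (e / 2) ltac:(lra).
exists (Y1 `|` Y2)%fset => h; rewrite inE negb_or => /andP[/hY1 a1 /hY2 a2].
have -> : r * f1 h + f2 h - (r * f1 (h * t)%g + f2 (h * t)%g) =
    r * (f1 h - f1 (h * t)%g) + (f2 h - f2 (h * t)%g) by ring.
apply: le_trans (ler_normD _ _) _; rewrite (splitr e); apply: lerD => //.
rewrite normrM; apply: le_trans (ler_wpM2l (normr_ge0 r) a1) _.
by rewrite mulrCA ler_piMr ?divr_ge0 ?(ltW e0)// ler_pdivrMr// mul1r lerDl.
Qed.

Lemma slow_translate g f : slow f -> slow (fun h => f (g * h)%g).
Proof.
move=> [[C fC] fs]; split; first by exists C.
move=> t e e0; have [Y hY] := fs t e e0.
exists [fset (g^-1 * y)%g | y in Y]%fset => h hh; rewrite mulgA; apply: hY.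
by apply: contra hh => ghY; apply/imfsetP; exists (g * h)%g => //; rewrite mulKg.
Qed.

Lemma slow_seq S : slow (fun g => (g \in S)%:R).
Proof.
split; first by exists 1 => g; rewrite ger0_norm ?ler0n// lern1 leq_b1.
move=> t e e0; exists ([fset x in S] `|` [fset (x * t^-1)%g | x in S])%fset => h.
rewrite inE negb_or => /andP[h1 h2].
have -> : h \in S = false by apply/negbTE; move: h1; rewrite inE.
rewrite (_ : (h * t)%g \in S = false) ?subrr ?normr0 ?ltW//; apply/negbTE.
by apply: contra h2 => hS; apply/imfsetP; exists (h * t)%g => //; rewrite mulgK.
Qed.

Lemma slow_cst (r : R) : slow (fun=> r).
Proof.
split; first by exists `|r|.
by move=> t e e0; exists fset0 => h _; rewrite subrr normr0 ltW.
Qed.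

Variable phi : (G -> R[i]) -> R[i].
Hypothesis phi_state : is_state (@small_at_infinity R G) phi.
Hypothesis phi_inv : forall t (F : G -> R[i]), small_at_infinity F ->
  phi (left_translate t F) = phi F.

Let mean f : R := complex.Re (phi (complexify f)).

Let mean_lin (r : R) f1 f2 : slow f1 -> slow f2 ->
  mean (fun g => r * f1 g + f2 g) = r * mean f1 + mean f2.
Proof.
have [lin _ _] := phi_state.
move=> /slow_small s1 /slow_small s2; have := lin r%:C _ _ s1 s2.
rewrite /mean (_ : _ + complexify f2 = complexify (fun g => r * f1 g + f2 g)).
  by move=> ->; case: (phi _) (phi _) => [a a'] [x x'] /=; rewrite mul0r subr0.
by apply/funext => g; rewrite /complexify rmorphD rmorphM.
Qed.

Let mean_ge0 f : slow f -> (forall g, 0 <= f g) -> 0 <= mean f.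
Proof.
have [_ pos _] := phi_state.
move=> /slow_small sf f0; have := pos _ sf (fun g => ltac:(by rewrite ler0c)).
by rewrite /mean; case: (phi _) => x y; rewrite lecE /= => /andP[].
Qed.

Let mean1 : mean (fun=> 1) = 1.
Proof. by have [_ _ h] := phi_state; rewrite /mean (_ : complexify _ = cst 1) ?h. Qed.

Let mean_translate g f : slow f -> mean (fun h => f (g * h)%g) = mean f.
Proof.
move=> /slow_small sf; rewrite /mean -[in RHS](phi_inv g^-1%g sf); congr (complex.Re (phi _)).
by apply/funext => h; rewrite /complexify /left_translate invgK.
Qed.

Hypothesis G_infinite : forall S, exists g, g \notin S.

Let ind S g : R := (g \in S)%:R.

Let mean_ind S : uniq S -> mean (ind S) = mean (ind [:: 1%g]) *+ size S.
Proof.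
elim: S => [|x S IH] /=.
  have s0 := slow_seq [::]; have := mean_lin 1 s0 s0; rewrite mul1r -/(ind [::]).
  rewrite (_ : (fun g => _) = ind [::]); last by apply/funext => g; rewrite /ind mul1r addr0.
  by move: (mean _) => y; rewrite mulr0n; lra.
move=> /andP[xS /IH E].
have s1 : slow (fun h => ind [:: 1%g] (x^-1 * h)%g) by apply: slow_translate; exact: slow_seq.
have -> : ind (x :: S) = fun g => 1 * ind [:: 1%g] (x^-1 * g)%g + ind S g.
  apply/funext => g; rewrite /ind mul1r !inE -[_ == 1%g](inj_eq (mulgI x)) mulVKg mulg1.
  by have [->|_] := eqVneq g x; rewrite ?(negPf xS) ?addr0 ?add0r.
rewrite mean_lin//; last exact: slow_seq.
by rewrite mul1r E mean_translate ?mulrS//; exact: slow_seq.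
Qed.

(** By left invariance all points have the same mass, and arbitrarily large finite sets have total
    mass at most 1. *)
Let mean_ind0 S : uniq S -> mean (ind S) = 0.
Proof.
have big n : exists2 S' : seq G, uniq S' & size S' = n.
  elim: n => [|n [S' uS' <-]]; first by exists [::].
  by have [g gS'] := G_infinite S'; exists (g :: S') => //=; rewrite gS'.
have z0 : 0 <= mean (ind [:: 1%g]) by apply: mean_ge0 => [|g]; [exact: slow_seq|rewrite ler0n].
suff z : mean (ind [:: 1%g]) = 0 by move=> /mean_ind ->; rewrite z mul0rn.
apply/eqP; rewrite eq_le z0 andbT leNgt; apply/negP => zp.
have [S' uS' sS'] := big (Num.truncn (mean (ind [:: 1%g]))^-1).+1.
have : 0 <= mean (fun g => - 1 * ind S' g + 1).
  apply: mean_ge0 => [|g]; first by apply: slow_lin; [exact: slow_seq|exact: slow_cst].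
  by rewrite mulN1r addrC subr_ge0 lern1 leq_b1.
rewrite mean_lin; [|exact: slow_seq|exact: slow_cst]; rewrite mean1 mean_ind// sS'.
have := truncnS_gt (mean (ind [:: 1%g]))^-1; rewrite -(ltr_pM2r zp) mulVf ?gt_eqF// -[mean _ *+ _]mulr_natr.
have final (n z : R) : 1 < n * z -> 0 <= - 1 * (z * n) + 1 -> False by lra.
exact: final.
Qed.

Lemma no_slow_certificate (I : finType) (s : I -> G) (f : I -> G -> R) (c : R) (Y : {fset G}) :
  (forall i, slow (f i)) -> 0 < c ->
  (forall h, h \notin Y -> c <= \sum_i (f i h - f i ((s i)^-1 * h)%g)) -> False.
Proof.
move=> fs c0 hc; pose D (r : seq I) h := \sum_(i <- r) (f i h - f i ((s i)^-1 * h)%g).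
have DE i r : D (i :: r) = fun h => 1 * f i h + (- 1 * f i ((s i)^-1 * h)%g + D r h).
  by apply/funext => h; rewrite /D big_cons; ring.
have D0 r : slow (D r) /\ mean (D r) = 0.
  elim: r => [|i r [sD mD]].
    have -> : D [::] = ind [::] by apply/funext => h; rewrite /D big_nil.
    by split; [exact: slow_seq|exact: mean_ind0].
  have st := slow_translate (s i)^-1%g (fs i); have sl := slow_lin (- 1) st sD.
  rewrite DE; split; first exact: slow_lin.
  rewrite mean_lin// mean_lin// mD mean_translate//; ring.
have [sD mD] := D0 (index_enum I); have [[M DM] _] := sD.
have M0 : 0 <= M := le_trans (normr_ge0 _) (DM 1%g).
have sY := slow_seq (enum_fset Y); have sc := slow_cst (- c).
have s1 := slow_lin (M + c) sY sc.
(* Adding (M + c) on Y makes the inequality valid everywhere without changing the mean, since finite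
   sets are null; D has mean 0 by invariance, so - c >= 0. *)
have : 0 <= mean (fun g => 1 * D (index_enum I) g + ((M + c) * ind (enum_fset Y) g + - c)).
  apply: mean_ge0 => [|g]; first exact: slow_lin.
  rewrite /ind; case: (boolP (g \in enum_fset Y)) => gY /=.
    by have := DM g; rewrite ler_norml => /andP[+ _]; move: (D _ g) => x; lra.
  by have := hc g gY; rewrite -/(D (index_enum I) g); move: (D _ g) => x; lra.
(* The constant - c is written as a combination of 1 and 0 so that [mean_lin] evaluates it. *)
have -> : (fun g => 1 * D (index_enum I) g + ((M + c) * ind (enum_fset Y) g + - c)) =
    (fun g => 1 * D (index_enum I) g + ((M + c) * ind (enum_fset Y) g + (- c * 1 + ind [::] g))).
  by apply/funext => g; rewrite {3}/ind /= addr0 mulr1.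
have s2 := slow_lin (- c) (slow_cst 1) (slow_seq [::]).
rewrite mean_lin//; last exact: slow_lin.
rewrite mean_lin// mean_lin; [|exact: slow_cst|exact: slow_seq].
by rewrite mD mean1 !mean_ind0 ?fset_uniq//; lra.
Qed.

End invariant_means.

(** * Conclusion for groups with an unbounded cocycle *)

Section unbounded_cocycle.
Variables (R : realType) (G : groupType) (b : G -> ell2 R G).
Hypotheses (cb : cocycle b) (unb : forall M, exists g, M <= nrm (b g)).

Lemma unbounded_infinite (S : seq G) : exists g, g \notin S.
Proof.
have [g hg] := unb (\sum_(x <- S) nrm (b x) + 1); exists g; apply/negP => gS.
move: hg; rewrite (big_rem g)//= => hg.
have : 0 <= \sum_(x <- rem g S) nrm (b x) by apply: sumr_ge0 => x _; exact: nrm_ge0.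
by move: hg; move: (\sum_(_ <- _) _) (nrm _) => x y; lra.
Qed.

Lemma properly_proximal_of_certificate (I : finType) (s : I -> G) (q : I -> ell2 R G -> R) (C c : R) :
  countable [set: G] -> 0 <= C -> 0 < c -> affine_certificate b s q C c -> properly_proximal R G.
Proof.
move=> cG C0 c0 cert; have [X [X1 X2 X3 X4]] := filtration_exists b cG.
have [f [fC fslow [Y hY]]] := averaged_certificate cb C0 c0 cert X1 X2 X3 X4.
move=> [phi [phi_state phi_inv]].
have c2 : 0 < c / 2 by rewrite divr_gt0.
apply: (no_slow_certificate phi_state phi_inv unbounded_infinite _ c2 hY) => i.
by split; [exists C | exact: fslow].
Qed.

Lemma properly_proximal_of_nonfolner : countable [set: G] -> ~ folner R G -> properly_proximal R G.
Proof.
move=> cG nfol; have [K [T [e [e0 T1 Te]]]] := nonfolner_certificate nfol.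
have [I [s [q cert]]] := affine_certificate_exists cb unb e0 T1 Te.
apply: properly_proximal_of_certificate cG _ _ cert; first by rewrite addr_ge0// ltW.
by rewrite divr_gt0.
Qed.

End unbounded_cocycle.

Theorem theorem1p1 (R : realType) (G : groupType)
    (G_countable : countable [set: G])
    (G_exact : exact_group R G)
    (betti_gt0 : (0 < first_l2_betti R G)%E) :
  properly_proximal R G.
Proof.
have [b [F [c [cb hc pairing]]]] := betti_cocycle G_countable betti_gt0.
have [fol|nfol] := pselect (folner R G); first by case: pairing; exact: folner_pairing.
apply: (properly_proximal_of_nonfolner cb) => // M; apply: contrapT => /forallNP h; apply: pairing.
have [x bx] : exists x, forall g, b g = lreg R g x - x.
  by apply: (bounded_cocycle_inner (M := M) cb) => g; rewrite leNgt; apply/negP => /ltW; exact: h.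
rewrite -[RHS](cycle_pairing_coboundary x hc); apply: eq_bigr => g _; congr (c g _); exact: bx.
Qed.
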